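(* Let $a\in(0,1/2]$ and, for $\alpha=0,1$, let $\{\lambda_{n,\alpha}\}_{n\ge0}$ be the spectrum of the boundary value problem $\mathcal L_\alpha(q^*(x),a)$, with some common complex-valued potential $q^*\in L_2(0,1)$. For $p\in L_2(0,a)$ let $q^{[p]}\in L_2(0,1)$ be the function constructed from the two spectra, $a$ and $p$ by the procedure described in the context. Then, as $p$ ranges over $L_2(0,a)$, the functions $q^{[p]}$ form the set of all iso-bispectral potentials for the given pair of spectra, i.e. $$ \{q\in L_2(0,1):\ \{\lambda_{n,\alpha}\}_{n\ge0}\text{ is the spectrum of }\mathcal L_\alpha(q(x),a)\text{ for }\alpha=0,1\}=\{q^{[p]}:\ p\in L_2(0,a)\}. $$
   Context: For a complex-valued $q\in L_2(0,1)$, $a\in[0,1]$ and $\gamma\in\mathbb C\setminus\{0\}$, $\mathcal L(q(x),a,\gamma)$ denotes the boundary value problem $$-y''(x)+q(x)y(a)=\lambda y(x),\quad 0<x<1,\qquad y^{(\nu)}(0)=\gamma y^{(\nu)}(1),\quad \nu=0,1,$$ for $y\in W_2^2[0,1]$, with spectral parameter $\lambda\in\mathbb C$. For $\alpha\in\{0,1\}$, $\mathcal L_\alpha(q(x),a):=\mathcal L(q(x),a,(-1)^\alpha)$. Let $C(x,\lambda)$, $S(x,\lambda)$ be the solutions of the equation with $C(a,\lambda)=S'(a,\lambda)=1$, $S(a,\lambda)=C'(a,\lambda)=0$; with $\rho^2=\lambda$, $$C(x,\lambda)=\cos\rho(x-a)+\int_a^x\frac{\sin\rho(x-t)}{\rho}q(t)\,dt,\qquad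 S(x,\lambda)=\frac{\sin\rho(x-a)}{\rho}.$$ The eigenvalues of $\mathcal L(q(x),a,\gamma)$ are the zeros of the characteristic function $$\Delta(\lambda)=\begin{vmatrix} C(0,\lambda)-\gamma C(1,\lambda) & S(0,\lambda)-\gamma S(1,\lambda)\\ C'(0,\lambda)-\gamma C'(1,\lambda) & S'(0,\lambda)-\gamma S'(1,\lambda)\end{vmatrix},$$ and the spectrum is the collection of zeros of $\Delta$ counted with multiplicity (a multiset). For $\alpha=0,1$ the spectrum of $\mathcal L_\alpha$ is numbered so that $\lambda_{2k,\alpha}=(2k+\alpha)^2\pi^2+\varkappa_{k,\alpha}$ $(k\ge0)$ with $\{\varkappa_{k,\alpha}\}_{k\ge0}\in l_2$, and $\lambda_{2k-1,\alpha}=(2k-\alpha)^2\pi^2$ $(k\ge1)$. Functions in $L_2$ are complex-valued and identified when equal a.e. Construction of $q^{[p]}$: Step 1. With $\lambda^0_{2k,\alpha}=(2k+\alpha)^2\pi^2$ $(k\ge0)$, $\lambda^0_{2k-1,\alpha}=(2k-\alpha)^2\pi^2$ $(k\ge1)$, construct $$\Delta_0(\lambda)=(\lambda-\lambda_{0,0})\prod_{n=1}^\infty\frac{\lambda_{n,0}-\lambda}{\lambda^0_{n,0}},\qquad \Delta_1(\lambda)=4\prod_{n=0}^\infty\frac{\lambda_{n,1}-\lambda}{\lambda^0_{n,1}},$$ and then, for $\alpha=0,1$, the functions $w_\alpha\in L_2(0,1)$, $w_\alpha(x)=2\sum_{k=1}^\infty f_\alpha(\pi k)\sin\pi kx$ (convergence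 in $L_2(0,1)$), where $f_\alpha(\rho)=\rho\,(2-2(-1)^\alpha\cos\rho-\Delta_\alpha(\rho^2))$. Step 2. Put $q^{[p]}(a-x)=p(x)$ for $0<x<a$. Step 3. Put $q^{[p]}(a+x)=w_0(x)-q^{[p]}(a-x)$ for $0<x<a$. Step 4. Put $q^{[p]}(x)=\dfrac{w_0(x-a)+w_1(x-a)}2$ for $x\in(2a,1)$ (void if $a=1/2$). *)

(* Defs.v *)
From HB Require Import structures.
From mathcomp Require Import all_boot all_order all_algebra.
From mathcomp Require Import all_classical all_reals all_analysis.
From mathcomp Require Import complex.
Import Order.TTheory GRing.Theory Num.Theory numFieldNormedType.Exports.

Set Implicit Arguments.
Unset Strict Implicit.
Unset Printing Implicit Defensive.

Local Open Scope classical_set_scope.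
Local Open Scope complex_scope.
Local Open Scope ring_scope.

(* R[i] with the topology of its modulus, as a normed module over itself; the
   library provides this only for abstract numeric fields. *)
#[warning="-redundant-canonical-projection"]
HB.instance Definition _ (R : realType) := NormedModule.copy R[i] R[i]^o.

Section Definitions.
Variable R : realType.
Local Notation C := R[i].
Local Notation mu := (@lebesgue_measure R).
Local Notation Re := complex.Re.
Local Notation Im := complex.Im.
Local Notation normc := Normc.normc.

Definition sqnorm2 (D : set R) (f : R -> C) : \bar R :=
  (\int[mu]_(x in D) (normc (f x) ^+ 2)%:E)%E.

(* Elements of L_2 are represented by functions on the whole line, of which only
   the values on D matter, up to equality almost everywhere on D. Measurability
   is with respect to the Borel sigma-algebra, which loses no class. *)
Definition L2 (D : set R) (f : R -> C) : Prop :=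
  [/\ measurable_fun D (fun x => Re (f x)),
      measurable_fun D (fun x => Im (f x)) &
      (sqnorm2 D f < +oo)%E].

Definition cintegral (D : set R) (f : R -> C) : C :=
  (\int[mu]_(x in D) Re (f x)) +i* (\int[mu]_(x in D) Im (f x)).

(* y is in W_2^2[0,1], with derivative dy, and solves
   - y'' + q(x) y(a) = lambda y on (0,1). *)
Definition solution (q : R -> C) (a : R) (lambda : C) (y dy : R -> C) : Prop :=
  exists d2y : R -> C,
    [/\ L2 `]0, 1[ d2y,
        forall x, x \in `[0, 1] -> dy x = dy 0 + cintegral `[0, x] d2y,
        forall x, x \in `[0, 1] -> y x = y 0 + cintegral `[0, x] dy &
        {ae mu, forall x, x \in `]0, 1[ -> - d2y x + q x * y a = lambda * y x}].

(* Delta is the characteristic function of the problem L(q, a, gamma) given by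
   that equation and y(0) = gamma y(1), y'(0) = gamma y'(1). *)
Definition characteristic_function (q : R -> C) (a : R) (gamma : C)
    (Delta : C -> C) : Prop :=
  forall lambda, exists c dc s ds : R -> C,
    [/\ solution q a lambda c dc /\ solution q a lambda s ds,
        c a = 1 /\ dc a = 0,
        s a = 0 /\ ds a = 1 &
        Delta lambda = (c 0 - gamma * c 1) * (ds 0 - gamma * ds 1)
                     - (s 0 - gamma * s 1) * (dc 0 - gamma * dc 1)].

(* z is a zero of Delta of multiplicity m; m = 0 means Delta z != 0. *)
Definition zero_multiplicity (Delta : C -> C) (z : C) (m : nat) : Prop :=
  exists g : C -> C,
    [/\ \forall w \near z, derivable g w 1,
        g z != 0 &
        \forall w \near z, Delta w = (w - z) ^+ m * g w].

(* The sequence lam enumerates the zeros of the characteristic function, each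
   one as many times as its multiplicity. *)
Definition is_spectrum (q : R -> C) (a : R) (gamma : C) (lam : nat -> C) : Prop :=
  exists2 Delta, characteristic_function q a gamma Delta &
    forall z, exists2 m, zero_multiplicity Delta z m &
      ([set n | lam n = z] #= `I_m)%card.

(* The zeros (2k + alpha)^2 pi^2 at n = 2k and (2k - alpha)^2 pi^2 at n = 2k - 1
   of the case q = 0; alpha in {0, 1} is a boolean, read as a number through the
   coercion to nat. *)
Definition lambda0 (alpha : bool) (n : nat) : C :=
  (((if odd n then n.+1 - alpha else n + alpha)%N%:R * pi) ^+ 2)%:C.

Definition numbered (alpha : bool) (lam : nat -> C) : Prop :=
  (forall n, odd n -> lam n = lambda0 alpha n) /\
  cvgn (series (fun k : nat => normc (lam k.*2 - lambda0 alpha k.*2) ^+ 2)).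

Definition partial_Delta (alpha : bool) (lam : nat -> C) (N : nat) (z : C) : C :=
  if alpha
  then 4 * \prod_(0 <= n < N) ((lam n - z) / lambda0 true n)
  else (z - lam 0%N) * \prod_(1 <= n < N) ((lam n - z) / lambda0 false n).

Definition f_of (alpha : bool) (Delta : C -> C) (rho : R) : C :=
  rho%:C * (2 - 2 * (-1) ^+ alpha * (cos rho)%:C - Delta ((rho ^+ 2)%:C)).

(* w is the function w_alpha of L_2(0,1) obtained from the spectrum: the infinite
   product converges pointwise to Delta, the sine series to w in L_2(0,1). *)
Definition step1 (alpha : bool) (lam : nat -> C) (w : R -> C) : Prop :=
  exists2 Delta : C -> C,
    forall z, partial_Delta alpha lam N z @[N --> \oo] --> Delta z &
    L2 `]0, 1[ w /\
    sqnorm2 `]0, 1[ (fun x => w x - 2 * \sum_(1 <= k < N)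
        f_of alpha Delta (pi * k%:R) * (sin (pi * k%:R * x))%:C)
      @[N --> \oo] --> 0%E.

(* q is, up to equality almost everywhere on (0,1), the potential q^[p]
   constructed from the two spectra, a and p. *)
Definition constructed (lam : bool -> nat -> C) (a : R) (p q : R -> C) : Prop :=
  L2 `]0, 1[ q /\
  exists w : bool -> R -> C,
    [/\ forall alpha, step1 alpha (lam alpha) (w alpha),
        {ae mu, forall x, x \in `]0, a[ -> q (a - x) = p x},
        {ae mu, forall x, x \in `]0, a[ -> q (a + x) = w false x - q (a - x)} &
        {ae mu, forall x, x \in `](2 * a), 1[ ->
           q x = (w false (x - a) + w true (x - a)) / 2}].

End Definitions.

(* Main.v *)
From HB Require Import structures.
Require Import Defs.
From mathcomp Require Import all_boot all_order all_algebra.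
From mathcomp Require Import all_classical all_reals all_analysis.
From mathcomp Require Import measurable_realfun.
From mathcomp Require Import complex ring lra.
Import Order.TTheory GRing.Theory Num.Theory numFieldNormedType.Exports.

Set Implicit Arguments.
Unset Strict Implicit.
Unset Printing Implicit Defensive.

Local Open Scope classical_set_scope.
Local Open Scope complex_scope.
Local Open Scope ring_scope.

(* Write w_alpha(s) = Q(s) + (-1)^alpha Q(1 - s), where Q(s) is the sum of q over the points of
   (0, 1) at distance s from a. Lagrange's identity gives
     Delta(rho^2) = 2 - 2 (-1)^alpha cos rho - int_0^1 w_alpha(s) sin(rho s) / rho ds,
   so the two characteristic functions and w_0, w_1, hence Q = (w_0 + w_1) / 2, determine each other.
   On (0, a) the function Q is q(a - s) + q(a + s) and on (a, 1 - a) it is q(a + s): prescribing Q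
   leaves exactly q on (0, a) free.

   It remains to see that Step 1 recovers w_alpha from the spectrum. On the circles
   |rho| = (m + 1/2) pi, Delta divided by the partial products of its zeros is close to 1,
   because |sin rho| and |cos rho| are comparable there to exp |Im rho| and the zeros are close to those
   for q = 0, which are handled by Euler's products; these quotients are entire, so by the maximum
   principle they are close to 1 at every fixed point. Then f_alpha(pi k) is the sine
   coefficient of w_alpha, and the sine series converges because the sines are complete
   in L_2(0, 1). *)

(** * Moduli and geometric series *)

(** Holomorphy enters only through [entire]: a single coefficient sequence whose truncations have
    geometric remainders on every disc. Division by a zero, continuity and a maximum principle
    follow from these inequalities alone. The maximum principle loses a constant factor and reaches
    only a quarter of the radius, which is harmless because the circles grow while the point stays
    fixed. The quotients of Delta by partial products must be entire, whereas [is_spectrum]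
    describes multiplicities locally, by a factorization near each zero. The factors are therefore
    divided out one at a time, counting the indices that carry the same value. For q = 0 the Euler
    products come from the integrals of cos(pi t)^n cos(rho t): each is an exact identity, finite
    product times a remainder factor, and the remainder tends to 1 uniformly on discs. That a
    constructed potential has the given spectra is seen by comparison with [qstar]: both have the
    same w_0 and w_1 almost everywhere, hence the same characteristic functions. *)

Section ComplexModulus.
Variable R : realType.
Local Notation C := R[i].
Local Notation N := (@Normc.normc R).
Local Notation Re := complex.Re.
Local Notation Im := complex.Im.

Lemma normc_ge0 (z : C) : 0 <= N z.
Proof. by case: z => x y; rewrite sqrtr_ge0. Qed.

Lemma normcE (z : C) : `|z| = (N z)%:C.
Proof. by rewrite normc_def; case: z. Qed.

Lemma cReD (x y : C) : Re (x + y) = Re x + Re y. Proof. by case: x; case: y. Qed.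
Lemma cImD (x y : C) : Im (x + y) = Im x + Im y. Proof. by case: x; case: y. Qed.
Lemma cReN (x : C) : Re (- x) = - Re x. Proof. by case: x. Qed.
Lemma cImN (x : C) : Im (- x) = - Im x. Proof. by case: x. Qed.
Lemma cReM (x y : C) : Re (x * y) = Re x * Re y - Im x * Im y. Proof. by case: x; case: y. Qed.
Lemma cImM (x y : C) : Im (x * y) = Re x * Im y + Im x * Re y.
Proof. by case: x; case: y. Qed.

Lemma Re_sum I (s : seq I) (P : pred I) (F : I -> C) :
  Re (\sum_(i <- s | P i) F i) = \sum_(i <- s | P i) Re (F i).
Proof. by elim/big_ind2 : _ => // x1 x2 y1 y2 <- <-; rewrite cReD. Qed.

Lemma Im_sum I (s : seq I) (P : pred I) (F : I -> C) :
  Im (\sum_(i <- s | P i) F i) = \sum_(i <- s | P i) Im (F i).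
Proof. by elim/big_ind2 : _ => // x1 x2 y1 y2 <- <-; rewrite cImD. Qed.

Lemma normcD_le (x y : C) : N (x + y) <= N x + N y.
Proof. by rewrite -lecR rmorphD /= -!normcE ler_normD. Qed.

Lemma normcB_le (x y : C) : N (x - y) <= N x + N y.
Proof. by rewrite -(normcN y) normcD_le. Qed.

Lemma normcBC (x y : C) : N (x - y) = N (y - x).
Proof. by rewrite -normcN opprB. Qed.

Lemma normcR (x : R) : N x%:C = `|x|.
Proof. by rewrite /= expr0n addr0 sqrtr_sqr. Qed.

Lemma normc_nat n : N n%:R = n%:R.
Proof. by rewrite -(rmorph_nat (real_complex R)) normcR ger0_norm. Qed.

Lemma normc0r : N 0 = 0. Proof. exact: Normc.normc0. Qed.
Lemma normc1r : N 1 = 1. Proof. exact: Normc.normc1. Qed.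

Lemma normcX (z : C) n : N (z ^+ n) = N z ^+ n.
Proof. by elim: n => [|n IH]; rewrite ?expr0 ?normc1r // !exprS Normc.normcM IH. Qed.

Lemma normc_sqr (z : C) : N z ^+ 2 = Re z ^+ 2 + Im z ^+ 2.
Proof. by case: z => x y /=; rewrite sqr_sqrtr // addr_ge0 // sqr_ge0. Qed.

Lemma normRe (z : C) : `|Re z| <= N z.
Proof.
rewrite -(@ler_pXn2r _ 2) ?nnegrE ?normc_ge0 // normc_sqr real_normK ?num_real //.
by rewrite lerDl sqr_ge0.
Qed.

Lemma normIm (z : C) : `|Im z| <= N z.
Proof.
rewrite -(@ler_pXn2r _ 2) ?nnegrE ?normc_ge0 // normc_sqr real_normK ?num_real //.
by rewrite lerDr sqr_ge0.
Qed.

Lemma normc_le_ReIm (z : C) : N z <= `|Re z| + `|Im z|.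
Proof.
rewrite {1}(complexE z); apply: le_trans (normcD_le _ _) _.
by rewrite Normc.normcM !normcR /= expr0n add0r expr1n sqrtr1 mul1r.
Qed.

Lemma normc_sum I (s : seq I) (P : pred I) (F : I -> C) :
  N (\sum_(i <- s | P i) F i) <= \sum_(i <- s | P i) N (F i).
Proof.
elim/big_ind2 : _ => [|x a y b xa yb|//]; first by rewrite normc0r.
by apply: le_trans (normcD_le _ _) _; rewrite lerD.
Qed.

Lemma normc_eq0 (z : C) : (N z == 0) = (z == 0).
Proof. by apply/eqP/eqP => [/Normc.eq0_normc//|->]; rewrite normc0r. Qed.

Lemma normc_gt0 (z : C) : (0 < N z) = (z != 0).
Proof. by rewrite lt0r normc_eq0 normc_ge0 andbT. Qed.

(** Multiplying by a unit reduces a bound on the modulus of an integral, or of a value obtained from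
    a derivative, to a bound on one real part. *)
Lemma normc_rotate (z : C) : exists2 u : C, N u = 1 & Re (u * z) = N z.
Proof.
have [->|z0] := eqVneq z 0; first by exists 1; rewrite ?normc1r // mulr0 normc0r.
have h : 0 < N z by rewrite normc_gt0.
exists (z^* * (N z)^-1%:C)%C.
  rewrite Normc.normcM normcR gtr0_norm ?invr_gt0 //.
  suff -> : N z^*%C = N z by rewrite divff // gt_eqF.
  by case: (z) => x y /=; rewrite sqrrN.
rewrite mulrAC (mulrC _ z).
have -> : z * z^*%C = (N z ^+ 2)%:C.
  by rewrite normc_sqr; case: (z) => x y; apply/eqP; rewrite eq_complex /=; apply/andP; split; apply/eqP; ring.
by rewrite -rmorphM /= expr2 mulfK // gt_eqF.
Qed.

(** This is how limits are taken below: identities and bounds for power series are proved up to an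
    error K q^n and the error is then discarded. *)
Lemma le_geom_limit (x y K q : R) : 0 <= q -> q < 1 ->
  (forall n, x <= y + K * q ^+ n) -> x <= y.
Proof.
move=> q0 q1 H.
have cv : y + K * q ^+ n @[n --> \oo] --> y.
  rewrite -[X in _ --> X]addr0; apply: cvgD; first exact: cvg_cst.
  by rewrite -(mulr0 K); apply: cvgM; [exact: cvg_cst|apply: cvg_expr; rewrite ger0_norm].
rewrite -(cvg_lim _ cv) //; apply: limr_ge; first by apply/cvg_ex; exists y.
by near=> n; apply: H.
Unshelve. all: by end_near. Qed.

Lemma geom_tail_le (K q : R) m n : 0 <= K -> 0 <= q <= 1 / 2 ->
  \sum_(m <= k < n) K * q ^+ k <= 2 * K * q ^+ m.
Proof.
move=> K0 /andP[q0 q1].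
have [nm|mn] := leqP n m; first by rewrite big_geq // !mulr_ge0 // exprn_ge0.
suff H d : \sum_(m <= k < m + d) K * q ^+ k <= 2 * K * (q ^+ m - q ^+ (m + d)).
  rewrite -(subnKC (ltnW mn)); apply: le_trans (H _) _.
  by rewrite ler_wpM2l ?mulr_ge0 // gerBl exprn_ge0.
elim: d => [|d IH]; first by rewrite addn0 big_geq // subrr mulr0.
rewrite addnS big_nat_recr ?leq_addr //=; apply: le_trans (lerD IH (lexx _)) _.
have h : 0 <= K * q ^+ (m + d) by rewrite mulr_ge0 ?exprn_ge0.
rewrite exprS -subr_ge0.
have -> : 2 * K * (q ^+ m - q * q ^+ (m + d)) -
  (2 * K * (q ^+ m - q ^+ (m + d)) + K * q ^+ (m + d)) =
  K * q ^+ (m + d) * (1 - 2 * q) by ring.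
by rewrite mulr_ge0 //; lra.
Qed.

(** The sum L is chosen before K and q, so one value serves all majorants; a power series thus gets
    a single sum function valid for every radius. *)
Lemma geom_series_real (t : nat -> R) : exists L, forall K q, 0 <= q <= 1 / 2 ->
  (forall k, `|t k| <= K * q ^+ k) ->
  forall n, `|L - \sum_(k < n) t k| <= 2 * K * q ^+ n.
Proof.
exists (limn (series t)) => K q q01 tK n.
have K0 : 0 <= K by have := le_trans (normr_ge0 _) (tK 0%N); rewrite expr0 mulr1.
have cv : cvgn (series t).
  apply: normed_cvg; apply: (@series_le_cvg _ _ (geometric K q)) => [k|k|k|]; rewrite /=.
  - by [].
  - by case/andP: q01 => q0 _; rewrite mulr_ge0 // exprn_ge0.
  - exact: tK.
  - by apply: is_cvg_geometric_series; case/andP: q01 => q0 q1; rewrite ger0_norm //; lra.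
have cvN : `|series t m - \sum_(k < n) t k| @[m --> \oo] --> `|limn (series t) - \sum_(k < n) t k|.
  apply: cvg_norm; apply: cvgB; [exact: cv|exact: cvg_cst].
rewrite -(cvg_lim _ cvN) //; apply: limr_le; first by apply/cvg_ex; eexists; exact: cvN.
exists n => // m /= nm.
rewrite /series /= (big_cat_nat _ nm) //= big_mkord addrAC subrr add0r.
apply: le_trans (ler_norm_sum _ _ _) _; apply: le_trans (geom_tail_le n m K0 q01).
by apply: ler_sum => k _; exact: tK.
Qed.

Lemma geom_series (t : nat -> C) : exists L, forall K q, 0 <= q <= 1 / 2 ->
  (forall k, N (t k) <= K * q ^+ k) ->
  forall n, N (L - \sum_(k < n) t k) <= 4 * K * q ^+ n.
Proof.
have [a Ha] := geom_series_real (fun k => Re (t k)).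
have [b Hb] := geom_series_real (fun k => Im (t k)).
exists (a +i* b) => K q q01 tK n.
apply: le_trans (normc_le_ReIm _) _.
have -> : 4 * K * q ^+ n = 2 * K * q ^+ n + 2 * K * q ^+ n by ring.
apply: lerD.
- have -> : Re (a +i* b - \sum_(k < n) t k) = a - \sum_(k < n) Re (t k).
    by rewrite cReD cReN Re_sum.
  by apply: Ha => // k; apply: le_trans (normRe _) (tK k).
- have -> : Im (a +i* b - \sum_(k < n) t k) = b - \sum_(k < n) Im (t k).
    by rewrite cImD cImN Im_sum.
  by apply: Hb => // k; apply: le_trans (normIm _) (tK k).
Qed.

End ComplexModulus.

(** * Entire functions *)

Section Entire.
Variable R : realType.
Local Notation C := R[i].
Local Notation N := (@Normc.normc R).

(** The case n = 0 bounds F by K on the disc; for |z| < r the inequalities say that the series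
    converges to F z at a geometric rate. *)
Definition taylor_on (r K : R) (F : C -> C) (c : nat -> C) : Prop :=
  forall n z, N z <= r -> N (F z - \sum_(k < n) c k * z ^+ k) <= K * (N z / r) ^+ n.

Definition entire (F : C -> C) : Prop :=
  exists c, forall r, 0 < r -> exists K, taylor_on r K F c.

Lemma taylor_on_ge0 r K F c : 0 < r -> taylor_on r K F c -> 0 <= K.
Proof.
move=> r0 /(_ 0%N 0); rewrite normc0r expr0 mulr1 => H.
by apply: le_trans (normc_ge0 _) (H (ltW r0)).
Qed.

Lemma taylor_on_coef0 r K F c : 0 < r -> taylor_on r K F c -> F 0 = c 0%N.
Proof.
move=> r0 /(_ 1%N 0); rewrite normc0r mul0r expr1 mulr0 big_ord1 expr0 mulr1 => /(_ (ltW r0)) H.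
by apply/eqP; rewrite -subr_eq0 -normc_eq0 eq_le normc_ge0 andbT.
Qed.

Lemma taylor_on_shift r K F c : 0 < r -> taylor_on r K F c ->
  taylor_on r (K / r) (fun z => if z == 0 then c 1%N else (F z - c 0%N) / z) (fun k => c k.+1).
Proof.
move=> r0 H n z zr.
have K0 := taylor_on_ge0 r0 H.
have [->|z0] := eqVneq z 0.
  case: n => [|n]; last first.
    rewrite big_ord_recl expr0 mulr1 big1 ?addr0 ?subrr ?normc0r ?mul0r ?expr0n ?mulr0 //.
    by move=> i _; rewrite expr0n mulr0.
  rewrite big_ord0 subr0 expr0 mulr1.
  (* At the origin the bound on c 1 is read off from the remainders of orders 1 and 2 at the points
     e = r / 2^m, which give |c 1| e <= K (e / r) + K (e / r)^2. *)
  apply: (@le_geom_limit _ _ _ (K / r) (1/2)) => [||m]; [lra|lra|].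
  have hz : 0 < r * (1/2) ^+ m by rewrite mulr_gt0 // exprn_gt0 //; lra.
  have hq : r * (1/2) ^+ m <= r.
    by apply: ler_piMr; [exact: ltW|apply: exprn_ile1; lra].
  have := H 2 (r * (1/2) ^+ m)%:C; rewrite normcR (gtr0_norm hz) => /(_ hq).
  have := H 1%N (r * (1/2) ^+ m)%:C; rewrite normcR (gtr0_norm hz) => /(_ hq).
  rewrite !big_ord_recr big_ord0 /= add0r expr0 mulr1 expr1.
  set e := r * _ in hz hq *; set f := F _ => H1 H2.
  have : N (c 1%N * e%:C) <= K * (e / r) ^+ 1 + K * (e / r) ^+ 2.
    have -> : c 1%N * e%:C = (f - c 0%N) - (f - (c 0%N + c 1%N * e%:C)) by ring.
    by apply: le_trans (normcB_le _ _) _; rewrite lerD.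
  rewrite Normc.normcM normcR (gtr0_norm hz) -ler_pdivlMr // => /le_trans; apply.
  rewrite le_eqVlt; apply/orP; left; apply/eqP.
  have -> : (1/2) ^+ m = e / r :> R by rewrite /e mulrAC divff ?mul1r // gt_eqF.
  by field; rewrite !gt_eqF.
have nz : 0 < N z by rewrite normc_gt0.
have := H n.+1 z zr; rewrite big_ord_recl expr0 mulr1.
have -> : F z - (c 0%N + \sum_(i < n) c (bump 0 i) * z ^+ bump 0 i) =
   ((F z - c 0%N) / z - \sum_(k < n) c k.+1 * z ^+ k) * z.
  rewrite mulrBl divfK // mulr_suml opprD addrA; congr (_ - _).
  by apply: eq_bigr => i _; rewrite /bump /= add1n exprSr mulrA.
rewrite Normc.normcM -ler_pdivlMr // => /le_trans; apply.
rewrite exprS le_eqVlt; apply/orP; left; apply/eqP.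
by field; rewrite !gt_eqF.
Qed.

(** Both square roots of u enter symmetrically, so the choice made by [sqrtc] is immaterial. Odd
    powers cancel, and the remainders of order 2n at the two roots give order n in u. *)
Lemma taylor_on_even r K F c : 0 < r -> taylor_on r K F c ->
  taylor_on (r ^+ 2) K (fun u => (F (sqrtc u) + F (- sqrtc u)) / 2) (fun k => c k.*2).
Proof.
move=> r0 H n u; set z := sqrtc u.
have uz : u = z ^+ 2 by rewrite sqr_sqrtc.
rewrite uz normcX ler_pXn2r ?nnegrE ?normc_ge0 ?(ltW r0) // => zr.
have H1 := H n.*2 z zr; have H2 := H n.*2 (- z); rewrite normcN in H2; move: (H2 zr) => {}H2.
have -> : (F z + F (- z)) / 2 - \sum_(k < n) c k.*2 * (z ^+ 2) ^+ k =
  ((F z - \sum_(k < n.*2) c k * z ^+ k) + (F (- z) - \sum_(k < n.*2) c k * (- z) ^+ k)) * (1/2)%:C.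
  have -> : \sum_(k < n) c k.*2 * (z ^+ 2) ^+ k =
    (\sum_(k < n.*2) c k * z ^+ k + \sum_(k < n.*2) c k * (- z) ^+ k) / 2.
    elim: n {H1 H2} => [|n IH]; first by rewrite !big_ord0 addr0 mul0r.
    rewrite doubleS !big_ord_recr /= IH.
    have -> : (- z) ^+ n.*2 = z ^+ n.*2 by rewrite -mul2n !exprM sqrrN.
    have -> : (- z) ^+ n.*2.+1 = - z ^+ n.*2.+1 by rewrite !exprS -mul2n !exprM sqrrN mulNr.
    by rewrite -exprM mul2n; field.
  rewrite (_ : (1/2)%:C = 1/2 :> C); last by rewrite rmorphM fmorphV /= !rmorph_nat.
  by field.
rewrite Normc.normcM normcR ger0_norm; last lra.
have -> : K * (N z ^+ 2 / r ^+ 2) ^+ n = (K * (N z / r) ^+ n.*2 + K * (N z / r) ^+ n.*2) * (1/2).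
  by rewrite -expr_div_n -exprM mul2n; field.
rewrite ler_wpM2r //.
by apply: le_trans (normcD_le _ _) _; rewrite lerD.
Qed.

(** Each averaging squares both radii, so after s rounds the gap between the function and its
    constant term is only K (r1 / r)^(2^s). *)
Lemma max_coef0_iter s F c r r1 K M : 0 < r1 < r -> taylor_on r K F c ->
  (forall w, N w = r1 -> N (F w) <= M) -> N (c 0%N) <= M + K * (r1 / r) ^+ (2 ^ s).
Proof.
elim: s F c r r1 => [|s IH] F c r r1 /andP[r10 r1r] H FM.
  rewrite expn0; have r0 := lt_trans r10 r1r.
  have := H 1%N r1%:C; rewrite normcR gtr0_norm // (ltW r1r) big_ord1 expr0 mulr1 => /(_ isT) H1.
  have -> : c 0%N = F r1%:C - (F r1%:C - c 0%N) by ring.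
  apply: le_trans (normcB_le _ _) _; apply: lerD => //; apply: FM.
  by rewrite normcR gtr0_norm.
have r0 := lt_trans r10 r1r.
have := IH _ _ _ (r1 ^+ 2) _ (taylor_on_even r0 H).
rewrite -expr_div_n -exprM -expnS; apply.
  by rewrite exprn_gt0 // ltr_pXn2r // nnegrE ltW.
move=> w wr; have zr : N (sqrtc w) = r1.
  by apply/eqP; rewrite -(@eqrXn2 _ 2) ?normc_ge0 ?ltW // -normcX sqr_sqrtc wr.
rewrite (_ : 2 = 2%:C :> C); last by rewrite rmorph_nat.
rewrite -fmorphV /= Normc.normcM normcR ger0_norm ?invr_ge0 // ler_pdivrMr //.
apply: le_trans (normcD_le _ _) _; rewrite mulr_natr mulr2n.
by rewrite lerD // FM // normcN.
Qed.

(* Averaging [F] over [{z, -z}] turns it into a power series in [z ^+ 2] with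
   the same constant term and no larger bound; iterating, only the constant term survives. *)
Lemma max_coef0 F c r r1 K M : 0 < r1 < r -> taylor_on r K F c ->
  (forall w, N w = r1 -> N (F w) <= M) -> N (c 0%N) <= M.
Proof.
move=> r1r H FM; have /andP[r10 r1lr] := r1r; have r0 := lt_trans r10 r1lr.
have K0 := taylor_on_ge0 r0 H.
have q0 : 0 <= r1 / r by rewrite divr_ge0 // ltW.
have q1 : r1 / r < 1 by rewrite ltr_pdivrMr // mul1r.
apply: (@le_geom_limit _ _ _ K (r1 / r)) => // n.
apply: le_trans (max_coef0_iter n r1r H FM) _; rewrite lerD2l ler_wpM2l //.
by apply: ler_wiXn2l => //; [exact: ltW|exact/ltnW/ltn_expl].
Qed.

(** A Cauchy estimate with loss 2^k: passing from F to (F - c 0) / z at most doubles the bound on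
    the circle, because |c 0| <= M, and divides it by r1. *)
Lemma max_coef F c r r1 K M k : 0 < r1 < r -> taylor_on r K F c ->
  (forall w, N w = r1 -> N (F w) <= M) -> N (c k) * r1 ^+ k <= 2 ^+ k * M.
Proof.
elim: k F c K M => [|k IH] F c K M r1r H FM.
  by rewrite !expr0 mulr1 mul1r (max_coef0 r1r H).
have /andP[r10 r1lr] := r1r; have r0 := lt_trans r10 r1lr.
have := IH _ _ _ (2 * M / r1) r1r (taylor_on_shift r0 H).
move=> h; rewrite exprSr mulrA -ler_pdivlMr //; apply: le_trans (h _) _ => [w wr|].
  have w0 : w == 0 = false by rewrite -normc_eq0 wr gt_eqF.
  rewrite w0 Normc.normcM Normc.normcV wr ler_pM2r ?invr_gt0 //.
  apply: le_trans (normcB_le _ _) _; rewrite mulr_natl mulr2n lerD ?FM //.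
  exact: max_coef0 r1r H FM.
by rewrite exprSr !mulrA.
Qed.

(** The restriction to |z| <= r / 4 absorbs the factors 2^k of [max_coef]: the k-th term is at most
    M / 2^k. *)
Lemma entire_max F r M z : entire F -> 0 < r -> 4 * N z <= r ->
  (forall w, N w = r -> N (F w) <= M) -> N (F z) <= 2 * M.
Proof.
move=> [c Hc] r0 zr FM.
have r20 : 0 < 2 * r by rewrite mulr_gt0.
have [K H] := Hc _ r20; have K0 := taylor_on_ge0 r20 H.
have M0 : 0 <= M.
  by apply: le_trans (normc_ge0 _) (FM r%:C _); rewrite normcR gtr0_norm.
have nz := normc_ge0 z.
apply: (@le_geom_limit _ _ _ K (1/2)) => [||n]; [lra|lra|].
have -> : F z = \sum_(k < n) c k * z ^+ k + (F z - \sum_(k < n) c k * z ^+ k).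
  by rewrite addrC subrK.
apply: le_trans (normcD_le _ _) _; apply: lerD.
  apply: le_trans (normc_sum _ _ _) _.
  apply: (@le_trans _ _ (\sum_(0 <= k < n) M * (1/2) ^+ k)).
    rewrite big_mkord; apply: ler_sum => k _; rewrite Normc.normcM normcX.
    have r1r : 0 < r < 2 * r by rewrite r0 /=; lra.
    have := max_coef k r1r H FM; rewrite -ler_pdivlMr ?exprn_gt0 // => h.
    apply: le_trans (ler_wpM2r (exprn_ge0 _ nz) h) _.
    have -> : 2 ^+ k * M / r ^+ k * N z ^+ k = M * (2 * N z / r) ^+ k.
      by rewrite expr_div_n exprMn; ring.
    rewrite ler_wpM2l // lerXn2r ?nnegrE //; first by rewrite divr_ge0 ?mulr_ge0 // ltW.
    by rewrite ler_pdivrMr //; lra.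
  have := @geom_tail_le _ M (1/2) 0 n M0; rewrite expr0 mulr1; apply; lra.
apply: le_trans (H n z _) _; first lra.
rewrite ler_wpM2l // lerXn2r ?nnegrE //; first by rewrite divr_ge0 // ltW.
by rewrite ler_pdivrMr //; lra.
Qed.

Lemma entire_bounded F r : entire F -> exists M, forall z, N z <= r -> N (F z) <= M.
Proof.
move=> [c Hc].
have r0 : 0 < `|r| + 1 by rewrite ltr_wpDl.
have [K H] := Hc _ r0; exists K => z zr.
have := H 0%N z; rewrite big_ord0 subr0 expr0 mulr1; apply.
by apply: le_trans zr _; rewrite (le_trans (ler_norm r)) // lerDl.
Qed.

Lemma entire_coef (d : nat -> C) :
  (forall r, 0 < r -> exists K, forall k, N (d k) <= K / r ^+ k) ->
  exists F : C -> C, forall r, 0 < r -> exists K, taylor_on r K F d.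
Proof.
move=> Hd.
have /choice[F HF] : forall z, exists L, forall K q, 0 <= q <= 1 / 2 ->
  (forall k, N (d k * z ^+ k) <= K * q ^+ k) ->
  forall n, N (L - \sum_(k < n) d k * z ^+ k) <= 4 * K * q ^+ n.
  by move=> z; apply: geom_series.
exists F => r r0.
have r20 : 0 < 2 * r by rewrite mulr_gt0.
have [K HK] := Hd _ r20; exists (4 * K) => n z zr.
have K0 : 0 <= K by have := le_trans (normc_ge0 _) (HK 0%N); rewrite expr0 divr1.
have nz := normc_ge0 z.
have q0 : 0 <= N z / (2 * r) by rewrite divr_ge0 // ltW.
apply: (@le_trans _ _ (4 * K * (N z / (2 * r)) ^+ n)).
  apply: HF => [|k].
    by rewrite q0 /= ler_pdivrMr //; lra.
  rewrite Normc.normcM normcX; apply: le_trans (ler_wpM2r (exprn_ge0 _ nz) (HK k)) _.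
  by rewrite expr_div_n -mulrA (mulrC _^-1).
rewrite ler_wpM2l ?mulr_ge0 // lerXn2r ?nnegrE //; first by rewrite divr_ge0 // ltW.
rewrite ler_wpM2l // lef_pV2 ?posrE //; lra.
Qed.

(** For z0 != 0 the coefficients d j of the quotient come from long division. Since F z0 = 0, the
    partial sum in d j is, up to sign, a remainder of F at z0, hence small; taking the radius at
    least |z0| makes the bound hold at every r. *)
Lemma entire_div F z0 : entire F -> F z0 = 0 ->
  exists2 G, entire G & forall z, F z = (z - z0) * G z.
Proof.
move=> [c Hc] F0.
have [z00|z00] := eqVneq z0 0.
  rewrite z00 in F0 *.
  have [K1 H1] := Hc _ ltr01.
  have c0 : c 0%N = 0 by rewrite -(taylor_on_coef0 ltr01 H1).
  exists (fun z => if z == 0 then c 1%N else (F z - c 0%N) / z).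
    exists (fun k => c k.+1) => r r0; have [K H] := Hc _ r0.
    by exists (K / r); exact: taylor_on_shift.
  move=> z; rewrite subr0 c0 subr0; case: eqP => [->|/eqP zn0]; first by rewrite mul0r.
  by rewrite mulrC divfK.
have nz0 : 0 < N z0 by rewrite normc_gt0.
pose d j := - (\sum_(k < j.+1) c k * z0 ^+ k) / z0 ^+ j.+1.
have [G HG] : exists G : C -> C, forall r, 0 < r -> exists K, taylor_on r K G d.
  apply: entire_coef => r r0.
  pose r' := Num.max r (N z0).
  have r'0 : 0 < r' by rewrite lt_max r0.
  have [K H] := Hc _ r'0; have K0 := taylor_on_ge0 r'0 H.
  exists (K / r') => k.
  have -> : d k = (F z0 - \sum_(k < k.+1) c k * z0 ^+ k) / z0 ^+ k.+1.
    by rewrite F0 sub0r.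
  rewrite Normc.normcM Normc.normcV normcX ler_pdivrMr ?exprn_gt0 //.
  apply: le_trans (H _ _ _) _; first by rewrite le_max lexx orbT.
  rewrite expr_div_n (exprS r').
  have -> : K / r' / r ^+ k * N z0 ^+ k.+1 = K * (N z0 ^+ k.+1 / (r' * r ^+ k)).
    by rewrite invfM; ring.
  rewrite ler_wpM2l // ler_wpM2l ?exprn_ge0 ?(ltW nz0) // lef_pV2 ?posrE ?mulr_gt0 ?exprn_gt0 //.
  by rewrite ler_pM2l // lerXn2r ?nnegrE ?(ltW r0) ?(ltW r'0) // le_max lexx.
exists G; first by exists d.
move=> z; pose r := 2 * N z + 1.
have nz := normc_ge0 z.
have r0 : 0 < r by rewrite /r; lra.
have [K H] := Hc _ r0; have [K' H'] := HG _ r0.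
have K0 := taylor_on_ge0 r0 H; have K'0 := taylor_on_ge0 r0 H'.
have zr : N z <= r by rewrite /r; lra.
(* The product with the truncated quotient telescopes to the truncation of F plus one boundary term,
   which is estimated at the end as z times the difference of two consecutive remainders of G. The
   radius 2 |z| + 1 keeps all ratios below 1/2. *)
have id n : (z - z0) * (\sum_(k < n) d k * z ^+ k) =
   \sum_(k < n) c k * z ^+ k + (if n is n'.+1 then d n' * z ^+ n else 0).
  elim: n => [|n IH]; first by rewrite !big_ord0 mulr0 addr0.
  rewrite !big_ord_recr /= mulrDr IH.
  have dr : d n = - c n / z0 + (if n is n'.+1 then d n' / z0 else 0).
    rewrite /d big_ord_recr /=; case: n {IH} => [|n].
      by rewrite big_ord0 expr0 expr1 addr0 mulr1 add0r.
    have zn : z0 ^+ n.+1 != 0 by rewrite expf_neq0.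
    by rewrite (exprS _ n.+1); field; rewrite z00 zn.
  have -> : (z - z0) * (d n * z ^+ n) = d n * z ^+ n.+1 - z0 * d n * z ^+ n.
    by rewrite exprS; ring.
  have -> : z0 * d n = - c n + (if n is n'.+1 then d n' else 0).
    by rewrite dr; case: (n) => [|n']; field.
  by case: (n) => [|n']; ring.
apply/eqP; rewrite -subr_eq0 -normc_eq0 eq_le normc_ge0 andbT.
apply: (@le_geom_limit _ _ _ (K + N (z - z0) * K' + 2 * K' * N z + 2 * K' * r) (1/2)) => [||n]; [lra|lra|].
rewrite add0r.
have q2 : 0 <= N z / r <= 1/2.
  by rewrite divr_ge0 ?(ltW r0) //= ler_pdivrMr // /r; lra.
have {q2}[q0 q1] := andP q2.
have qn m : (N z / r) ^+ m <= (1/2) ^+ m.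
  by rewrite lerXn2r ?nnegrE //; lra.
have -> : F z - (z - z0) * G z = (F z - \sum_(k < n) c k * z ^+ k)
   - (z - z0) * (G z - \sum_(k < n) d k * z ^+ k)
   - (if n is n'.+1 then d n' * z ^+ n else 0).
  rewrite mulrBr id; case: (n) => [|n']; ring.
apply: le_trans (normcB_le _ _) _.
rewrite (_ : _ * (1/2) ^+ n = (K + N (z - z0) * K') * (1/2) ^+ n + (2 * K' * N z + 2 * K' * r) * (1/2) ^+ n); last by ring.
apply: lerD.
  apply: le_trans (normcB_le _ _) _; rewrite [leRHS]mulrDl; apply: lerD.
    apply: le_trans (H n z zr) _; by rewrite ler_wpM2l.
  rewrite Normc.normcM -mulrA ler_wpM2l ?normc_ge0 //.
  apply: le_trans (H' n z zr) _; by rewrite ler_wpM2l.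
case: n => [|n]; first by rewrite normc0r mulr_ge0 ?exprn_ge0 ?addr_ge0 ?mulr_ge0 ?(ltW r0).
have -> : d n * z ^+ n.+1 = z * ((G z - \sum_(k < n) d k * z ^+ k) - (G z - \sum_(k < n.+1) d k * z ^+ k)).
  by rewrite big_ord_recr /= exprS; ring.
rewrite Normc.normcM.
apply: (@le_trans _ _ (N z * (K' * (1/2) ^+ n + K' * (1/2) ^+ n.+1))).
  rewrite ler_wpM2l //; apply: le_trans (normcB_le _ _) _; apply: lerD.
    apply: le_trans (H' n z zr) _; by rewrite ler_wpM2l.
  apply: le_trans (H' n.+1 z zr) _; by rewrite ler_wpM2l.
rewrite -subr_ge0.
have -> : (2 * K' * N z + 2 * K' * r) * (1 / 2) ^+ n.+1 -
  N z * (K' * (1 / 2) ^+ n + K' * (1 / 2) ^+ n.+1) = (1/2) ^+ n * K' * (r - N z / 2).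
  by rewrite exprS; field.
by rewrite !mulr_ge0 ?exprn_ge0 //; rewrite /r; lra.
Qed.

(** F - F z vanishes at z, so it is w - z times an entire function, which is bounded near z. *)
Lemma entire_lipschitz F z : entire F -> exists M, forall w, N (w - z) <= 1 ->
  N (F w - F z) <= M * N (w - z).
Proof.
move=> [c Hc].
have [G EG HG] : exists2 G, entire G & forall w, F w - F z = (w - z) * G w.
  apply: (@entire_div (fun w => F w - F z)); last by rewrite subrr.
  exists (fun k => if k is 0 then c 0%N - F z else c k) => r r0.
  have [K H] := Hc _ r0; have K0 := taylor_on_ge0 r0 H; exists (K + N (F z)) => -[|n] w wr.
    rewrite big_ord0 subr0 expr0 mulr1; apply: le_trans (normcB_le _ _) _.
    by rewrite lerD2r; have := H 0%N w wr; rewrite expr0 mulr1 big_ord0 subr0.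
  have := H n.+1 w wr; rewrite !big_ord_recl /=.
  have -> : F w - F z - ((c 0%N - F z) * w ^+ 0 + \sum_(i < n) c (bump 0 i) * w ^+ bump 0 i)
     = F w - (c 0%N * w ^+ 0 + \sum_(i < n) c (bump 0 i) * w ^+ bump 0 i) by rewrite expr0; ring.
  move=> /le_trans; apply; rewrite ler_wpM2r ?exprn_ge0 ?divr_ge0 ?normc_ge0 ?(ltW r0) //.
  by rewrite lerDl normc_ge0.
have [M HM] := entire_bounded (N z + 1) EG.
exists M => w wz; rewrite HG Normc.normcM mulrC ler_wpM2r ?normc_ge0 // HM //.
have -> : w = z + (w - z) by ring.
by apply: le_trans (normcD_le _ _) _; rewrite lerD2l.
Qed.

End Entire.

(** * Cosine and sine of a square root *)

Section CDeriv.
Variable R : realType.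
Local Notation C := R[i].
Local Notation N := (@Normc.normc R).
Local Notation Re := complex.Re.
Local Notation Im := complex.Im.

Definition cderiv (f df : R -> C) : Prop := forall x : R,
  is_derive x 1 (fun t => Re (f t)) (Re (df x)) /\ is_derive x 1 (fun t => Im (f t)) (Im (df x)).

Lemma is_derive_val (f : R -> R) (x v w : R) : is_derive x 1 f v -> v = w -> is_derive x 1 f w.
Proof. by move=> h <-. Qed.

Lemma cderiv_eq f df dg : cderiv f df -> df =1 dg -> cderiv f dg.
Proof. by move=> h e x; rewrite -e. Qed.

Lemma cderiv_cst (c : C) : cderiv (fun=> c) (fun=> 0).
Proof. by move=> x; split; exact: is_derive_cst. Qed.

Lemma cderivD f df g dg : cderiv f df -> cderiv g dg ->
  cderiv (fun x => f x + g x) (fun x => df x + dg x).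
Proof.
move=> hf hg x; have [f1 f2] := hf x; have [g1 g2] := hg x; split.
- rewrite cReD (_ : (fun t => _) = (fun t => Re (f t)) \+ (fun t => Re (g t))); last first.
    by apply/funext => t /=; rewrite cReD.
  exact: is_deriveD.
- rewrite cImD (_ : (fun t => _) = (fun t => Im (f t)) \+ (fun t => Im (g t))); last first.
    by apply/funext => t /=; rewrite cImD.
  exact: is_deriveD.
Qed.

Lemma cderivM f df g dg : cderiv f df -> cderiv g dg ->
  cderiv (fun x => f x * g x) (fun x => df x * g x + f x * dg x).
Proof.
move=> hf hg x; have [f1 f2] := hf x; have [g1 g2] := hg x; split.
- rewrite (_ : (fun t => _) = ((fun t => Re (f t)) * (fun t => Re (g t))) -
    ((fun t => Im (f t)) * (fun t => Im (g t)))); last first.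
    by apply/funext => t /=; rewrite cReM.
  apply: is_derive_val (is_deriveB (is_deriveM f1 g1) (is_deriveM f2 g2)) _.
  by rewrite cReD !cReM /GRing.scale /=; ring.
- rewrite (_ : (fun t => _) = ((fun t => Re (f t)) * (fun t => Im (g t))) +
    ((fun t => Im (f t)) * (fun t => Re (g t)))); last first.
    by apply/funext => t /=; rewrite cImM.
  apply: is_derive_val (is_deriveD (is_deriveM f1 g2) (is_deriveM f2 g1)) _.
  by rewrite cImD !cImM /GRing.scale /=; ring.
Qed.

Lemma cderivZ (c : C) f df : cderiv f df -> cderiv (fun x => c * f x) (fun x => c * df x).
Proof.
move=> hf; apply: cderiv_eq (cderivM (cderiv_cst c) hf) _ => x.
by rewrite mul0r add0r.
Qed.

Lemma cderivB f df g dg : cderiv f df -> cderiv g dg ->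
  cderiv (fun x => f x - g x) (fun x => df x - dg x).
Proof.
move=> hf hg; have := cderivD hf (cderivZ (-1) hg).
rewrite (_ : (fun x => f x + _) = (fun x => f x - g x)); last by apply/funext => x; rewrite mulN1r.
by move/cderiv_eq; apply => x; rewrite mulN1r.
Qed.

Lemma cderiv_real (f df : R -> R) : (forall x, is_derive x (1:R) f (df x)) ->
  cderiv (fun x => (f x)%:C) (fun x => (df x)%:C).
Proof. by move=> h x; split=> /=; [exact: h|exact: is_derive_cst]. Qed.

Lemma cderiv_sum n (f df : nat -> R -> C) : (forall k, cderiv (f k) (df k)) ->
  cderiv (fun x => \sum_(k < n) f k x) (fun x => \sum_(k < n) df k x).
Proof.
move=> h; elim: n => [|n IH].
  rewrite (_ : (fun x => \sum_(k < 0) f k x) = fun=> 0); last by apply/funext => x; rewrite big_ord0.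
  by apply: cderiv_eq (cderiv_cst 0) _ => x; rewrite big_ord0.
rewrite (_ : (fun x => \sum_(k < n.+1) f k x) = fun x => \sum_(k < n) f k x + f n x); last first.
  by apply/funext => x; rewrite big_ord_recr.
by apply: cderiv_eq (cderivD IH (h n)) _ => x; rewrite big_ord_recr.
Qed.

Lemma le_of_deriv (f df g dg : R -> R) x : 0 <= x ->
  (forall t, is_derive t (1:R) f (df t)) -> (forall t, is_derive t (1:R) g (dg t)) ->
  f 0 <= g 0 -> (forall t, 0 <= t <= x -> df t <= dg t) -> f x <= g x.
Proof.
move=> x0 hf hg fg0 H.
have hd t : is_derive t (1:R) (g - f) (dg t - df t) by apply: is_deriveB.
have cont t : {for t, continuous (g - f)}.
  by apply: differentiable_continuous; apply/derivable1_diffP; case: (hd t).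
have [c /andP[c0 cx]] := MVT_segment x0 (fun t _ => hd t) (continuous_subspaceT cont).
have -> : (g - f) x - (g - f) 0 = (g x - f x) - (g 0 - f 0) by [].
have := H c; rewrite subr0 => Hc E.
have h : 0 <= (dg c - df c) * x.
  by rewrite mulr_ge0 // subr_ge0 Hc //; move: c0 cx; rewrite !bnd_simp => -> ->.
by lra.
Qed.

(** The rotation is fixed at the endpoint x, so comparing the derivatives of two real functions
    suffices. *)
Lemma normc_le_of_cderiv (f df : R -> C) (g dg : R -> R) x : 0 <= x ->
  cderiv f df -> (forall t, is_derive t (1:R) g (dg t)) ->
  f 0 = 0 -> g 0 = 0 -> (forall t, 0 <= t <= x -> N (df t) <= dg t) -> N (f x) <= g x.
Proof.
move=> x0 hf hg f0 g0 H.
have [u u1 <-] := normc_rotate (f x).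
have hu := cderivZ u hf.
apply: (le_of_deriv x0 (fun t => (hu t).1) hg); first by rewrite f0 mulr0 g0.
move=> t tx; apply: le_trans (H t tx); apply: le_trans (ler_norm _) _.
by apply: le_trans (normRe _) _; rewrite Normc.normcM u1 mul1r.
Qed.

Definition cexp (z : C) : C := (expR (Re z))%:C * (cos (Im z) +i* sin (Im z)).

Lemma cexpD x y : cexp (x + y) = cexp x * cexp y.
Proof.
rewrite /cexp cReD cImD expRD cosD sinD; apply/eqP; rewrite eq_complex /=.
by apply/andP; split; apply/eqP; ring.
Qed.

Lemma cexp0 : cexp 0 = 1.
Proof. by rewrite /cexp /= expR0 cos0 sin0 mul1r. Qed.

Lemma normc_cexp z : N (cexp z) = expR (Re z).
Proof.
rewrite /cexp Normc.normcM normcR ger0_norm ?expR_ge0 // /= cos2Dsin2 sqrtr1 mulr1 //.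
Qed.

Lemma is_deriveMl (c x : R) : is_derive x 1 (fun t => c * t) c.
Proof.
have := @is_deriveZ _ _ _ id c x 1 1 (is_derive_id x 1).
by move/is_derive_val; apply; rewrite /GRing.scale /= mulr1.
Qed.

Lemma cderiv_cexp (z : C) : cderiv (fun x => cexp (z * x%:C)) (fun x => z * cexp (z * x%:C)).
Proof.
case: z => a b.
have e : (fun x : R => cexp ((a +i* b) * x%:C)) =
   fun x : R => (expR (a * x))%:C * (cos (b * x) +i* sin (b * x)).
  by apply/funext => x; rewrite /cexp cReM cImM /= !mulr0 subr0 add0r.
rewrite e.
have d1 : cderiv (fun x : R => (expR (a * x))%:C) (fun x => (a * expR (a * x))%:C).
  apply: cderiv_real => x.
  have := @is_derive1_comp _ expR (fun t => a * t) x _ _ (is_derive_expR _) (is_deriveMl a x).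
  by rewrite mulrC.
have d2 : cderiv (fun x : R => cos (b * x) +i* sin (b * x))
   (fun x => (b * - sin (b * x)) +i* (b * cos (b * x))).
  move=> x; split => /=.
  - apply: is_derive_val (@is_derive1_comp _ cos (fun t => b * t) x _ _ (is_derive_cos _) (is_deriveMl b x)) _; exact: mulrC.
  - apply: is_derive_val (@is_derive1_comp _ sin (fun t => b * t) x _ _ (is_derive_sin _) (is_deriveMl b x)) _; exact: mulrC.
apply: cderiv_eq (cderivM d1 d2) _ => x.
have -> : cexp ((a +i* b) * x%:C) = (expR (a * x))%:C * (cos (b * x) +i* sin (b * x)) by have := congr1 (fun f => f x) e.
apply/eqP; rewrite eq_complex /=; apply/andP; split; apply/eqP; ring.
Qed.

(* [cosl l x] and [sinl l x] stand for [cos (rho x)] and [sin (rho x) / rho] where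
   [rho ^+ 2 = l]; the latter extends to [l = 0]. *)
Definition cosl (l : C) (x : R) : C :=
  (cexp ('i * sqrtc l * x%:C) + cexp (- ('i * sqrtc l) * x%:C)) / 2.
Definition sinl (l : C) (x : R) : C :=
  if l == 0 then x%:C
  else (cexp ('i * sqrtc l * x%:C) - cexp (- ('i * sqrtc l) * x%:C)) / (2 * 'i * sqrtc l).

Lemma i_neq0 : ('i : C) != 0.
Proof. by rewrite eq_complex /= oner_eq0 andbF. Qed.

Lemma i_sqr : ('i : C) * 'i = -1.
Proof. by have := sqr_i R; rewrite expr2. Qed.

(** [cosl l x] and [sinl l x] are even in the root, so estimates can be stated for any rho with
    [rho ^+ 2 = l], in particular for real rho. *)
Lemma cosl_of_sqrt (rho l : C) x : rho ^+ 2 = l ->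
  cosl l x = (cexp ('i * rho * x%:C) + cexp (- ('i * rho) * x%:C)) / 2.
Proof.
move=> h; have : (rho == sqrtc l) || (rho == - sqrtc l) by rewrite -eqf_sqr sqr_sqrtc h.
case/orP => /eqP ->; first by [].
by rewrite /cosl mulrN opprK addrC.
Qed.

Lemma sinl_of_sqrt (rho l : C) x : rho ^+ 2 = l ->
  rho * sinl l x = (cexp ('i * rho * x%:C) - cexp (- ('i * rho) * x%:C)) / (2 * 'i).
Proof.
move=> h; have [l0|l0] := eqVneq l 0.
  move: h; rewrite l0 => /eqP; rewrite expf_eq0 /= => /eqP ->.
  by rewrite mul0r mulr0 oppr0 subrr mul0r.
have s0 : sqrtc l != 0 by rewrite sqrtc_eq0.
have i0 := i_neq0.
have : (rho == sqrtc l) || (rho == - sqrtc l) by rewrite -eqf_sqr sqr_sqrtc h.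
rewrite /sinl (negbTE l0).
case/orP => /eqP ->; first by field; rewrite s0 i0.
by rewrite mulrN opprK; field; rewrite s0 i0.
Qed.

Lemma cosl0 l : cosl l 0 = 1.
Proof. by rewrite /cosl !mulr0 cexp0; field. Qed.

Lemma sinl0 l : sinl l 0 = 0.
Proof. by rewrite /sinl !mulr0 subrr mul0r; case: eqP. Qed.

Lemma cosl_at0 x : cosl 0 x = 1.
Proof. by rewrite /cosl sqrtc0 mulr0 oppr0 !mul0r cexp0; field. Qed.

Lemma sinl_at0 x : sinl 0 x = x%:C.
Proof. by rewrite /sinl eqxx. Qed.

Lemma cderiv_cosl l : cderiv (cosl l) (fun x => - l * sinl l x).
Proof.
have h := cderivZ (2^-1) (cderivD (cderiv_cexp ('i * sqrtc l)) (cderiv_cexp (- ('i * sqrtc l)))).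
rewrite (_ : cosl l = fun x : R => 2^-1 * (cexp ('i * sqrtc l * x%:C) + cexp (- ('i * sqrtc l) * x%:C))); last first.
  by apply/funext => x; rewrite /cosl mulrC.
apply: cderiv_eq h _ => x.
have -> : - l * sinl l x = - sqrtc l * (sqrtc l * sinl l x).
  by rewrite -{1}(sqr_sqrtc l) expr2; ring.
rewrite (sinl_of_sqrt x (sqr_sqrtc l)).
have i0 := i_neq0; have ii := i_sqr.
set a := cexp _; set b := cexp _; set s := sqrtc l.
have -> : 2^-1 * ('i * s * a + - ('i * s) * b) = - s * ((a - b) * (- ('i * 'i)) / (2 * 'i)).
  by field.
by rewrite ii opprK mulr1.
Qed.

Lemma cderiv_sinl l : cderiv (sinl l) (cosl l).
Proof.
have [l0|l0] := eqVneq l 0.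
  rewrite l0 (_ : sinl 0 = fun x => x%:C); last by apply/funext => x; rewrite sinl_at0.
  apply: (@cderiv_eq _ (fun=> (1:R)%:C)); last by move=> x; rewrite cosl_at0.
  by apply: cderiv_real => x; exact: (is_derive_id x (1:R)).
have s0 : sqrtc l != 0 by rewrite sqrtc_eq0.
have i0 := i_neq0.
have h := cderivZ (2 * 'i * sqrtc l)^-1 (cderivB (cderiv_cexp ('i * sqrtc l)) (cderiv_cexp (- ('i * sqrtc l)))).
rewrite (_ : sinl l = fun x : R => (2 * 'i * sqrtc l)^-1 * (cexp ('i * sqrtc l * x%:C) - cexp (- ('i * sqrtc l) * x%:C))); last first.
  by apply/funext => x; rewrite /sinl (negbTE l0) mulrC.
by apply: cderiv_eq h _ => x; rewrite /cosl; field; rewrite s0 i0.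
Qed.

Lemma coslD l x y : cosl l (x + y) = cosl l x * cosl l y - l * sinl l x * sinl l y.
Proof.
have -> : l * sinl l x * sinl l y = (sqrtc l * sinl l x) * (sqrtc l * sinl l y).
  by rewrite -{1}(sqr_sqrtc l) expr2; ring.
rewrite !(sinl_of_sqrt _ (sqr_sqrtc l)) /cosl rmorphD /= !mulrDr !cexpD.
have i0 := i_neq0; have ii := i_sqr.
set a := cexp _; set b := cexp _; set c := cexp _; set d := cexp _.
have -> : (a - c) / (2 * 'i) * ((b - d) / (2 * 'i)) = (a - c) * (b - d) / 4 / ('i * 'i) by field.
by rewrite ii; field.
Qed.

Lemma sinlD l x y : sinl l (x + y) = sinl l x * cosl l y + cosl l x * sinl l y.
Proof.
have [->|l0] := eqVneq l 0; first by rewrite !sinl_at0 !cosl_at0 mulr1 mul1r rmorphD.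
have s0 : sqrtc l != 0 by rewrite sqrtc_eq0.
have i0 := i_neq0.
apply: (mulfI s0); rewrite mulrDr mulrA (mulrCA _ (cosl l x)).
rewrite !(sinl_of_sqrt _ (sqr_sqrtc l)) /cosl rmorphD /= !mulrDr !cexpD.
by field.
Qed.

Lemma coslN l x : cosl l (- x) = cosl l x.
Proof. by rewrite /cosl rmorphN /= !mulrN mulNr opprK addrC. Qed.

Lemma sinlN l x : sinl l (- x) = - sinl l x.
Proof.
rewrite /sinl rmorphN /= !mulrN !mulNr !opprK; case: eqP => // _.
by rewrite -[RHS]mulNr opprB.
Qed.

Lemma cosl_sqr l x : cosl l x ^+ 2 + l * sinl l x ^+ 2 = 1.
Proof.
have := coslD l x (- x); rewrite subrr cosl0 coslN sinlN => ->.
ring.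
Qed.

Lemma normc_i : N 'i = 1.
Proof. by rewrite /= expr0n add0r expr1n sqrtr1. Qed.

Lemma Re_iM (z : C) : Re ('i * z) = - Im z.
Proof. by case: z => a b; rewrite cReM /= mul0r mul1r sub0r. Qed.

Lemma normc_cexp_i (rho : C) (x : R) : 0 <= x ->
  N (cexp ('i * rho * x%:C)) <= expR (`|Im rho| * x).
Proof.
move=> x0; rewrite normc_cexp ler_expR cReM Re_iM /= mulr0 subr0 ler_wpM2r //.
by rewrite -normrN ler_norm.
Qed.

Lemma normc_half (z : C) : N (z / 2) = N z / 2.
Proof. by rewrite Normc.normcM Normc.normcV normc_nat. Qed.

Lemma normc_half_i (z : C) : N (z / (2 * 'i)) = N z / 2.
Proof. by rewrite Normc.normcM Normc.normcV Normc.normcM normc_i mulr1 normc_nat. Qed.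

Lemma le_half_sum (u v w : R) : u <= w -> v <= w -> (u + v) / 2 <= w.
Proof. by move=> uw vw; lra. Qed.

Lemma normc_cosl (rho l : C) x : rho ^+ 2 = l -> 0 <= x ->
  N (cosl l x) <= expR (`|Im rho| * x).
Proof.
move=> h x0; rewrite (cosl_of_sqrt x h) normc_half.
apply: le_trans (ler_wpM2r _ (normcD_le _ _)) _; first by rewrite invr_ge0.
apply: le_half_sum; first exact: normc_cexp_i.
by rewrite -mulrN; apply: le_trans (normc_cexp_i (- rho) x0) _; rewrite cImN normrN.
Qed.

Lemma normc_sinl (rho l : C) x : rho ^+ 2 = l -> 0 <= x ->
  N (rho * sinl l x) <= expR (`|Im rho| * x).
Proof.
move=> h x0; rewrite (sinl_of_sqrt x h) normc_half_i.
apply: le_trans (ler_wpM2r _ (normcB_le _ _)) _; first by rewrite invr_ge0.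
apply: le_half_sum; first exact: normc_cexp_i.
by rewrite -mulrN; apply: le_trans (normc_cexp_i (- rho) x0) _; rewrite cImN normrN.
Qed.

Lemma cosl_real (r x : R) : cosl ((r ^+ 2)%:C) x = (cos (r * x))%:C.
Proof.
rewrite (@cosl_of_sqrt r%:C); last by rewrite -rmorphXn.
have -> : 'i * r%:C * x%:C = 0 +i* (r * x) :> C by apply/eqP; rewrite eq_complex /=; apply/andP; split; apply/eqP; ring.
have -> : - ('i * r%:C) * x%:C = 0 +i* (- (r * x)) :> C by apply/eqP; rewrite eq_complex /=; apply/andP; split; apply/eqP; ring.
rewrite /cexp /= expR0 cosN sinN !mul1r.
apply: (mulIf (_ : 2 != 0 :> C)); first by rewrite pnatr_eq0.
rewrite divfK ?pnatr_eq0 //; apply/eqP; rewrite eq_complex /= !(mulr0, mul0r, subrr, addr0, subr0).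
by rewrite mulrDr mulr1 !eqxx.
Qed.

Lemma sinl_real (r x : R) : r%:C * sinl ((r ^+ 2)%:C) x = (sin (r * x))%:C.
Proof.
rewrite (@sinl_of_sqrt r%:C); last by rewrite -rmorphXn.
have -> : 'i * r%:C * x%:C = 0 +i* (r * x) :> C by apply/eqP; rewrite eq_complex /=; apply/andP; split; apply/eqP; ring.
have -> : - ('i * r%:C) * x%:C = 0 +i* (- (r * x)) :> C by apply/eqP; rewrite eq_complex /=; apply/andP; split; apply/eqP; ring.
rewrite /cexp /= expR0 cosN sinN !mul1r.
have h0 : (2 * 'i : C) != 0 by rewrite mulf_neq0 ?pnatr_eq0 // i_neq0.
apply: (mulIf h0); rewrite divfK //; apply/eqP; rewrite eq_complex /=.
by apply/andP; split; apply/eqP; ring.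
Qed.

(** Trades |rho| for |l|, where [rho ^+ 2 = l]: the Taylor bounds are wanted in the variable l. *)
Lemma normc_le_sqr1 (z : C) : N z <= 1 + N z ^+ 2.
Proof.
have h := normc_ge0 z; rewrite -subr_ge0.
have -> : 1 + N z ^+ 2 - N z = (N z - 1/2) ^+ 2 + 3/4 by field.
by rewrite addr_ge0 ?sqr_ge0.
Qed.

Lemma normc_cosl_unit l x : 0 <= x <= 1 -> N (cosl l x) <= expR (1 + N l).
Proof.
case/andP=> x0 x1; apply: le_trans (normc_cosl (sqr_sqrtc l) x0) _.
rewrite ler_expR -(sqr_sqrtc l) normcX sqr_sqrtc; apply: le_trans (normc_le_sqr1 _).
by apply: le_trans (normIm _); rewrite ler_piMr.
Qed.

Definition monof (k : nat) (x : R) : R := x ^+ k / k`!%:R.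

Lemma monof0 k : monof k.+1 0 = 0.
Proof. by rewrite /monof expr0n mul0r. Qed.

Lemma monof_ge0 k x : 0 <= x -> 0 <= monof k x.
Proof. by move=> x0; rewrite /monof divr_ge0 // exprn_ge0. Qed.

Lemma is_derive_monof k x : is_derive x (1:R) (monof k.+1) (monof k x).
Proof.
have h := is_deriveZ (k.+1`!%:R^-1) (is_deriveX k.+1 (is_derive_id x (1:R))).
have e : (k.+1`!%:R^-1 \*: (id ^+ k.+1) : R -> R) = monof k.+1.
  by apply/funext => t; rewrite /= exprfctE /monof mulrC.
rewrite -e; apply: is_derive_val h _; rewrite /monof /GRing.scale /= mulr1 factS natrM invfM.
by rewrite mulrACA mulVf ?pnatr_eq0 // mul1r mulrC.
Qed.

Definition cos_rem n l x : C := cosl l x - \sum_(k < n) (- l) ^+ k * (monof k.*2 x)%:C.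
Definition sin_rem n l x : C := sinl l x - \sum_(k < n) (- l) ^+ k * (monof k.*2.+1 x)%:C.

Lemma cderiv_sin_rem n l : cderiv (sin_rem n l) (cos_rem n l).
Proof.
apply: cderivB (cderiv_sinl l) _.
apply: (cderiv_sum _ (f := fun k x => (- l) ^+ k * (monof k.*2.+1 x)%:C)
  (df := fun k x => (- l) ^+ k * (monof k.*2 x)%:C)) => k; apply: cderivZ.
by apply: cderiv_real => x; exact: is_derive_monof.
Qed.

Lemma cderiv_cos_rem n l : cderiv (cos_rem n.+1 l) (fun x => - l * sin_rem n l x).
Proof.
rewrite (_ : cos_rem n.+1 l = fun x => cosl l x - (1 + \sum_(k < n) (- l) ^+ k.+1 * (monof k.*2.+2 x)%:C)).
  have h := cderivB (cderiv_cosl l) (cderivD (cderiv_cst 1) (@cderiv_sum n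
     (fun k x => (- l) ^+ k.+1 * (monof k.*2.+2 x)%:C) (fun k x => (- l) ^+ k.+1 * (monof k.*2.+1 x)%:C) _)).
  apply: (cderiv_eq (h _)) => [k|x].
    by apply: cderivZ; apply: cderiv_real => x; exact: is_derive_monof.
  rewrite add0r /sin_rem mulrBr; congr (_ - _); rewrite mulr_sumr.
  by apply: eq_bigr => k _; rewrite exprS mulrA.
apply/funext => x; rewrite /cos_rem big_ord_recl expr0 mul1r /=; congr (_ - (_ + _)).
by rewrite /monof expr0 fact0 divr1.
Qed.

(** The derivative of the sine remainder is the cosine remainder of the same order, and that of the
    next cosine remainder is -l times the sine remainder. Starting from |cosl| <= exp (1 + |l|),
    each integration raises the degree of the monomial by one. *)
Lemma rem_bounds n l x : 0 <= x <= 1 ->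
  N (cos_rem n l x) <= expR (1 + N l) * N l ^+ n * monof n.*2 x /\
  N (sin_rem n l x) <= expR (1 + N l) * N l ^+ n * monof n.*2.+1 x.
Proof.
have step m : (forall t, 0 <= t <= 1 -> N (cos_rem m l t) <= expR (1 + N l) * N l ^+ m * monof m.*2 t) ->
   forall t, 0 <= t <= 1 -> N (sin_rem m l t) <= expR (1 + N l) * N l ^+ m * monof m.*2.+1 t.
  move=> H t /andP[t0 t1].
  apply: (@normc_le_of_cderiv (sin_rem m l) (cos_rem m l) (fun t => expR (1 + N l) * N l ^+ m * monof m.*2.+1 t)
    (fun t => expR (1 + N l) * N l ^+ m * monof m.*2 t) t t0).
  - exact: cderiv_sin_rem.
  - by move=> s; apply: is_deriveZ; exact: is_derive_monof.
  - rewrite /sin_rem sinl0 big1 ?subr0 // => k _; by rewrite monof0 mulr0.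
  - by rewrite monof0 mulr0.
  - by move=> s /andP[s0 st]; apply: H; rewrite s0 (le_trans st).
elim: n x => [|n IH] x x01.
  have H t : 0 <= t <= 1 -> N (cos_rem 0 l t) <= expR (1 + N l) * N l ^+ 0 * monof 0 t.
    by move=> t01; rewrite /cos_rem big_ord0 subr0 /monof expr0 fact0 divr1 expr0 !mulr1 normc_cosl_unit.
  split; [exact: H|exact: step].
have H t : 0 <= t <= 1 -> N (cos_rem n.+1 l t) <= expR (1 + N l) * N l ^+ n.+1 * monof n.*2.+2 t.
  move=> /andP[t0 t1].
  apply: (@normc_le_of_cderiv (cos_rem n.+1 l) _ (fun t => expR (1 + N l) * N l ^+ n.+1 * monof n.*2.+2 t)
    (fun t => expR (1 + N l) * N l ^+ n.+1 * monof n.*2.+1 t) t t0 (cderiv_cos_rem n l)).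
  - by move=> s; apply: is_deriveZ; exact: is_derive_monof.
  - rewrite /cos_rem cosl0 big_ord_recl expr0 mul1r /monof expr0 fact0 divr1.
    by rewrite big1 ?addr0 ?subrr // => k _; rewrite expr0n mul0r mulr0.
  - by rewrite monof0 mulr0.
  - move=> s /andP[s0 st]; rewrite Normc.normcM normcN exprS.
    have /IH[_] : 0 <= s <= 1 by rewrite s0 (le_trans st).
    move/(ler_wpM2l (normc_ge0 l))/le_trans; apply.
    by rewrite le_eqVlt; apply/orP; left; apply/eqP; ring.
split; [exact: H|exact: step].
Qed.

Lemma monof_le_fact k x : 0 <= x <= 1 -> monof k x <= k`!%:R^-1.
Proof.
by case/andP => x0 x1; rewrite /monof ler_piMl ?invr_ge0 // exprn_ile1.
Qed.

Lemma pow_fact_le n m (r : R) : 0 <= r -> (n <= m)%N -> r ^+ n / m`!%:R <= expR r.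
Proof.
move=> r0 nm; apply: (@le_trans _ _ (r ^+ n / n`!%:R)).
  rewrite ler_wpM2l ?exprn_ge0 // lef_pV2 ?posrE ?ltr0n ?fact_gt0 // ler_nat.
  exact: leq_fact.
case: n {nm} => [|n]; last by apply: le_trans (expR_ge1Dxn n r0); rewrite lerDr.
by rewrite expr0 fact0 divr1 -expR0 ler_expR.
Qed.

(** The factorial pays for any radius: |l|^n / m! = (|l| / r)^n r^n / m!, and r^n / m! <= exp r once
    n <= m. *)
Lemma rem_geom n m r l x : 0 < r -> N l <= r -> (n <= m)%N -> 0 <= x <= 1 ->
  expR (1 + N l) * N l ^+ n * monof m x <= (expR (1 + r) * expR r) * (N l / r) ^+ n.
Proof.
move=> r0 lr nm x01; have nl := normc_ge0 l; have r0' := ltW r0.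
apply: (@le_trans _ _ (expR (1 + r) * N l ^+ n * m`!%:R^-1)).
  rewrite ler_pM ?mulr_ge0 ?expR_ge0 ?exprn_ge0 ?monof_ge0 //; first by case/andP: x01.
    by rewrite ler_wpM2r ?exprn_ge0 // ler_expR lerD2l.
  exact: monof_le_fact.
have -> : expR (1 + r) * N l ^+ n / m`!%:R = expR (1 + r) * ((N l / r) ^+ n * (r ^+ n / m`!%:R)).
  rewrite expr_div_n -!mulrA; congr (_ * (_ * _)).
  by rewrite mulKf // expf_neq0 // gt_eqF.
rewrite -mulrA ler_wpM2l ?expR_ge0 // mulrC ler_wpM2r ?exprn_ge0 ?divr_ge0 //.
exact: pow_fact_le.
Qed.

Lemma taylor_cosl r x : 0 < r -> 0 <= x <= 1 ->
  taylor_on r (expR (1 + r) * expR r) (fun l => cosl l x) (fun k => ((-1) ^+ k * monof k.*2 x)%:C).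
Proof.
move=> r0 x01 n l lr; have [H _] := rem_bounds n l x01.
rewrite (_ : cosl l x - _ = cos_rem n l x).
  by apply: le_trans H _; apply: rem_geom => //; rewrite -addnn leq_addl.
rewrite /cos_rem; congr (_ - _); apply: eq_bigr => k _.
by rewrite -[- l]mulN1r exprMn rmorphM rmorphXn rmorphN1 mulrAC.
Qed.

Lemma taylor_sinl r x : 0 < r -> 0 <= x <= 1 ->
  taylor_on r (expR (1 + r) * expR r) (fun l => sinl l x) (fun k => ((-1) ^+ k * monof k.*2.+1 x)%:C).
Proof.
move=> r0 x01 n l lr; have [_ H] := rem_bounds n l x01.
rewrite (_ : sinl l x - _ = sin_rem n l x).
  by apply: le_trans H _; apply: rem_geom => //; rewrite -addnn ltnW // ltnS leq_addl.
rewrite /sin_rem; congr (_ - _); apply: eq_bigr => k _.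
by rewrite -[- l]mulN1r exprMn rmorphM rmorphXn rmorphN1 mulrAC.
Qed.

End CDeriv.

(** * Lower bounds for sine and cosine on the circles |rho| = (m + 1/2) pi *)

Section Circle.
Variable R : realType.
Local Notation C := R[i].
Local Notation N := (@Normc.normc R).
Local Notation Re := complex.Re.
Local Notation Im := complex.Im.

Lemma sin_le_id (x : R) : 0 <= x -> sin x <= x.
Proof.
move=> x0; apply: (@le_of_deriv R sin cos id (fun=> 1)) => //.
by rewrite sin0.
Qed.

Lemma sin_pi_nat n : sin (n%:R * pi) = 0 :> R.
Proof.
elim: n => [|n IH]; first by rewrite mul0r sin0.
by rewrite -natr1 mulrDl mul1r sinDpi IH oppr0.
Qed.

Lemma cos_pi_nat n : cos (n%:R * pi) = (-1) ^+ n :> R.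
Proof.
elim: n => [|n IH]; first by rewrite mul0r cos0.
by rewrite -natr1 mulrDl mul1r cosDpi IH exprS mulN1r.
Qed.

Lemma cos_pi_nat_sqr n : cos (n%:R * pi) ^+ 2 = 1 :> R.
Proof. by rewrite cos_pi_nat -exprM mulnC exprM expr2 mulrNN mulr1 expr1n. Qed.

(* [cosh ^ 2 - cos ^ 2 = sinh ^ 2 + sin ^ 2] *)
Lemma normc_sinl_sqr (rho l : C) : rho ^+ 2 = l ->
  N (rho * sinl l 1) ^+ 2 =
  ((expR (Im rho) - expR (- Im rho)) / 2) ^+ 2 + sin (Re rho) ^+ 2.
Proof.
move=> h; rewrite (sinl_of_sqrt 1 h) normc_half_i expr_div_n normc_sqr /cexp.
case: rho h => x y _; set E := expR y; set F := expR (- y).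
rewrite !(cReD, cImD, cReN, cImN, cReM, cImM) /=.
rewrite !(mulr0, mul0r, mul1r, mulr1, subr0, addr0, sub0r, add0r, oppr0, opprK) -/E -/F.
have EF : E * F = 1 by rewrite -expRD subrr expR0.
rewrite cosN sinN.
have cs := cos2Dsin2 x.
have c2 : cos x ^+ 2 = 1 - sin x ^+ 2 by rewrite -cs addrK.
set c := cos x in c2 *; set s := sin x in c2 *.
rewrite (_ : _ + _ = (E - F) ^+ 2 * (c ^+ 2 + s ^+ 2) + 4 * (E * F) * s ^+ 2); last by ring.
by rewrite c2 EF; field.
Qed.

(** If |Im rho| >= 1/2, the hyperbolic part alone is large enough. Otherwise the circle forces |Re
    rho| close to (m + 1/2) pi, where the real sine is close to 1 in modulus, while exp |Im rho| is
    at most 2. *)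
Lemma sinl_circle (rho l : C) m : rho ^+ 2 = l -> (0 < m)%N ->
  N rho = (m%:R + 1 / 2) * pi -> expR `|Im rho| / 4 <= N (rho * sinl l 1).
Proof.
move=> h m0 Nrho.
rewrite -(@ler_pXn2r _ 2) ?nnegrE ?normc_ge0 ?divr_ge0 ?expR_ge0 // (normc_sinl_sqr h).
set y := Im rho; set x := Re rho; set E := expR `|y|.
have E0 : 0 < E by exact: expR_gt0.
have -> : ((expR y - expR (- y)) / 2) ^+ 2 = ((E - E^-1) / 2) ^+ 2.
  rewrite /E -expRN; case: (ger0P y) => y0; first by [].
  by rewrite opprK -[LHS]sqrrN -mulNr opprB.
have [y2|y2] := lerP (1/2) `|y|.
  have E1 : 3/2 <= E by apply: le_trans (expR_ge1Dx _); lra.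
  apply: (@le_trans _ _ (((E - E^-1) / 2) ^+ 2)); last by rewrite lerDl sqr_ge0.
  have h1 : E^-1 <= 4/9 * E.
    rewrite -[leLHS]div1r ler_pdivrMr //.
    have : 3/2 * (3/2) <= E * E by rewrite ler_pM //; lra.
    by lra.
  by rewrite lerXn2r ?nnegrE //; lra.
apply: (@le_trans _ _ (sin x ^+ 2)); last by rewrite lerDr sqr_ge0.
have E2 : E <= 2.
  have h1 : 1/2 <= E^-1.
    by rewrite -expRN; apply: le_trans (expR_ge1Dx _); lra.
  have : 1/2 * E <= E^-1 * E by rewrite ler_wpM2r // ltW.
  by rewrite mulVf ?gt_eqF //; lra.
pose X := `|x|; pose r := N rho.
have -> : sin x ^+ 2 = sin X ^+ 2.
  by rewrite /X; case: (ger0P x) => // _; rewrite sinN sqrrN.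
have r2 : r ^+ 2 = X ^+ 2 + y ^+ 2 by rewrite /r normc_sqr /X real_normK ?num_real.
have X0 : 0 <= X by exact: normr_ge0.
have r3 : 2 <= r.
  rewrite /r Nrho; have hp := pi_ge2 R.
  have m1 : (1:R) <= m%:R by rewrite ler1n.
  have : (m%:R + 1/2) * 2 <= (m%:R + 1/2) * (pi : R) by rewrite ler_wpM2l //; lra.
  by lra.
have yy : y ^+ 2 <= 1/4.
  rewrite -(real_normK (num_real y)) -[1/4](_ : (1/2)^+2 = _); last by field.
  by rewrite lerXn2r ?nnegrE // ltW.
have Xr : X <= r.
  by rewrite -(@ler_pXn2r _ 2) ?nnegrE ?normc_ge0 // r2 lerDl sqr_ge0.
(* Here d (r + X) = y^2 <= 1/4 and r + X >= 1, so d <= 1/4; as r is an odd multiple of pi / 2, the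
   squared sine of X = r - d is cos^2 d. *)
pose d := r - X.
have d0 : 0 <= d by rewrite subr_ge0.
have d1 : d <= 1/4.
  have : d * (r + X) <= 1/4 by rewrite /d -subr_sqr r2 addrAC subrr add0r.
  have : d * 1 <= d * (r + X) by rewrite ler_wpM2l //; lra.
  by lra.
have -> : sin X ^+ 2 = cos d ^+ 2.
  have -> : X = r - d by rewrite /d; ring.
  have rE : r = m%:R * pi + pi / 2 by rewrite /r Nrho; field.
  have cr : cos r = 0 by rewrite rE cosD cos_pihalf sin_pi_nat mulr0 mul0r subr0.
  have sr : sin r = cos (m%:R * pi) by rewrite rE sinD cos_pihalf sin_pihalf mulr0 add0r mulr1.
  by rewrite sinB cr sr mul0r subr0 exprMn cos_pi_nat_sqr mul1r.
rewrite cos2sin2.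
have s0 : 0 <= sin d by apply: sin_ge0_pi; rewrite d0 /=; have := pi_ge2 R; lra.
have s1 : sin d <= 1/4 by apply: le_trans d1; exact: sin_le_id.
have s2 : sin d ^+ 2 <= 1/4 * (1/4) by rewrite expr2 ler_pM.
have E3 : (E/4) ^+ 2 <= 1/2 * (1/2) by rewrite expr2 ler_pM //; lra.
by lra.
Qed.

(* [sin rho = 2 sin (rho / 2) cos (rho / 2)], each factor being at most [expR (`|Im rho| / 2)]. *)
Lemma half_circle (rho l : C) m : rho ^+ 2 = l -> (0 < m)%N ->
  N rho = (m%:R + 1 / 2) * pi ->
  expR (`|Im rho| / 2) / 8 <= N (rho * sinl l (1/2)) /\
  expR (`|Im rho| / 2) / 8 <= N (cosl l (1/2)).
Proof.
move=> h m0 Nrho.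
have H := sinl_circle h m0 Nrho.
have e : rho * sinl l 1 = 2 * ((rho * sinl l (1/2)) * cosl l (1/2)).
  rewrite {1}(_ : 1 = 1/2 + 1/2 :> R); last by field.
  by rewrite sinlD; ring.
have h2 : (0:R) <= 1/2 by [].
have hc := normc_cosl h h2; have hs := normc_sinl h h2.
rewrite mulrA mulr1 in hc hs.
set E := expR (`|Im rho| / 2) in hc hs *.
have E0 : 0 < E by exact: expR_gt0.
have EE : expR `|Im rho| = E * E by rewrite /E -expRD; congr expR; field.
move: H; rewrite e Normc.normcM Normc.normcM normc_nat EE.
set s := N _ in hs *; set c := N _ in hc * => H.
have s0 : 0 <= s by exact: normc_ge0. have c0 : 0 <= c by exact: normc_ge0.
split; rewrite -(ler_pM2r E0).
- have : s * c <= s * E by rewrite ler_wpM2l.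
  by lra.
- have : s * c <= E * c by rewrite ler_wpM2r.
  by lra.
Qed.

End Circle.

(** * Integration by parts *)

Section IBP.
Variable R : realType.
Local Notation mu := (@lebesgue_measure R).

Lemma integrable_patch (D : set R) (f : R -> R) : measurable D ->
  mu.-integrable D (EFin \o f) -> mu.-integrable setT (EFin \o (f \_ D)).
Proof.
by move=> mD /(@integrable_mkcond _ _ _ mu D (EFin \o f) mD).1; rewrite restrict_EFin.
Qed.

Lemma integrable_scale (D : set R) (k : R) (g : R -> R) : measurable D ->
  mu.-integrable D (EFin \o g) -> mu.-integrable D (fun t => (k * g t)%:E).
Proof. by move=> mD ig; exact: (@integrableZl _ _ R mu _ mD k (EFin \o g)). Qed.

Lemma integrable_bdM (D : set R) (h g : R -> R) M : measurable D -> measurable_fun D h ->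
  (forall t, D t -> `|h t| <= M) -> mu.-integrable D (EFin \o g) ->
  mu.-integrable D (EFin \o (fun t => h t * g t)).
Proof.
move=> mD mh hM ig; apply: (@integrableMr _ _ R mu D mD h (EFin \o g)) => //.
exists M; split; first by rewrite num_real.
by move=> z Mz t Dt; apply: le_trans (hM t Dt) _; exact: ltW.
Qed.

Lemma continuous_bounded_itv (h : R -> R) a b : continuous h ->
  exists M, forall t, `[a, b]%classic t -> `|h t| <= M.
Proof.
move=> ch; have /compact_bounded := continuous_compact (continuous_subspaceT ch) (@segment_compact _ a b).
move=> [M [Mr HM]]; exists (M + 1) => t tab; apply: (HM (M + 1)); first by rewrite ltrDl.
by exists t.
Qed.

Lemma integrable_cont_itv (f : R -> R) a b : continuous f -> mu.-integrable `[a, b] (EFin \o f).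
Proof.
move=> cf; apply: continuous_compact_integrable; first exact: segment_compact.
exact: continuous_subspaceT.
Qed.

(** Both sides integrate h(s) g(t) over the triangle 0 <= t <= s <= x; the integrand is dominated by
    |h(s)| |g(t)| on the square, so Fubini applies. *)
Lemma fubini_triangle (h g : R -> R) x : continuous h ->
  mu.-integrable `[0, x] (EFin \o g) ->
  \int[mu]_(s in `[0, x]) (h s * \int[mu]_(t in `[0, s]) g t) =
  \int[mu]_(t in `[0, x]) (g t * \int[mu]_(s in `[t, x]) h s).
Proof.
move=> ch ig.
pose D : set R := `[0, x]%classic.
have mD : measurable D by exact: measurable_itv.
(* Restriction to a set extends by the default [point], which for real numbers is 0. *)
have p0 : (point : R) = 0 by [].
have ihD := integrable_patch mD (integrable_cont_itv 0 x ch).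
have igD := integrable_patch mD ig.
pose hD := h \_ D; pose gD := g \_ D.
have mhD : measurable_fun setT hD by apply/measurable_EFinP; exact: measurable_int ihD.
have mgD : measurable_fun setT gD by apply/measurable_EFinP; exact: measurable_int igD.
pose f (p : R * R) : R := if p.2 <= p.1 then hD p.1 * gD p.2 else 0.
have mf : measurable_fun setT (EFin \o f).
  apply/measurable_EFinP; apply: measurable_fun_ifT => //.
  - by apply: measurable_fun_ler.
  - by apply: measurable_funM; apply: measurableT_comp.
have If : (mu \x mu)%E.-integrable setT (EFin \o f).
  apply/integrable12ltyP => //.
  apply: (@le_lt_trans _ _ (\int[mu]_s (`|hD s|%:E * \int[mu]_t `|gD t|%:E))%E).
    apply: ge0_le_integral => //.
    - by move=> s _; apply: integral_ge0.
    - have mfa : measurable_fun setT (abse \o (EFin \o f)) by exact: measurableT_comp.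
      exact: (@measurable_fun_fubini_tonelli_F _ _ _ _ R mu _ mfa (fun z => abse_ge0 _)).
    - apply: emeasurable_funM => //; apply/measurable_EFinP; exact: measurableT_comp.
    - move=> s _; rewrite -ge0_integralZl //; last by apply/measurable_EFinP; exact: measurableT_comp.
      apply: ge0_le_integral => //.
      + apply/measurable_EFinP; apply: measurableT_comp => //.
        by apply/measurable_EFinP; apply: (measurableT_comp mf); exact: pair1_measurable.
      + apply: emeasurable_funM => //; apply/measurable_EFinP; exact: measurableT_comp.
      + move=> t _; rewrite -EFinM lee_fin /f /= -normrM.
        by case: ifP => // _; rewrite normr0.
  rewrite ge0_integralZr //.
  - apply: lte_mul_pinfty => //.
    + exact: integral_ge0.
    + have /integrableP[_] := ihD; rewrite ge0_fin_numE //; exact: integral_ge0.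
    + by have /integrableP[_] := igD.
  - by apply/measurable_EFinP; exact: measurableT_comp.
  - exact: integral_ge0.
have := @Fubini _ _ _ _ _ mu mu (EFin \o f) If.
have inner1 s : (\int[mu]_t (EFin \o f) (s, t) = ((fun s => h s * \int[mu]_(t in `[0%R, s]) g t) \_ D s)%:E)%E.
  rewrite patchE; case: ifPn => sD; last first.
    rewrite integral0_eq // => t _; rewrite /f /hD /= patchE (negbTE sD) mul0r; by case: ifP.
  have /andP[s0 sx] : 0 <= s <= x by move: sD; rewrite inE /D /= in_itv.
  have igs : mu.-integrable `[0, s] (EFin \o g).
    by apply: integrableS ig => //; apply: subset_itvl; rewrite bnd_simp.
  rewrite -RintegralZl // /Rintegral fineK; last first.
    by apply: integrable_fin_num => //; exact: integrable_scale.
  rewrite [RHS]integral_mkcond; apply: eq_integral => t _ /=.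
  rewrite restrict_EFin /f /= /hD /gD !patchE sD ?p0.
  have -> : (t \in D) = (0 <= t <= x) by rewrite /D; apply/idP/idP; rewrite inE /= in_itv.
  have -> : (t \in `[0, s]%classic) = (0 <= t <= s).
    by apply/idP/idP; rewrite inE /= in_itv.
  case: (leP t s) => ts; last by rewrite andbF.
  rewrite andbT; case: (leP 0 t) => t0 /=; last by rewrite mulr0.
  by rewrite (le_trans ts sx).
have inner2 t : (\int[mu]_s (EFin \o f) (s, t) = ((fun t => g t * \int[mu]_(s in `[t, x]) h s) \_ D t)%:E)%E.
  rewrite patchE; case: ifPn => tD; last first.
    rewrite integral0_eq // => s _; rewrite /f /gD /= patchE (negbTE tD) mulr0; by case: ifP.
  have /andP[t0 tx] : 0 <= t <= x by move: tD; rewrite inE /D /= in_itv.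
  have ihs : mu.-integrable `[t, x] (EFin \o h) by exact: integrable_cont_itv.
  rewrite -RintegralZl // /Rintegral fineK; last first.
    by apply: integrable_fin_num => //; exact: integrable_scale.
  rewrite [RHS]integral_mkcond; apply: eq_integral => s _ /=.
  rewrite restrict_EFin /f /= /hD /gD !patchE tD ?p0.
  have -> : (s \in D) = (0 <= s <= x) by rewrite /D; apply/idP/idP; rewrite inE /= in_itv.
  have -> : (s \in `[t, x]%classic) = (t <= s <= x).
    by apply/idP/idP; rewrite inE /= in_itv.
  case: (leP t s) => ts //=.
  by rewrite (le_trans t0 ts) /=; case: ifP; rewrite ?mul0r // mulrC.
under eq_integral do rewrite inner1.
under [X in _ = X]eq_integral do rewrite inner2.
move=> H; rewrite [LHS]Rintegral_mkcond [RHS]Rintegral_mkcond /Rintegral; exact: congr1 H.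
Qed.

(** Here g is merely integrable, as the second derivative of a solution is, so its primitive need
    not be differentiable everywhere; exchanging the integrals leaves the fundamental theorem to be
    applied to the continuous h only. *)
Lemma ibp_real (F h g : R -> R) x : 0 <= x -> (forall s, is_derive s (1:R) F (h s)) ->
  continuous h -> mu.-integrable `[0, x] (EFin \o g) ->
  \int[mu]_(s in `[0, x]) (h s * \int[mu]_(t in `[0, s]) g t) =
  F x * \int[mu]_(t in `[0, x]) g t - \int[mu]_(t in `[0, x]) (F t * g t).
Proof.
move=> x0 dF ch ig; rewrite fubini_triangle //.
have cF : continuous F.
  by move=> t; apply: differentiable_continuous; apply/derivable1_diffP; case: (dF t).
have ftc t : t <= x -> \int[mu]_(s in `[t, x]) h s = F x - F t.
  rewrite le_eqVlt => /predU1P[->|tx]; first by rewrite set_itv1 Rintegral_set1 subrr.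
  rewrite /Rintegral (@continuous_FTC2 _ h F) //.
  - exact: continuous_subspaceT.
  - split; first by move=> z _; case: (dF z).
    + exact: cvg_at_right_filter (cF t).
    + exact: cvg_at_left_filter (cF x).
  - by move=> z _; rewrite derive1E; case: (dF z).
rewrite (@eq_Rintegral _ _ _ mu _ (fun t => F x * g t - F t * g t)); last first.
  move=> t; rewrite inE /= in_itv /= => /andP[t0 tx]; rewrite ftc //; ring.
have iFg : mu.-integrable `[0, x] (EFin \o (fun t => F t * g t)).
  have [M HM] := continuous_bounded_itv 0 x cF.
  apply: (integrable_bdM _ _ HM) => //.
  by apply: measurable_funTS; exact: continuous_measurable_fun.
rewrite RintegralB //; last exact: integrable_scale.
by rewrite RintegralZl.
Qed.

End IBP.

(** * Complex-valued integrals and absolutely continuous functions *)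

Section CIntegral.
Variable R : realType.
Local Notation C := R[i].
Local Notation N := (@Normc.normc R).
Local Notation mu := (@lebesgue_measure R).
Local Notation Re := complex.Re.
Local Notation Im := complex.Im.

Definition rint (D : set R) (f : R -> R) : Prop := mu.-integrable D (EFin \o f).

Definition cint (D : set R) (f : R -> C) : Prop :=
  rint D (fun x => Re (f x)) /\ rint D (fun x => Im (f x)).

Lemma rintD (D : set R) f g : measurable D -> rint D f -> rint D g -> rint D (fun x => f x + g x).
Proof. by move=> mD hf hg; exact: (@integrableD _ _ R mu _ mD (EFin \o f) (EFin \o g)). Qed.

Lemma rintB (D : set R) f g : measurable D -> rint D f -> rint D g -> rint D (fun x => f x - g x).
Proof. by move=> mD hf hg; exact: (@integrableB _ _ R mu _ mD (EFin \o f) (EFin \o g)). Qed.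

Lemma eq_rint (D : set R) f g : measurable D -> (forall x, D x -> f x = g x) -> rint D f -> rint D g.
Proof.
move=> mD e; apply: (@eq_integrable _ _ R mu D mD (EFin \o f) (EFin \o g)) => x.
by rewrite inE => Dx; rewrite /= e.
Qed.

Lemma eq_cint (D : set R) f g : measurable D -> (forall x, D x -> f x = g x) -> cint D f -> cint D g.
Proof. by move=> mD e [h1 h2]; split; [apply: eq_rint h1|apply: eq_rint h2] => // x Dx; rewrite e. Qed.

Lemma cintD (D : set R) f g : measurable D -> cint D f -> cint D g -> cint D (fun x => f x + g x).
Proof.
move=> mD [f1 f2] [g1 g2]; split.
- by apply: (eq_rint mD) (rintD mD f1 g1) => x _; rewrite cReD.
- by apply: (eq_rint mD) (rintD mD f2 g2) => x _; rewrite cImD.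
Qed.

Lemma cintB (D : set R) f g : measurable D -> cint D f -> cint D g -> cint D (fun x => f x - g x).
Proof.
move=> mD [f1 f2] [g1 g2]; split.
- by apply: (eq_rint mD) (rintB mD f1 g1) => x _; rewrite cReD cReN.
- by apply: (eq_rint mD) (rintB mD f2 g2) => x _; rewrite cImD cImN.
Qed.

Lemma cintZ (D : set R) c f : measurable D -> cint D f -> cint D (fun x => c * f x).
Proof.
move=> mD [f1 f2]; split.
- apply: (eq_rint mD) (rintB mD (integrable_scale (Re c) mD f1) (integrable_scale (Im c) mD f2)) => x _.
  by rewrite cReM.
- apply: (eq_rint mD) (rintD mD (integrable_scale (Re c) mD f2) (integrable_scale (Im c) mD f1)) => x _.
  by rewrite cImM.
Qed.

Lemma eq_cintegral (D : set R) (f g : R -> C) : (forall x, D x -> f x = g x) -> cintegral D f = cintegral D g.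
Proof.
by move=> e; rewrite /cintegral; congr (_ +i* _); apply: eq_Rintegral => x; rewrite inE => Dx; rewrite e.
Qed.

Lemma cintegralD (D : set R) f g : measurable D -> cint D f -> cint D g ->
  cintegral D (fun x => f x + g x) = cintegral D f + cintegral D g.
Proof.
move=> mD [f1 f2] [g1 g2]; rewrite /cintegral.
rewrite (@eq_Rintegral _ _ _ mu _ (fun x => Re (f x) + Re (g x))); last by move=> x _; rewrite cReD.
rewrite (@eq_Rintegral _ _ _ mu _ (fun x => Im (f x) + Im (g x)) (fun x => Im _)); last by move=> x _; rewrite cImD.
by rewrite !RintegralD.
Qed.

Lemma cintegralZ (D : set R) c f : measurable D -> cint D f ->
  cintegral D (fun x => c * f x) = c * cintegral D f.
Proof.
move=> mD [f1 f2]; rewrite /cintegral.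
rewrite (@eq_Rintegral _ _ _ mu _ (fun x => Re c * Re (f x) - Im c * Im (f x))); last by move=> x _; rewrite cReM.
rewrite (@eq_Rintegral _ _ _ mu _ (fun x => Re c * Im (f x) + Im c * Re (f x)) (fun x => Im _)); last by move=> x _; rewrite cImM.
rewrite RintegralB ?RintegralD ?RintegralZl //; try exact: integrable_scale.
by case: c.
Qed.

Lemma cintegralB (D : set R) f g : measurable D -> cint D f -> cint D g ->
  cintegral D (fun x => f x - g x) = cintegral D f - cintegral D g.
Proof.
move=> mD hf hg; rewrite -[- cintegral D g]mulN1r -cintegralZ // -cintegralD //; last exact: cintZ.
by apply: eq_cintegral => x _; rewrite mulN1r.
Qed.

Lemma normc_cintegral_le (D : set R) f (g : R -> R) : measurable D -> cint D f -> rint D g ->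
  (forall x, D x -> N (f x) <= g x) -> N (cintegral D f) <= \int[mu]_(x in D) g x.
Proof.
move=> mD hf hg H; have [u u1 <-] := normc_rotate (cintegral D f).
rewrite -cintegralZ //; have [h1 h2] := cintZ u mD hf.
apply: le_Rintegral => // x Dx; apply: le_trans (H x Dx).
apply: le_trans (ler_norm _) _; apply: le_trans (normRe _) _.
by rewrite Normc.normcM u1 mul1r.
Qed.

Lemma rintS (D E : set R) f : measurable D -> measurable E -> E `<=` D -> rint D f -> rint E f.
Proof. by move=> mD mE ED; exact: (@integrableS _ _ R mu D E (EFin \o f) mD mE ED). Qed.

Lemma cintS (D E : set R) f : measurable D -> measurable E -> E `<=` D -> cint D f -> cint E f.
Proof.
move=> mD mE ED [h1 h2]; split; [exact: rintS h1|exact: rintS h2].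
Qed.

Definition ccont (f : R -> C) : Prop :=
  continuous (fun x => Re (f x)) /\ continuous (fun x => Im (f x)).

Lemma cderiv_ccont f df : cderiv f df -> ccont f.
Proof.
move=> h; split => x; apply: differentiable_continuous; apply/derivable1_diffP.
- by case: (h x) => -[].
- by case: (h x) => _ [].
Qed.

Lemma rintMcont (D : set R) (a b : R) (h g : R -> R) : measurable D -> D `<=` `[a, b] -> continuous h ->
  rint D g -> rint D (fun x => h x * g x).
Proof.
move=> mD Dab ch hg; have [M HM] := continuous_bounded_itv a b ch.
apply: (@integrable_bdM _ D h g M) => //.
- by apply: measurable_funTS; exact: continuous_measurable_fun.
- by move=> t Dt; apply: HM; exact: Dab.
Qed.

Lemma cintM (D : set R) (a b : R) (h g : R -> C) : measurable D -> D `<=` `[a, b] -> ccont h ->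
  cint D g -> cint D (fun x => h x * g x).
Proof.
move=> mD Dab [h1 h2] [g1 g2]; split.
- apply: (eq_rint mD) (rintB mD (rintMcont mD Dab h1 g1) (rintMcont mD Dab h2 g2)) => x _.
  by rewrite cReM.
- apply: (eq_rint mD) (rintD mD (rintMcont mD Dab h1 g2) (rintMcont mD Dab h2 g1)) => x _.
  by rewrite cImM.
Qed.

Lemma itv0x (x : R) : x \in `[0, 1] -> `[0, x]%classic `<=` `[0, 1]%classic.
Proof.
rewrite in_itv /= => /andP[x0 x1]; apply: subset_itvl; by rewrite bnd_simp.
Qed.

Lemma rprim_product (F h G g : R -> R) :
  (forall s, is_derive s (1:R) F (h s)) -> continuous h -> rint `[0, 1] g ->
  (forall x, x \in `[0, 1] -> G x = G 0 + \int[mu]_(t in `[0, x]) g t) ->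
  rint `[0, 1] G /\
  forall x, x \in `[0, 1] ->
    \int[mu]_(t in `[0, x]) (h t * G t + F t * g t) = F x * G x - F 0 * G 0.
Proof.
move=> dF ch ig HG.
have cF : continuous F.
  by move=> t; apply: differentiable_continuous; apply/derivable1_diffP; case: (dF t).
have mI (x : R) : measurable `[0, x]%classic by exact: measurable_itv.
have iP : rint `[0, 1] (fun x => \int[mu]_(t in `[0, x]) g t).
  apply: continuous_compact_integrable; first exact: segment_compact.
  exact: parameterized_integral_continuous.
have iG : rint `[0, 1] G.
  apply: (eq_rint (mI 1)) (rintD (mI 1) _ iP) => [x|]; first by move/HG => /esym; exact.
  exact: integrable_cont_itv (@cst_continuous _ _ _).
split=> // x x01.
have x0 : 0 <= x by move: x01; rewrite in_itv => /andP[].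
have sx := itv0x x01.
have igx : rint `[0, x] g by exact: rintS ig.
have iPx : rint `[0, x] (fun x => \int[mu]_(t in `[0, x]) g t).
  by exact: rintS iP.
have ihx : rint `[0, x] h by exact: integrable_cont_itv.
have ihP := rintMcont (mI x) (@subset_refl _ _) ch iPx.
have iFg := rintMcont (mI x) (@subset_refl _ _) cF igx.
have iGh : rint `[0, x] (fun t => G 0 * h t) by exact: integrable_scale.
rewrite (@eq_Rintegral _ _ _ mu _ (fun t => (G 0 * h t + h t * \int[mu]_(s in `[0, t]) g s) + F t * g t)); last first.
  by move=> t; rewrite inE => /sx /HG ->; ring.
rewrite RintegralD //; last exact: (rintD (mI x) iGh ihP).
rewrite RintegralD //.
rewrite RintegralZl // (ibp_real x0 dF ch igx) (HG x x01).
have -> : \int[mu]_(s in `[0, x]) h s = F x - F 0.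
  move: x0; rewrite le_eqVlt => /predU1P[<-|tx].
    by rewrite set_itv1 Rintegral_set1 subrr.
  rewrite /Rintegral (@continuous_FTC2 _ h F) //.
  - exact: continuous_subspaceT.
  - split; first by move=> z _; case: (dF z).
    + exact: cvg_at_right_filter (cF 0).
    + exact: cvg_at_left_filter (cF x).
  - by move=> z _; rewrite derive1E; case: (dF z).
ring.
Qed.

(* [G] is absolutely continuous on [[0, 1]] with density [g]. *)
Definition primitive (G g : R -> C) : Prop :=
  cint `[0, 1] g /\ forall x, x \in `[0, 1] -> G x = G 0 + cintegral `[0, x] g.

(** The product rule in integrated form, for a smooth factor and an absolutely continuous one; the
    real and imaginary parts of the factors give four real instances. *)
Lemma primitive_product F h G g : cderiv F h -> ccont h -> primitive G g ->
  cint `[0, 1] G /\ primitive (fun x => F x * G x) (fun x => h x * G x + F x * g x).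
Proof.
move=> dF [ch1 ch2] [[g1 g2] HG].
have Hr x : x \in `[0, 1] -> Re (G x) = Re (G 0) + \int[mu]_(t in `[0, x]) Re (g t).
  by move/HG => ->; rewrite cReD.
have Hi x : x \in `[0, 1] -> Im (G x) = Im (G 0) + \int[mu]_(t in `[0, x]) Im (g t).
  by move/HG => ->; rewrite cImD.
have dFr s := (dF s).1; have dFi s := (dF s).2.
have [iGr Prr] := rprim_product dFr ch1 g1 Hr.
have [iGi Pii] := rprim_product dFi ch2 g2 Hi.
have [_ Pri] := rprim_product dFr ch1 g2 Hi.
have [_ Pir] := rprim_product dFi ch2 g1 Hr.
have cF : ccont F := cderiv_ccont dF.
have mI (x : R) : measurable `[0, x]%classic by exact: measurable_itv.
split; first by split.
have ihG x : x \in `[0, 1] -> forall (h' G' F' g' : R -> R), continuous h' -> continuous F' -> rint `[0, 1] G' -> rint `[0, 1] g' ->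
   rint `[0, x] (fun t => h' t * G' t + F' t * g' t).
  move=> x01 h' G' F' g' c1 c2 i1 i2; have sx := itv0x x01.
  have j1 := rintMcont (mI x) (@subset_refl _ _) c1 (rintS (mI 1) (mI x) sx i1).
  have j2 := rintMcont (mI x) (@subset_refl _ _) c2 (rintS (mI 1) (mI x) sx i2).
  exact: (rintD (mI x) j1 j2).
case: cF => cFr cFi.
split.
  have j1 := cintM (mI 1) (@subset_refl _ _) (conj ch1 ch2) (conj iGr iGi).
  have j2 := cintM (mI 1) (@subset_refl _ _) (conj cFr cFi) (conj g1 g2).
  exact: (cintD (mI 1) j1 j2).
move=> x x01; apply/eqP; rewrite eq_complex; apply/andP; split; apply/eqP.
- rewrite cReD /cintegral /= (@eq_Rintegral _ _ _ mu _ (fun t =>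
    (Re (h t) * Re (G t) + Re (F t) * Re (g t)) - (Im (h t) * Im (G t) + Im (F t) * Im (g t)))); last first.
    by move=> t _; rewrite cReD !cReM; ring.
  rewrite RintegralB // ?Prr ?Pii ?cReM //; try exact: ihG.
  ring.
- rewrite cImD /cintegral /= (@eq_Rintegral _ _ _ mu _ (fun t =>
    (Re (h t) * Im (G t) + Re (F t) * Im (g t)) + (Im (h t) * Re (G t) + Im (F t) * Re (g t)))); last first.
    by move=> t _; rewrite cImD !cImM; ring.
  rewrite RintegralD // ?Pri ?Pir ?cImM //; try exact: ihG.
  ring.
Qed.

End CIntegral.

(** * Square-integrable functions and equality almost everywhere *)

Section SquareIntegrable.
Variable R : realType.
Local Notation C := R[i].
Local Notation N := (@Normc.normc R).
Local Notation mu := (@lebesgue_measure R).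
Local Notation Re := complex.Re.
Local Notation Im := complex.Im.

Definition rL2 (D : set R) (f : R -> R) : Prop :=
  measurable_fun D f /\ rint D (fun x => f x ^+ 2).

Lemma rint_meas (D : set R) f : rint D f -> measurable_fun D f.
Proof. by move=> h; apply/measurable_EFinP; exact: measurable_int h. Qed.

Lemma le_rint (D : set R) (f g : R -> R) : measurable D -> measurable_fun D f ->
  (forall x, D x -> `|f x| <= g x) -> rint D g -> rint D f.
Proof.
move=> mD mf fg ig.
apply: (@le_integrable _ _ R mu D mD (EFin \o f) (EFin \o g)) => //.
- exact/measurable_EFinP.
- move=> x Dx; rewrite /= lee_fin; apply: le_trans (fg x Dx) _; exact: ler_norm.
Qed.

Lemma rint_cst (D : set R) (c : R) : measurable D -> D `<=` `[0, 1] -> rint D (fun=> c).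
Proof.
move=> mD D01; apply: (rintS (measurable_itv _) mD D01).
exact: integrable_cont_itv (@cst_continuous _ _ _).
Qed.

Lemma rL2_rintM (D : set R) f g : measurable D -> rL2 D f -> rL2 D g -> rint D (fun x => f x * g x).
Proof.
move=> mD [mf if2] [mg ig2]; apply: (@le_rint _ _ (fun x => f x ^+ 2 + g x ^+ 2)) => //.
- exact: measurable_funM.
- move=> x _; rewrite normrM -(real_normK (num_real (f x))) -(real_normK (num_real (g x))).
  have := sqr_ge0 (`|f x| - `|g x|); have := normr_ge0 (f x); have := normr_ge0 (g x).
  set u := `|f x|; set v := `|g x|; move=> v0 u0 h.
  have uv : 0 <= u * v by rewrite mulr_ge0.
  have e : (u - v) ^+ 2 = u ^+ 2 + v ^+ 2 - 2 * (u * v) by ring.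
  by rewrite e in h; lra.
- exact: rintD.
Qed.

Lemma rL2_cst (D : set R) (c : R) : measurable D -> D `<=` `[0, 1] -> rL2 D (fun=> c).
Proof. by move=> mD D01; split=> //; exact: rint_cst. Qed.

Lemma rL2_rint (D : set R) f : measurable D -> D `<=` `[0, 1] -> rL2 D f -> rint D f.
Proof.
move=> mD D01 hf; apply: (eq_rint mD) (rL2_rintM mD hf (rL2_cst 1 mD D01)) => x _.
by rewrite mulr1.
Qed.

Lemma rL2D (D : set R) f g : measurable D -> rL2 D f -> rL2 D g -> rL2 D (fun x => f x + g x).
Proof.
move=> mD hf hg; split; first by apply: measurable_funD; [case: hf|case: hg].
have h1 := rintD mD hf.2 (integrable_scale 2 mD (rL2_rintM mD hf hg)).
by apply: (eq_rint mD) (rintD mD h1 hg.2) => x _; ring.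
Qed.

Lemma rL2Z (D : set R) c f : measurable D -> rL2 D f -> rL2 D (fun x => c * f x).
Proof.
move=> mD [mf hf]; split; first exact: measurable_funM.
by apply: (eq_rint mD) (integrable_scale (c ^+ 2) mD hf) => x _; rewrite exprMn.
Qed.

Lemma rL2B (D : set R) f g : measurable D -> rL2 D f -> rL2 D g -> rL2 D (fun x => f x - g x).
Proof.
move=> mD hf hg; have := rL2D mD hf (rL2Z (-1) mD hg).
by congr (rL2 D _); apply/funext => x; rewrite mulN1r.
Qed.

Lemma rL2_bounded (D : set R) (f : R -> R) (M : R) : measurable D -> D `<=` `[0, 1] -> measurable_fun D f ->
  (forall x, D x -> `|f x| <= M) -> rL2 D f.
Proof.
move=> mD D01 mf fM; split=> //; apply: (@le_rint _ _ (fun=> M ^+ 2)) => //.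
- by apply: measurable_funX.
- move=> x Dx; rewrite normrX lerXn2r ?nnegrE //; last exact: fM.
  exact: le_trans (normr_ge0 _) (fM x Dx).
- exact: rint_cst.
Qed.

Lemma rL2_cont (D : set R) f : measurable D -> D `<=` `[0, 1] -> continuous f -> rL2 D f.
Proof.
move=> mD D01 cf; have [M HM] := continuous_bounded_itv 0 1 cf.
apply: (@rL2_bounded _ _ M) => //; last by move=> x /D01; exact: HM.
by apply: measurable_funTS; exact: continuous_measurable_fun.
Qed.

Lemma rL2S (D E : set R) f : measurable D -> measurable E -> E `<=` D -> rL2 D f -> rL2 E f.
Proof.
move=> mD mE ED [mf hf]; split; [exact: measurable_funS mf|exact: rintS hf].
Qed.

Lemma eq_rL2 (D : set R) f g : measurable D -> (forall x, D x -> f x = g x) -> rL2 D f -> rL2 D g.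
Proof.
move=> mD e [mf hf]; split.
- apply: eq_measurable_fun mf => x; rewrite inE => Dx; exact: e.
- by apply: (eq_rint mD) hf => x Dx; rewrite e.
Qed.

Lemma sqnorm2_rint (D : set R) f : measurable D ->
  rL2 D (fun x => Re (f x)) -> rL2 D (fun x => Im (f x)) ->
  sqnorm2 D f = ((\int[mu]_(x in D) (Re (f x) ^+ 2))%R +
    (\int[mu]_(x in D) (Im (f x) ^+ 2))%R)%:E.
Proof.
move=> mD [m1 h1] [m2 h2]; rewrite -RintegralD // /Rintegral fineK; last first.
  by apply: integrable_fin_num => //; exact: rintD.
by rewrite /sqnorm2; apply: eq_integral => x _; rewrite normc_sqr.
Qed.

Lemma L2P (D : set R) f : measurable D ->
  L2 D f <-> rL2 D (fun x => Re (f x)) /\ rL2 D (fun x => Im (f x)).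
Proof.
move=> mD; split => [[m1 m2 h]|[h1 h2]]; last first.
  by split; [case: h1|case: h2|rewrite sqnorm2_rint // ltry].
have ig : rint D (fun x => N (f x) ^+ 2).
  apply/integrableP; split.
    apply/measurable_EFinP; rewrite (_ : (fun x => _) = fun x => Re (f x) ^+ 2 + Im (f x) ^+ 2); last first.
      by apply/funext => x; rewrite normc_sqr.
    by apply: measurable_funD; apply: measurable_funX.
  apply: le_lt_trans h; rewrite /sqnorm2 le_eqVlt; apply/orP; left; apply/eqP.
  by apply: eq_integral => x _ /=; rewrite ger0_norm ?sqr_ge0.
split; split => //; apply: (le_rint mD _ _ ig).
- exact: measurable_funX.
- by move=> x _; rewrite ger0_norm ?sqr_ge0 // normc_sqr lerDl sqr_ge0.
- exact: measurable_funX.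
- by move=> x _; rewrite ger0_norm ?sqr_ge0 // normc_sqr lerDr sqr_ge0.
Qed.

Lemma itvoo_sub (a b c d : R) : c <= a -> b <= d -> `]a, b[%classic `<=` `[c, d]%classic.
Proof.
by move=> ca bd; apply: subset_itv; rewrite bnd_simp.
Qed.

Lemma L2_cint (f : R -> C) : L2 `]0, 1[ f -> cint `[0, 1] f.
Proof.
have mD : measurable (`]0, 1[%classic : set R) by exact: measurable_itv.
have s01 : `]0, 1[%classic `<=` `[(0:R), 1]%classic by exact: itvoo_sub.
have aux (g : R -> R) : rint `]0, 1[ g -> rint `[0, 1] g.
  move=> h; have mg := rint_meas h; apply/integrableP; split.
    by apply/measurable_EFinP; exact: measurable_fun_itv_cc mg.
  rewrite integral_itv_bndoo; first by case/integrableP : h.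
  by apply: measurableT_comp => //; apply/measurable_EFinP.
by move=> /(L2P _ mD)[h1 h2]; split; apply: aux; apply: rL2_rint.
Qed.

Lemma ae_mono (P Q : R -> Prop) : (forall x, P x -> Q x) ->
  (\forall x \ae mu, P x) -> \forall x \ae mu, Q x.
Proof. by move=> PQ; apply: filterS => //; exact: (ae_filter_ringOfSetsType mu). Qed.

Lemma ae_and (P Q : R -> Prop) :
  (\forall x \ae mu, P x) -> (\forall x \ae mu, Q x) -> \forall x \ae mu, P x /\ Q x.
Proof. by move=> hP hQ; apply: filterI => //; exact: (ae_filter_ringOfSetsType mu). Qed.

Lemma ae_open_closed (P : R -> Prop) :
  {ae mu, forall x, x \in `]0, 1[ -> P x} -> {ae mu, forall x, x \in `[0, 1] -> P x}.
Proof.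
have ne (c : R) : {ae mu, forall x, x <> c}.
  exists [set c]; split => //; first exact: lebesgue_measure_set1.
  by move=> x /= /contrapT ->.
move=> h; apply: ae_mono (ae_and (ne 0) (ae_and (ne 1) h)) => x [x0 [x1 H]]; rewrite in_itv /= => /andP[h0 h1].
apply: H; rewrite in_itv /= !lt_neqAle h0 h1 !andbT eq_sym.
by apply/andP; split; apply/eqP.
Qed.

Lemma cintegral_ae (D : set R) f g : measurable D -> cint D f -> cint D g ->
  {ae mu, forall x, D x -> f x = g x} -> cintegral D f = cintegral D g.
Proof.
move=> mD [f1 f2] [g1 g2] e; rewrite /cintegral /Rintegral.
have m1 := measurable_int _ f1; have m2 := measurable_int _ f2.
have m3 := measurable_int _ g1; have m4 := measurable_int _ g2.
congr (fine _ +i* fine _).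
- by apply: ae_eq_integral => //; apply: ae_mono e => x H Dx /=; rewrite H.
- by apply: ae_eq_integral => //; apply: ae_mono e => x H Dx /=; rewrite H.
Qed.

End SquareIntegrable.

(** * The differential equation *)

Section Equation.
Variable R : realType.
Local Notation C := R[i].
Local Notation mu := (@lebesgue_measure R).
Local Notation Re := complex.Re.
Local Notation Im := complex.Im.

Lemma cintegral_set1 (f : R -> C) x : cintegral `[x, x] f = 0.
Proof. by rewrite /cintegral set_itv1 !Rintegral_set1. Qed.

Lemma mem0_01 : (0:R) \in `[0, 1]. Proof. by rewrite in_itv /= lexx ler01. Qed.
Lemma mem1_01 : (1:R) \in `[0, 1]. Proof. by rewrite in_itv /= lexx ler01. Qed.

Lemma primitive_prim (g : R -> C) : cint `[0, 1] g -> primitive (fun x => cintegral `[0, x] g) g.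
Proof. by move=> ig; split=> // x _; rewrite cintegral_set1 add0r. Qed.

Lemma eq_primitive (G H g h : R -> C) : (forall x, x \in `[0, 1] -> G x = H x) ->
  (forall x, x \in `[0, 1] -> g x = h x) -> primitive G g -> primitive H h.
Proof.
move=> e1 e2 [ig HG]; split; first exact: eq_cint ig.
move=> x x01; rewrite -!e1 ?mem0_01 // HG //; congr (_ + _).
by apply: eq_cintegral => t tx; apply: e2; exact: (itv0x x01).
Qed.

Lemma primitiveD (G H g h : R -> C) : primitive G g -> primitive H h ->
  primitive (fun x => G x + H x) (fun x => g x + h x).
Proof.
move=> [ig HG] [ih HH]; split; first exact: cintD.
move=> x x01; rewrite HG // (HH x) // cintegralD //; try exact: cintS (itv0x x01) _.
ring.
Qed.

Lemma primitiveZ c (G g : R -> C) : primitive G g -> primitive (fun x => c * G x) (fun x => c * g x).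
Proof.
move=> [ig HG]; split; first exact: cintZ.
move=> x x01; rewrite HG // cintegralZ //; last exact: cintS (itv0x x01) _.
ring.
Qed.

Lemma primitiveB (G H g h : R -> C) : primitive G g -> primitive H h ->
  primitive (fun x => G x - H x) (fun x => g x - h x).
Proof.
move=> h1 h2; apply: eq_primitive (primitiveD h1 (primitiveZ (-1) h2)) => x _; by rewrite mulN1r.
Qed.

Lemma cint_cst (c : C) (a b : R) : cint `[a, b] (fun=> c).
Proof. by split; apply: integrable_cont_itv; exact: cst_continuous. Qed.

Lemma primitive_cderiv (F h : R -> C) : cderiv F h -> ccont h -> primitive F h.
Proof.
move=> dF ch.
have p1 : primitive (fun=> 1 : C) (fun=> 0).
  split; first exact: cint_cst.
  move=> x _; rewrite /cintegral /= [X in X +i* _](_ : _ = 0) ?[X in _ +i* X](_ : _ = 0) ?addr0 //;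
  by rewrite /Rintegral integral0.
have [_] := primitive_product dF ch p1.
by apply: eq_primitive => x _; rewrite ?mulr1 ?mulr0 ?addr0.
Qed.

Lemma solution_primitive (q : R -> C) a l y dy : solution q a l y dy ->
  exists d2y, [/\ primitive dy d2y, primitive y dy &
    {ae mu, forall x, x \in `]0, 1[ -> - d2y x + q x * y a = l * y x}].
Proof.
move=> [d2y [L2d Hdy Hy E]]; exists d2y.
have p1 : primitive dy d2y by split=> //; exact: L2_cint.
split=> //; split=> //.
(* Only the integrability of [dy] is wanted here; the product with the constant 1 supplies it. *)
have [h _] := primitive_product (cderiv_cst 1) (conj (@cst_continuous _ _ _) (@cst_continuous _ _ _)) p1.
exact: h.
Qed.

Lemma solution_lagrange (q : R -> C) a l y dy (phi psi : R -> C) x :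
  L2 `]0, 1[ q -> solution q a l y dy -> cderiv phi psi -> cderiv psi (fun t => - l * phi t) ->
  x \in `[0, 1] ->
  phi x * dy x - psi x * y x - (phi 0 * dy 0 - psi 0 * y 0) =
  y a * cintegral `[0, x] (fun t => q t * phi t).
Proof.
move=> L2q /solution_primitive [d2y [p1 p2 E]] dphi dpsi x01.
have cphi := cderiv_ccont dphi; have cpsi := cderiv_ccont dpsi.
have cpsi' : ccont (fun t => - l * phi t) by exact: cderiv_ccont (cderivZ (- l) dphi).
have [_ r1] := primitive_product dphi cpsi p1.
have [iy r2] := primitive_product dpsi cpsi' p2.
have [ir H] := primitiveB r1 r2.
rewrite (H x x01) addrAC subrr add0r -cintegralZ //; last first.
  apply: cintS (itv0x x01) _ => //; apply: (eq_cint _ _ (cintM _ (@subset_refl _ _) cphi (L2_cint L2q))) => // t _.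
  by rewrite mulrC.
apply: cintegral_ae => //.
- exact: cintS (itv0x x01) ir.
- apply: cintZ => //; apply: cintS (itv0x x01) _ => //.
  apply: (eq_cint _ _ (cintM _ (@subset_refl _ _) cphi (L2_cint L2q))) => // t _.
  by rewrite mulrC.
- apply: ae_mono (ae_open_closed E) => t Ht tx.
  have t01 := itv0x x01 tx; have := Ht t01 => {}Ht.
  have -> : y a * (q t * phi t) = phi t * (q t * y a) by ring.
  have -> : q t * y a = d2y t + l * y t by rewrite -Ht; ring.
  ring.
Qed.

End Equation.

(** * Existence of solutions and the characteristic determinant *)

Section Characteristic.
Variable R : realType.
Local Notation C := R[i].
Local Notation mu := (@lebesgue_measure R).
Local Notation Re := complex.Re.
Local Notation Im := complex.Im.

(** Serves to put y'' = u q - l y in L_2, as [solution] requires. *)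
Lemma primitive_L2 (G g : R -> C) : primitive G g -> L2 `]0, 1[ G.
Proof.
move=> [[g1 g2] HG].
have mD : measurable (`]0, 1[%classic : set R) by exact: measurable_itv.
have mI : measurable (`[0, 1]%classic : set R) by exact: measurable_itv.
have s01 : `]0, 1[%classic `<=` `[(0:R), 1]%classic by exact: itvoo_sub.
have aux (h P : R -> R) c : rint `[0, 1] h ->
    (forall x, x \in `[0, 1] -> P x = c + \int[mu]_(t in `[0, x]) h t) -> rL2 `]0, 1[ P.
  move=> ih HP; apply: (@rL2S R `[0, 1]%classic) => //.
  have cP : {within `[0, 1], continuous (fun x => c + \int[mu]_(t in `[0, x]) h t)}.
    apply/subspace_continuousP => x x01; apply: cvgD; first exact: cvg_cst.
    by have /subspace_continuousP := parameterized_integral_continuous ler01 ih; apply.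
  apply: (@eq_rL2 _ _ (fun x => c + \int[mu]_(t in `[0, x]) h t)) => //.
    by move=> x /HP.
  have [M [_ HM]] := compact_bounded (continuous_compact cP (@segment_compact _ 0 1)).
  apply: (@rL2_bounded _ _ _ (M + 1)) => //.
  - exact: subspace_continuous_measurable_fun.
  - by move=> x x01; apply: (HM (M + 1)); [rewrite ltrDl|exists x].
apply/(L2P _ mD); split.
- by apply: (aux _ _ (Re (G 0)) g1) => x x01; rewrite HG // cReD.
- by apply: (aux _ _ (Im (G 0)) g2) => x x01; rewrite HG // cImD.
Qed.

Lemma L2D (D : set R) (f g : R -> C) : measurable D -> L2 D f -> L2 D g -> L2 D (fun x => f x + g x).
Proof.
move=> mD /(L2P _ mD)[f1 f2] /(L2P _ mD)[g1 g2]; apply/(L2P _ mD); split.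
- by apply: (eq_rL2 mD _ (rL2D mD f1 g1)) => x _; rewrite cReD.
- by apply: (eq_rL2 mD _ (rL2D mD f2 g2)) => x _; rewrite cImD.
Qed.

Lemma L2Z (D : set R) (c : C) (f : R -> C) : measurable D -> L2 D f -> L2 D (fun x => c * f x).
Proof.
move=> mD /(L2P _ mD)[f1 f2]; apply/(L2P _ mD); split.
- by apply: (eq_rL2 mD _ (rL2B mD (rL2Z (Re c) mD f1) (rL2Z (Im c) mD f2))) => x _; rewrite cReM.
- by apply: (eq_rL2 mD _ (rL2D mD (rL2Z (Re c) mD f2) (rL2Z (Im c) mD f1))) => x _; rewrite cImM.
Qed.

Lemma ccont_cosl l : ccont (@cosl R l). Proof. exact: cderiv_ccont (cderiv_cosl l). Qed.
Lemma ccont_sinl l : ccont (@sinl R l). Proof. exact: cderiv_ccont (cderiv_sinl l). Qed.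
Lemma ccont_Nsinl l : ccont (fun x => - l * @sinl R l x).
Proof. exact: cderiv_ccont (cderivZ (- l) (cderiv_sinl l)). Qed.

Lemma cderiv_Nsinl (l : C) : cderiv (fun x => - l * @sinl R l x) (fun x => - l * cosl l x).
Proof. exact: (cderivZ (- l) (cderiv_sinl l)). Qed.

(** Once y(a) = u is imposed, the equation is the linear one y'' + l y = u q. Variation of constants
    gives the particular solution u P, where P'' + l P = q and P(0) = P'(0) = 0, and a homogeneous
    solution corrects the data at a. *)
Lemma exists_solution (q : R -> C) a l u v : L2 `]0, 1[ q -> a \in `[0, 1] ->
  exists y dy, [/\ solution q a l y dy, y a = u & dy a = v].
Proof.
move=> L2q a01.
have mI : measurable (`[0, 1]%classic : set R) by exact: measurable_itv.
have mD : measurable (`]0, 1[%classic : set R) by exact: measurable_itv.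
have iq := L2_cint L2q.
have pA := primitive_prim (cintM mI (@subset_refl _ _) (ccont_cosl l) iq).
have pB := primitive_prim (cintM mI (@subset_refl _ _) (ccont_sinl l) iq).
set A := (fun x : R => _) in pA; set B := (fun x : R => _) in pB.
have [_ sA] := primitive_product (cderiv_sinl l) (ccont_cosl l) pA.
have [_ cA] := primitive_product (cderiv_cosl l) (ccont_Nsinl l) pA.
have [_ sB] := primitive_product (cderiv_sinl l) (ccont_cosl l) pB.
have [_ cB] := primitive_product (cderiv_cosl l) (ccont_Nsinl l) pB.
pose P x := sinl l x * A x - cosl l x * B x.
pose dP x := cosl l x * A x + l * (sinl l x * B x).
(* u' and v' are the data at a left to the homogeneous part; al and be are its value and derivative
   at 0, obtained by solving back from a to 0. *)
pose u' := u - u * P a; pose v' := v - u * dP a.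
pose al := u' * cosl l a - v' * sinl l a; pose be := l * u' * sinl l a + v' * cosl l a.
pose y x := al * cosl l x + be * sinl l x + u * P x.
pose dy x := al * (- l * sinl l x) + be * cosl l x + u * dP x.
pose d2y x := u * q x - l * y x.
have py : primitive y dy.
  have h1 := primitiveZ al (primitive_cderiv (cderiv_cosl l) (ccont_Nsinl l)).
  have h2 := primitiveZ be (primitive_cderiv (cderiv_sinl l) (ccont_cosl l)).
  have h3 := primitiveZ u (primitiveB sA cB).
  apply: eq_primitive (primitiveD (primitiveD h1 h2) h3) => x x01 //.
  rewrite /dy /dP; ring.
have pdy : primitive dy d2y.
  have h1 := primitiveZ al (primitive_cderiv (cderiv_Nsinl l) (cderiv_ccont (cderivZ (- l) (cderiv_cosl l)))).
  have h2 := primitiveZ be (primitive_cderiv (cderiv_cosl l) (ccont_Nsinl l)).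
  have h3 := primitiveZ u (primitiveD cA (primitiveZ l sB)).
  apply: eq_primitive (primitiveD (primitiveD h1 h2) h3) => x x01 //.
  (* Differentiating dP produces q multiplied by cosl^2 + l sinl^2, so the factor 1 in front of u q
     is written in that form before calling [ring]. *)
  rewrite /d2y /y /P -[u * q x]mulr1 -(cosl_sqr l x); ring.
exists y, dy; split.
- exists d2y; split; [|exact: pdy.2|exact: py.2|].
  + have h := L2D mD (L2Z u mD L2q) (L2Z (- l) mD (primitive_L2 py)).
    by congr (L2 _ _): h; apply/funext => x; rewrite /d2y mulNr.
  + apply: aeW => x _; rewrite /d2y.
    suff -> : y a = u by ring.
    rewrite /y /al /be -[RHS](subrK (u * P a)) -/u' -{3}[u']mulr1 -(cosl_sqr l a); ring.
- rewrite /y /al /be -[RHS](subrK (u * P a)) -/u' -{3}[u']mulr1 -(cosl_sqr l a); ring.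
- rewrite /dy /al /be -[RHS](subrK (u * dP a)) -/v' -{3}[v']mulr1 -(cosl_sqr l a); ring.
Qed.

Lemma cintegral_split (f : R -> C) a : a \in `[0, 1] -> cint `[0, 1] f ->
  cintegral `[0, 1] f = cintegral `[0, a] f + cintegral `]a, 1] f.
Proof.
move=> a01 [h1 h2]; have := a01; rewrite in_itv /= => /andP[a0 a1].
have := Rintegral_itvB (x := a) h1; have := Rintegral_itvB (x := a) h2.
rewrite !bnd_simp => /(_ a0 a1) e2 /(_ a0 a1) e1.
rewrite /cintegral -e1 -e2; apply/eqP; rewrite eq_complex /=.
by apply/andP; split; apply/eqP; ring.
Qed.

(* The kernel of [2 - 2 sg cosl l 1 - Delta l] against [q], as a function of the distance to [a]. *)
Definition kernel_fun (sg l : C) (s : R) : C := sinl l s + sg * sinl l (1 - s).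

Lemma ccontD f g : @ccont R f -> ccont g -> ccont (fun x => f x + g x).
Proof.
move=> [f1 f2] [g1 g2]; split => x.
- under eq_fun do rewrite cReD; exact: (@continuousD _ _ _ _ _ _ (f1 x) (g1 x)).
- under eq_fun do rewrite cImD; exact: (@continuousD _ _ _ _ _ _ (f2 x) (g2 x)).
Qed.

(** Lagrange's identity against [sinl l] and [cosl l] on [0, a] and on [0, 1] is a linear system for
    the four boundary values; its determinant is [cosl_sqr]. *)
Lemma sol_values (q : R -> C) a l y dy : L2 `]0, 1[ q -> a \in `[0, 1] ->
  solution q a l y dy ->
  let A x := cintegral `[0, x] (fun t => q t * cosl l t) in
  let B x := cintegral `[0, x] (fun t => q t * sinl l t) in
  [/\ y 0 = y a * B a + cosl l a * y a - sinl l a * dy a,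
      dy 0 = cosl l a * dy a + l * sinl l a * y a - y a * A a,
      y 1 = cosl l 1 * (y 0 - y a * B 1) + sinl l 1 * (dy 0 + y a * A 1) &
      dy 1 = cosl l 1 * (dy 0 + y a * A 1) - l * sinl l 1 * (y 0 - y a * B 1)].
Proof.
move=> L2q a01 sol A B.
have ds : cderiv (@cosl R l) (fun t => - l * sinl l t) by exact: cderiv_cosl.
have L1 x := solution_lagrange L2q sol (cderiv_sinl l) ds (x := x).
have L2 x := solution_lagrange L2q sol (cderiv_cosl l) (@cderiv_Nsinl l) (x := x).
have := L1 _ a01; have := L1 _ (@mem1_01 R); have := L2 _ a01; have := L2 _ (@mem1_01 R).
rewrite -!/(A _) -!/(B _) !cosl0 !sinl0 => e4 e3 e2 e1.
have E1 : y 0 = y a * B a + cosl l a * y a - sinl l a * dy a by rewrite -e1; ring.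
have E2 : dy 0 = cosl l a * dy a + l * sinl l a * y a - y a * A a by rewrite -e3; ring.
have E3 : y 0 - y a * B 1 = cosl l 1 * y 1 - sinl l 1 * dy 1 by rewrite -e2; ring.
have E4 : dy 0 + y a * A 1 = cosl l 1 * dy 1 + l * sinl l 1 * y 1 by rewrite -e4; ring.
by split=> //; rewrite E3 E4 -[LHS]mulr1 -[X in _ * X = _](cosl_sqr l 1); ring.
Qed.

(** Since s(a) = 0, the solution s does not see q, so every product in the determinant contains at
    most one integral of q and the result is affine in q. The expansion consists of the Wronskians
    of c and s at 0 and at 1, joined by [sg ^+ 2 = 1], and of the mixed terms, where the kernel in 1
    - |t - a| arises. *)
Lemma characteristic_value (q : R -> C) a (sg l : C) c dc s ds :
  L2 `]0, 1[ q -> a \in `[0, 1] -> sg ^+ 2 = 1 ->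
  solution q a l c dc -> solution q a l s ds ->
  c a = 1 -> dc a = 0 -> s a = 0 -> ds a = 1 ->
  (c 0 - sg * c 1) * (ds 0 - sg * ds 1) - (s 0 - sg * s 1) * (dc 0 - sg * dc 1) =
  2 - 2 * sg * cosl l 1 - (cintegral `[0, a] (fun t => q t * kernel_fun sg l (a - t)) +
    cintegral `]a, 1] (fun t => q t * kernel_fun sg l (t - a))).
Proof.
move=> L2q a01 sg2 solc sols ca dca sa dsa.
have iq := L2_cint L2q.
have mI : measurable (`[0, 1]%classic : set R) by exact: measurable_itv.
have mIa : measurable (`[0, a]%classic : set R) by exact: measurable_itv.
have mIb : measurable (`]a, 1]%classic : set R) by exact: measurable_itv.
have [] := sol_values L2q a01 solc; have [] := sol_values L2q a01 sols.
pose A x := cintegral `[0, x] (fun t => q t * cosl l t).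
pose B x := cintegral `[0, x] (fun t => q t * sinl l t).
rewrite -!/(A _) -!/(B _) ca dca sa dsa !(mul0r, mulr0, mulr1, mul1r, addr0, add0r, subr0) => s0 ds0 s1 ds1 c0 dc0 c1 dc1.
have iqc : cint `[0, 1] (fun t => q t * cosl l t).
  by apply: (eq_cint mI _ (cintM mI (@subset_refl _ _) (ccont_cosl l) iq)) => t _; rewrite mulrC.
have iqs : cint `[0, 1] (fun t => q t * sinl l t).
  by apply: (eq_cint mI _ (cintM mI (@subset_refl _ _) (ccont_sinl l) iq)) => t _; rewrite mulrC.
have sA := cintegral_split a01 iqc; have sB := cintegral_split a01 iqs.
have suba : `[0, a]%classic `<=` `[0, 1]%classic := itv0x a01.
have subb : `]a, 1]%classic `<=` `[0, 1]%classic.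
  by move: a01; rewrite in_itv /= => /andP[a0 _]; apply: subset_itvr; rewrite bnd_simp.
set Ca := cosl l a in s0 ds0 c0 dc0 *; set Sa := sinl l a in s0 ds0 c0 dc0 *.
set C1 := cosl l 1 in s1 ds1 c1 dc1 *; set S1 := sinl l 1 in s1 ds1 c1 dc1 *.
have S1a : sinl l (1 - a) = S1 * Ca - C1 * Sa by rewrite sinlD coslN sinlN mulrN.
have C1a : cosl l (1 - a) = C1 * Ca + l * S1 * Sa by rewrite coslD coslN sinlN -/C1 -/S1 -/Ca -/Sa; ring.
have S1b : sinl l (1 + a) = S1 * Ca + C1 * Sa by rewrite sinlD.
have C1b : cosl l (1 + a) = C1 * Ca - l * S1 * Sa by rewrite coslD.
have -> : cintegral `[0, a] (fun t => q t * kernel_fun sg l (a - t)) =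
   (Sa + sg * (S1 * Ca - C1 * Sa)) * A a + (- Ca + sg * (C1 * Ca + l * S1 * Sa)) * B a.
  rewrite /A /B -!cintegralZ //; try exact: cintS suba _.
  rewrite -cintegralD //; try by apply: cintZ => //; exact: cintS suba _.
  apply: eq_cintegral => t _; rewrite /kernel_fun (_ : 1 - (a - t) = (1 - a) + t); last by ring.
  rewrite (sinlD l a (- t)) (sinlD l (1 - a) t) coslN sinlN S1a C1a -/Ca -/Sa; ring.
have -> : cintegral `]a, 1] (fun t => q t * kernel_fun sg l (t - a)) =
   (- Sa + sg * (S1 * Ca + C1 * Sa)) * (A 1 - A a) + (Ca - sg * (C1 * Ca - l * S1 * Sa)) * (B 1 - B a).
  have -> : A 1 - A a = cintegral `]a, 1] (fun t => q t * cosl l t) by rewrite /A sA; ring.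
  have -> : B 1 - B a = cintegral `]a, 1] (fun t => q t * sinl l t) by rewrite /B sB; ring.
  rewrite -!cintegralZ //; try exact: cintS subb _.
  rewrite -cintegralD //; try by apply: cintZ => //; exact: cintS subb _.
  apply: eq_cintegral => t _; rewrite /kernel_fun (_ : 1 - (t - a) = (1 + a) + - t); last by ring.
  rewrite (sinlD l t (- a)) (sinlD l (1 + a) (- t)) !coslN !sinlN S1b C1b -/Ca -/Sa; ring.
have d0 : c 0 * ds 0 - s 0 * dc 0 = 1 + B a * Ca - A a * Sa.
  rewrite c0 ds0 s0 dc0 -[1](cosl_sqr l a) -/Ca -/Sa; ring.
have d1 : c 1 * ds 1 - s 1 * dc 1 = 1 + (B a - B 1) * Ca - (A a - A 1) * Sa.
  have -> : c 1 * ds 1 - s 1 * dc 1 = (C1 ^+ 2 + l * S1 ^+ 2) * ((c 0 - B 1) * ds 0 - s 0 * (dc 0 + A 1)).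
    rewrite c1 ds1 s1 dc1; ring.
  rewrite cosl_sqr mul1r c0 ds0 s0 dc0 -[X in _ = X + _ - _](cosl_sqr l a) -/Ca -/Sa; ring.
have mix : c 0 * ds 1 + c 1 * ds 0 - s 0 * dc 1 - s 1 * dc 0 =
  2 * C1 * 1 + ((S1 * Ca - C1 * Sa) * A a + (C1 * Ca + l * S1 * Sa) * B a +
    (S1 * Ca + C1 * Sa) * (A 1 - A a) - (C1 * Ca - l * S1 * Sa) * (B 1 - B a)).
  rewrite c1 ds1 s1 dc1 c0 ds0 s0 dc0 -[X in 2 * C1 * X](cosl_sqr l a) -/Ca -/Sa; ring.
have -> : (c 0 - sg * c 1) * (ds 0 - sg * ds 1) - (s 0 - sg * s 1) * (dc 0 - sg * dc 1) =
  (c 0 * ds 0 - s 0 * dc 0) + sg ^+ 2 * (c 1 * ds 1 - s 1 * dc 1) -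
  sg * (c 0 * ds 1 + c 1 * ds 0 - s 0 * dc 1 - s 1 * dc 0) by ring.
rewrite d0 d1 mix sg2; ring.
Qed.

End Characteristic.

(** * Euler products *)

Section EulerProduct.
Variable R : realType.
Local Notation C := R[i].
Local Notation N := (@Normc.normc R).
Local Notation mu := (@lebesgue_measure R).
Local Notation Re := complex.Re.
Local Notation Im := complex.Im.

Definition cospi (t : R) : R := cos (pi * t).
Definition sinpi (t : R) : R := sin (pi * t).

Lemma is_derive_cospi (t : R) : is_derive t (1:R) cospi (- pi * sinpi t).
Proof.
apply: is_derive_val (@is_derive1_comp _ cos (fun s => pi * s) t _ _ (is_derive_cos _) (is_deriveMl pi t)) _.
by rewrite /sinpi; ring.
Qed.

Lemma is_derive_sinpi (t : R) : is_derive t (1:R) sinpi (pi * cospi t).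
Proof.
apply: is_derive_val (@is_derive1_comp _ sin (fun s => pi * s) t _ _ (is_derive_sin _) (is_deriveMl pi t)) _.
by rewrite /cospi; ring.
Qed.

Lemma cderiv_cospi : cderiv (fun t => (cospi t)%:C) (fun t => - pi%:C * (sinpi t)%:C).
Proof.
apply: cderiv_eq (cderiv_real is_derive_cospi) _ => t; by rewrite -rmorphN -rmorphM.
Qed.

Lemma cderiv_sinpi : cderiv (fun t => (sinpi t)%:C) (fun t => pi%:C * (cospi t)%:C).
Proof.
apply: cderiv_eq (cderiv_real is_derive_sinpi) _ => t; by rewrite -rmorphM.
Qed.

Lemma cderivX f df n : @cderiv R f df ->
  cderiv (fun t => f t ^+ n.+1) (fun t => n.+1%:R * f t ^+ n * df t).
Proof.
move=> h; elim: n => [|n IH].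
  by apply: cderiv_eq h _ => t; rewrite expr0 !mul1r.
rewrite (_ : (fun t => f t ^+ n.+2) = fun t => f t * f t ^+ n.+1); last by apply/funext => t; rewrite exprS.
by apply: cderiv_eq (cderivM h IH) _ => t; rewrite -[n.+2%:R]natr1 (exprS _ n); ring.
Qed.

Lemma sinpi0 : sinpi 0 = 0. Proof. by rewrite /sinpi mulr0 sin0. Qed.
Lemma cospi_half : cospi (1/2) = 0. Proof. by rewrite /cospi mul1r cos_pihalf. Qed.
Lemma sinpi_half : sinpi (1/2) = 1. Proof. by rewrite /sinpi mul1r sin_pihalf. Qed.
Lemma cospi_sinpi t : cospi t ^+ 2 + sinpi t ^+ 2 = 1. Proof. exact: cos2Dsin2. Qed.

(** A Wallis integral with parameter l: raising n by 2 brings out one factor of the Euler product,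
    of the sine for even n and of the cosine for odd n. *)
Definition cos_int n (l : C) : C :=
  cintegral `[0, 1/2] (fun t => (cospi t)%:C ^+ n * cosl l t).

Lemma half01 : (1/2 : R) \in `[0, 1].
Proof. by rewrite in_itv /=; apply/andP; split; lra. Qed.

Lemma mhalf : measurable (`[0, 1/2]%classic : set R). Proof. exact: measurable_itv. Qed.

Lemma cderiv_int (F h : R -> C) x : cderiv F h -> ccont h -> x \in `[0, 1] ->
  cintegral `[0, x] h = F x - F 0.
Proof.
by move=> dF ch x01; have [_ /(_ x x01) ->] := primitive_cderiv dF ch; rewrite addrC addKr.
Qed.

Lemma ccont_int (h : R -> C) a b : ccont h -> cint `[a, b] h.
Proof. by move=> [h1 h2]; split; exact: integrable_cont_itv. Qed.

Lemma ccont_cospiX n l : ccont (fun t => (cospi t)%:C ^+ n * cosl l t).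
Proof.
case: n => [|n].
  by rewrite (_ : (fun _ => _) = cosl l); [exact: ccont_cosl|apply/funext => t; rewrite mul1r].
exact: cderiv_ccont (cderivM (cderivX n cderiv_cospi) (cderiv_cosl l)).
Qed.

Lemma cos_int0 l : cos_int 0 l = sinl l (1/2).
Proof.
rewrite /cos_int (@eq_cintegral _ _ _ (cosl l)); last by move=> t _; rewrite mul1r.
by rewrite (cderiv_int (cderiv_sinl l) (ccont_cosl l) half01) sinl0 subr0.
Qed.

Lemma cos_int1 l : (pi%:C ^+ 2 - l) * cos_int 1 l = pi%:C * cosl l (1/2).
Proof.
pose F t := - pi%:C * (sinpi t)%:C * cosl l t + (cospi t)%:C * (l * sinl l t).
have dF : cderiv F (fun t => (l - pi%:C ^+ 2) * ((cospi t)%:C ^+ 1 * cosl l t)).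
  have h1 := cderivM (cderivZ (- pi%:C) cderiv_sinpi) (cderiv_cosl l).
  have h2 := cderivM cderiv_cospi (cderivZ l (cderiv_sinl l)).
  by apply: cderiv_eq (cderivD h1 h2) _ => t; ring.
have cF : ccont (fun t => (l - pi%:C ^+ 2) * ((cospi t)%:C ^+ 1 * cosl l t)).
  exact: cderiv_ccont (cderivZ _ (cderivM (cderivX 0 cderiv_cospi) (cderiv_cosl l))).
have := cderiv_int dF cF half01.
rewrite cintegralZ; [|exact: mhalf|exact: ccont_int (ccont_cospiX 1 l)].
rewrite -/(cos_int 1 l) /F cospi_half sinpi_half sinpi0 sinl0 => e.
have -> : (pi%:C ^+ 2 - l) * cos_int 1 l = - ((l - pi%:C ^+ 2) * cos_int 1 l) by ring.
by rewrite e; ring.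
Qed.

(** F is the Wronskian expression (f' g - f g') of f = cos(pi t)^(m + 2) and g = [cosl l]. It
    vanishes at 0 and, because f has a multiple zero there, also at 1/2. In [cos_int1] the zero is
    simple and the value at 1/2 remains. *)
Lemma cos_intS m l : ((pi%:C * m.+2%:R) ^+ 2 - l) * cos_int m.+2 l =
  pi%:C ^+ 2 * m.+2%:R * m.+1%:R * cos_int m l.
Proof.
pose c t : C := (cospi t)%:C; pose s t : C := (sinpi t)%:C.
pose F t := (m.+2%:R * c t ^+ m.+1 * (- pi%:C * s t)) * cosl l t + c t ^+ m.+2 * (l * sinl l t).
pose h t := (l - (pi%:C * m.+2%:R) ^+ 2) * (c t ^+ m.+2 * cosl l t)
  + pi%:C ^+ 2 * m.+2%:R * m.+1%:R * (c t ^+ m * cosl l t).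
have cs t : s t * s t = 1 - c t * c t.
  by rewrite /c /s -!rmorphM -(rmorph1 (real_complex R)) -rmorphB /=; congr (_%:C); rewrite -(cospi_sinpi t); ring.
have dF : cderiv F h.
  have h1 := cderivM (cderivM (cderivZ m.+2%:R (cderivX m cderiv_cospi)) (cderivZ (- pi%:C) cderiv_sinpi)) (cderiv_cosl l).
  have h2 := cderivM (cderivX m.+1 cderiv_cospi) (cderivZ l (cderiv_sinl l)).
  apply: cderiv_eq (cderivD h1 h2) _ => t.
  rewrite /h -/(c t) -/(s t) !exprS.
  set e := c t ^+ m; set p := pi%:C.
  have -> : m.+2%:R = m.+1%:R + 1 :> C by rewrite natr1.
  set n := m.+1%:R.
  transitivity ((l - (p * (n + 1)) ^+ 2) * (c t * (c t * e) * cosl l t) +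
     p ^+ 2 * (n + 1) * n * ((c t * c t + s t * s t) * e * cosl l t)); last by rewrite cs; ring.
  ring.
have cF : ccont h.
  apply: ccontD; first exact: cderiv_ccont (cderivZ _ (cderivM (cderivX m.+1 cderiv_cospi) (cderiv_cosl l))).
  case: (m) => [|m'].
    rewrite (_ : (fun _ => _) = fun t => pi%:C ^+ 2 * 2%:R * 1%:R * cosl l t); last first.
      by apply/funext => t; rewrite expr0 mul1r.
    exact: cderiv_ccont (cderivZ _ (cderiv_cosl l)).
  exact: cderiv_ccont (cderivZ _ (cderivM (cderivX m' cderiv_cospi) (cderiv_cosl l))).
have := cderiv_int dF cF half01; rewrite /h.
have i1 := ccont_int 0 (1/2) (ccont_cospiX m.+2 l).
have i2 := ccont_int 0 (1/2) (ccont_cospiX m l).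
rewrite cintegralD ?cintegralZ //; try exact: mhalf; try exact: (cintZ _ mhalf).
rewrite -/(cos_int m.+2 l) -/(cos_int m l) /F /c /s cospi_half sinpi0 sinl0 !(exprS _ m.+1) !(exprS _ m) !mul0r !mulr0 !mul0r => e.
have -> : ((pi%:C * m.+2%:R) ^+ 2 - l) * cos_int m.+2 l = pi%:C ^+ 2 * m.+2%:R * m.+1%:R * cos_int m l
  - ((l - (pi%:C * m.+2%:R) ^+ 2) * cos_int m.+2 l + pi%:C ^+ 2 * m.+2%:R * m.+1%:R * cos_int m l) by ring.
by rewrite e; ring.
Qed.

Lemma pi_neq0 : (pi%:C : C) != 0.
Proof. by rewrite eq_complex /= eqxx andbT gt_eqF // pi_gt0. Qed.

Lemma cos_int_at0S m : cos_int m.+2 0 = m.+1%:R / m.+2%:R * cos_int m 0.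
Proof.
have := cos_intS m 0; rewrite subr0 exprMn => h.
have p0 := pi_neq0.
have m2 : (m.+2%:R : C) != 0 by rewrite pnatr_eq0.
have k0 : (pi%:C ^+ 2 * m.+2%:R ^+ 2 : C) != 0 by rewrite mulf_neq0 // expf_neq0.
by apply: (mulfI k0); rewrite h; move: (pi%:C) p0 {k0 h} => p p0; field.
Qed.

Lemma cos_int_at0_neq0 m : cos_int m 0 != 0.
Proof.
have p0 := pi_neq0.
suff : cos_int m 0 != 0 /\ cos_int m.+1 0 != 0 by case.
elim: m => [|m [IH1 IH2]].
  split; first by rewrite cos_int0 sinl_at0 eq_complex /= eqxx andbT.
  have := cos_int1 0; rewrite subr0 cosl_at0 mulr1 => h; apply/eqP => e; move: h.
  by rewrite e mulr0 => /esym/eqP; rewrite (negbTE p0).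
split=> //; rewrite cos_int_at0S !mulf_neq0 ?invr_eq0 ?pnatr_eq0 //.
Qed.

(** Dividing by the value at l = 0 turns the recursion into exact Euler factors; what is left after
    finitely many of them is a [cos_ratio] of high order, which tends to 1. *)
Definition cos_ratio m l := cos_int m l / cos_int m 0.

Lemma cos_ratioS m l : cos_ratio m l = (1 - l / (pi%:C * m.+2%:R) ^+ 2) * cos_ratio m.+2 l.
Proof.
have p0 := pi_neq0; have h0 := cos_int_at0_neq0 m.
have m1 : (m.+1%:R : C) != 0 by rewrite pnatr_eq0.
have m2 : (m.+2%:R : C) != 0 by rewrite pnatr_eq0.
rewrite /cos_ratio cos_int_at0S.
have -> : (1 - l / (pi%:C * m.+2%:R) ^+ 2) * (cos_int m.+2 l / (m.+1%:R / m.+2%:R * cos_int m 0)) =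
  (((pi%:C * m.+2%:R) ^+ 2 - l) * cos_int m.+2 l) / (pi%:C ^+ 2 * m.+2%:R * m.+1%:R * cos_int m 0).
  by move: (pi%:C) p0 (m.+2%:R : C) m2 (m.+1%:R : C) m1 => p p0 u m2 v m1; field; rewrite p0 h0 m1 m2.
by rewrite cos_intS; move: (pi%:C) p0 (m.+2%:R : C) m2 (m.+1%:R : C) m1 => p p0 u m2 v m1; field; rewrite p0 h0 m1 m2.
Qed.

Lemma cos_ratio0 l : cos_ratio 0 l = 2 * sinl l (1/2).
Proof.
rewrite /cos_ratio !cos_int0 sinl_at0 mulrC; congr (_ * _).
by rewrite rmorphM fmorphV /= rmorph_nat rmorph1 mul1r invrK.
Qed.

Lemma cos_ratio1 l : cosl l (1/2) = (1 - l / (pi%:C * 1%:R) ^+ 2) * cos_ratio 1 l.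
Proof.
have p0 := pi_neq0; have := cos_int1 l; have := cos_int1 0.
rewrite subr0 cosl_at0 mulr1 /cos_ratio => e0 e1.
have -> : cos_int 1 0 = pi%:C^-1.
  by apply: (mulfI (expf_neq0 2 p0)); rewrite e0 expr2 mulfK.
have -> : cosl l (1/2) = pi%:C^-1 * (pi%:C * cosl l (1/2)) by rewrite mulKf.
by rewrite -e1; move: (pi%:C) p0 => p p0; field.
Qed.

Definition even_prod m l := \prod_(k < m) (1 - l / (pi%:C * k.*2.+2%:R) ^+ 2) : C.
Definition odd_prod m l := \prod_(k < m) (1 - l / (pi%:C * k.*2.+1%:R) ^+ 2) : C.

Lemma even_prodE m l : 2 * sinl l (1/2) = even_prod m l * cos_ratio m.*2 l.
Proof.
elim: m => [|m IH]; first by rewrite /even_prod big_ord0 [RHS]mul1r -cos_ratio0.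
by rewrite IH /even_prod big_ord_recr /= -mulrA -cos_ratioS.
Qed.

Lemma odd_prodE m l : cosl l (1/2) = odd_prod m.+1 l * cos_ratio m.*2.+1 l.
Proof.
elim: m => [|m IH]; first by rewrite cos_ratio1 /odd_prod big_ord_recr big_ord0 /= mul1r.
by rewrite IH /odd_prod [in RHS]big_ord_recr /= -mulrA -cos_ratioS.
Qed.

Lemma x_cos_le_sin (x : R) : 0 <= x -> x <= pi -> x * cos x <= sin x.
Proof.
move=> x0 xpi.
have d1 t : is_derive t (1:R) (fun s : R => s * cos s) (cos t - t * sin t).
  have := is_deriveM (is_derive_id t (1:R)) (is_derive_cos t).
  by move/is_derive_val; apply; rewrite /GRing.scale /=; ring.
apply: (le_of_deriv x0 d1 (fun t => is_derive_sin t)); first by rewrite mul0r sin0.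
move=> t /andP[t0 tx]; rewrite gerBl mulr_ge0 // sin_ge0_pi // t0 /=.
exact: le_trans tx xpi.
Qed.

Definition rcos_int n : R := \int[mu]_(t in `[0, 1/2]) (cospi t ^+ n).

Lemma cos_int_at0 n : cos_int n 0 = (rcos_int n)%:C.
Proof.
rewrite /cos_int /cintegral /rcos_int; congr (_ +i* _).
- apply: eq_Rintegral => t _.
  by rewrite cosl_at0 mulr1 -rmorphXn.
- rewrite (@eq_Rintegral _ _ _ mu _ (fun=> 0)); last by move=> t _; rewrite cosl_at0 mulr1 -rmorphXn.
  by rewrite /Rintegral integral0.
Qed.

Lemma rcos_intS m : rcos_int m.+2 = m.+1%:R / m.+2%:R * rcos_int m.
Proof.
have := cos_int_at0S m; rewrite !cos_int_at0 => /(congr1 (@complex.Re R)).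
rewrite -!(rmorph_nat (real_complex R)) -fmorphV -!rmorphM; exact.
Qed.

Lemma continuous_cospiX n : continuous (fun t => cospi t ^+ n).
Proof.
have [h _] := ccont_cospiX n 0.
rewrite (_ : (fun t => _) = fun t => Re ((cospi t)%:C ^+ n * cosl 0 t)) //.
by apply/funext => t; rewrite cosl_at0 mulr1 -rmorphXn.
Qed.

Lemma cospi_ge0 t : 0 <= t <= 1/2 -> 0 <= cospi t.
Proof.
case/andP=> t0 t1; apply: cos_ge0_pihalf; have p := pi_gt0 R; apply/andP; split.
- apply: (@le_trans _ _ 0); first by rewrite oppr_le0 divr_ge0 // ltW.
  by rewrite mulr_ge0 // ltW.
- by rewrite ler_wpM2l // ?(ltW p) //; lra.
Qed.

Lemma rcos_int_ge0 n : 0 <= rcos_int n.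
Proof.
apply: Rintegral_ge0 => t /=; rewrite in_itv /= => tt.
by rewrite exprn_ge0 // cospi_ge0.
Qed.

Lemma rcos_int_gt0 n : 0 < rcos_int n.
Proof.
rewrite lt0r rcos_int_ge0 andbT; have := cos_int_at0_neq0 n; rewrite cos_int_at0.
by apply: contraNneq => ->.
Qed.

(** High powers of cos(pi t) concentrate near t = 0, where [cosl l t] is within K t^2 of 1. The
    resulting integral is compared with the Wallis recursion, which gives I_m / I_(m + 2) - 1 = 1 /
    (m + 1). *)
Lemma cos_ratio_near1 r l m : N l <= r ->
  N (cos_ratio m.+2 l - 1) <= expR (1 + r) * r / m.+1%:R.
Proof.
move=> lr; have r0 : 0 <= r := le_trans (normc_ge0 l) lr.
have J0 := cos_int_at0_neq0 m.+2.
have -> : cos_ratio m.+2 l - 1 = (cos_int m.+2 l - cos_int m.+2 0) / cos_int m.+2 0.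
  by rewrite /cos_ratio mulrBl divff.
rewrite Normc.normcM Normc.normcV {2}cos_int_at0 normcR ger0_norm ?rcos_int_ge0 //.
rewrite ler_pdivrMr ?rcos_int_gt0 //.
have i1 n l' := ccont_int 0 (1/2) (ccont_cospiX n l').
rewrite /cos_int -cintegralB //; try exact: mhalf.
set K := expR (1 + r) * r.
have K0 : 0 <= K by rewrite mulr_ge0 ?expR_ge0.
have irc n : rint `[0, 1/2] (fun t => cospi t ^+ n).
  by apply: integrable_cont_itv; exact: continuous_cospiX.
have ig : rint `[0, 1/2] (fun t => K * (cospi t ^+ m - cospi t ^+ m.+2)).
  by apply: integrable_scale; [exact: mhalf|exact: (rintB mhalf)].
apply: le_trans (normc_cintegral_le mhalf (cintB mhalf (i1 _ l) (i1 _ 0)) ig _) _.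
  move=> t /=; rewrite in_itv /= => /andP[t0 t1]; rewrite -mulrBr Normc.normcM normcX normcR.
  have c0 : 0 <= cospi t by rewrite cospi_ge0 // t0.
  rewrite (ger0_norm c0).
  have t01 : 0 <= t <= 1 by rewrite t0 /=; lra.
  have [+ _] := rem_bounds 1 l t01.
  rewrite /cos_rem big_ord1 expr0 mul1r /monof expr0 fact0 divr1 cosl_at0 expr1 => h.
  have nl := normc_ge0 l.
  have h2 : N (cosl l t - 1) <= K * t ^+ 2.
    apply: le_trans h _; rewrite /K.
    apply: ler_pM; rewrite ?mulr_ge0 ?expR_ge0 ?invr_ge0 ?exprn_ge0 //.
      by apply: ler_pM; rewrite ?expR_ge0 // ler_expR lerD2l.
    by rewrite ler_piMr ?exprn_ge0 // invf_le1 // ler1n.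
  apply: le_trans (ler_wpM2l (exprn_ge0 _ c0) h2) _.
  rewrite mulrCA ler_wpM2l // !exprS.
  have p := pi_ge2 R.
  have tc : t * cospi t <= sinpi t.
    apply: (@le_trans _ _ (pi * t * cos (pi * t))).
      rewrite -/(cospi t) ler_wpM2r // ler_peMl //; lra.
    apply: x_cos_le_sin; first by rewrite mulr_ge0 // ltW // pi_gt0.
    by rewrite ler_piMr ?ltW ?pi_gt0 //; lra.
  have tc2 : (t * cospi t) * (t * cospi t) <= sinpi t * sinpi t.
    by apply: ler_pM => //; rewrite mulr_ge0.
  have cm : 0 <= cospi t ^+ m by rewrite exprn_ge0.
  have e := cospi_sinpi t; rewrite !expr2 in e.
  have -> : cospi t ^+ m - cospi t * (cospi t * cospi t ^+ m) = cospi t ^+ m * (sinpi t * sinpi t).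
    have -> : sinpi t * sinpi t = 1 - cospi t * cospi t by rewrite -e; ring.
    by ring.
  rewrite expr0 mulr1.
  by apply: le_trans (ler_wpM2l cm tc2); rewrite le_eqVlt; apply/orP; left; apply/eqP; ring.
rewrite RintegralZl //; last exact: (rintB mhalf (irc m) (irc m.+2)).
rewrite RintegralB //; try exact: irc.
rewrite -/(rcos_int m) -/(rcos_int m.+2) rcos_intS.
rewrite le_eqVlt; apply/orP; left; apply/eqP.
have m1 : (m.+1%:R : R) != 0 by rewrite pnatr_eq0.
have -> : m.+2%:R = m.+1%:R + 1 :> R by rewrite natr1.
have m2 : (m.+1%:R + 1 : R) != 0 by rewrite natr1 pnatr_eq0.
by move: (m.+1%:R : R) m1 m2 => u m1 m2; field; rewrite m1 m2.
Qed.

End EulerProduct.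

(** * The characteristic function as an infinite product *)

Section Hadamard.
Variable R : realType.
Local Notation C := R[i].
Local Notation N := (@Normc.normc R).
Local Notation Re := complex.Re.
Local Notation Im := complex.Im.

(** As long as the sum is at most 1/2, each partial product has modulus at most 2, so a new factor
    moves the product by at most 2 |x n|. *)
Lemma prod_near1 (x : nat -> C) n : \sum_(k < n) N (x k) <= 1/2 ->
  N (\prod_(k < n) (1 + x k) - 1) <= 2 * \sum_(k < n) N (x k).
Proof.
elim: n => [|n IH]; first by rewrite !big_ord0 subrr normc0r mulr0.
rewrite !big_ord_recr /= => h.
have xn := normc_ge0 (x n).
have h' : \sum_(k < n) N (x k) <= 1/2 by lra.
have {}IH := IH h'.
set P := \prod_(k < n) _ in IH *; set S := \sum_(k < n) _ in h h' IH *.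
have -> : P * (1 + x n) - 1 = (P - 1) + P * x n by ring.
have NP : N P <= 2.
  have -> : P = (P - 1) + 1 by rewrite subrK.
  by apply: le_trans (normcD_le _ _) _; rewrite normc1r; lra.
apply: le_trans (normcD_le _ _) _; rewrite Normc.normcM mulrDr lerD //.
by rewrite ler_wpM2r.
Qed.

(** The first term is 4. The others telescope, because (u + 3/2)^2 exceeds (u + 1)(u + 2) by 1/4;
    this gives 5 - 1 / n for n terms. *)
Lemma sum_half_inv_sqr n : \sum_(0 <= i < n) ((i%:R + 1/2) ^+ 2)^-1 <= 5 :> R.
Proof.
case: n => [|n]; first by rewrite big_geq.
apply: (@le_trans _ _ (5 - n.+1%:R^-1)); last by rewrite gerBl invr_ge0.
elim: n => [|n IH].
  rewrite big_nat1 add0r (_ : (1/2) ^+ 2 = 4^-1 :> R); last by field.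
  by rewrite invrK invr1; lra.
rewrite big_nat_recr //=; apply: le_trans (lerD IH (lexx _)) _.
have n0 : 0 <= n%:R :> R by [].
have -> : n.+2%:R = n%:R + 2 :> R by rewrite -addn2 natrD.
have -> : n.+1%:R = n%:R + 1 :> R by rewrite natr1.
set u := n%:R in n0 *.
have h : ((u + 1 + 1/2) ^+ 2)^-1 <= (u + 2)^-1 * (u + 1)^-1.
  rewrite -invfM lef_pV2 ?posrE; [|by apply: exprn_gt0; lra|by apply: mulr_gt0; lra].
  by rewrite -subr_ge0 (_ : _ - _ = 1/4) //; field.
have e : (u + 2)^-1 * (u + 1)^-1 = (u + 1)^-1 - (u + 2)^-1.
  by field; rewrite !gt_eqF //; lra.
by lra.
Qed.

(** The integers on either side of m + 1/2 lie at distances i + 1/2 from it, so each side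
    contributes at most 5, uniformly in m. *)
Lemma sum_inv_sqr m n : \sum_(0 <= j < n) ((j%:R - (m%:R + 1/2)) ^+ 2)^-1 <= 10 :> R.
Proof.
have g0 j : 0 <= ((j%:R - (m%:R + 1/2)) ^+ 2)^-1 :> R by rewrite invr_ge0 sqr_ge0.
apply: (@le_trans _ _ (\sum_(0 <= j < m.+1 + n) ((j%:R - (m%:R + 1/2)) ^+ 2)^-1)).
  rewrite addnC (big_cat_nat (n := n) (leq0n _) (leq_addr _ _)) //= lerDl.
  by apply: sumr_ge0.
rewrite (big_cat_nat (n := m.+1) (leq0n _) (leq_addr _ _)) //=.
have -> : 10 = 5 + 5 :> R by ring.
apply: lerD.
  rewrite big_nat_rev /= add0n; apply: le_trans (sum_half_inv_sqr m.+1).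
  rewrite le_eqVlt; apply/orP; left; apply/eqP.
  apply: eq_big_nat => i /andP[_ im]; congr (_^-1).
  rewrite subSS natrB // -[LHS]sqrrN; congr (_ ^+ 2); ring.
rewrite -{1}[m.+1]add0n big_addn addKn; apply: le_trans (sum_half_inv_sqr n).
rewrite le_eqVlt; apply/orP; left; apply/eqP.
apply: eq_big_nat => i _; congr (_^-1).
by rewrite natrD -[m.+1%:R]natr1; congr (_ ^+ 2); field.
Qed.

Definition lam_index (alpha : bool) n : nat := (if odd n then n.+1 - alpha else n + alpha)%N.

Lemma lambda0E alpha n : lambda0 R alpha n = (((lam_index alpha n)%:R * pi) ^+ 2)%:C.
Proof. by []. Qed.

Lemma lam_index_gt0 alpha n : alpha || (0 < n)%N -> (0 < lam_index alpha n)%N.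
Proof.
rewrite /lam_index; case: ifP => [on|_] h; last by rewrite addn_gt0; case: alpha h; rewrite ?orbT // orbF.
by case: n on h => // n _ _; case: alpha; rewrite ?subn1 ?subn0.
Qed.

Lemma lambda0_neq0 alpha n : alpha || (0 < n)%N -> lambda0 R alpha n != 0.
Proof.
move=> h; rewrite lambda0E -normc_eq0 normcR ger0_norm ?sqr_ge0 //.
by rewrite expf_neq0 // mulf_neq0 ?pnatr_eq0 -?lt0n ?lam_index_gt0 // gt_eqF // pi_gt0.
Qed.

Lemma numbered_bound alpha (lam : nat -> C) : numbered alpha lam ->
  exists S, forall n, \sum_(0 <= k < n) N (lam k - lambda0 R alpha k) ^+ 2 <= S.
Proof.
move=> [odd0 cv]; exists (limn (series (fun k : nat => N (lam k.*2 - lambda0 R alpha k.*2) ^+ 2))) => n.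
have t0 k : 0 <= N (lam k - lambda0 R alpha k) ^+ 2 by rewrite sqr_ge0.
apply: (@le_trans _ _ (\sum_(0 <= k < n.*2) N (lam k - lambda0 R alpha k) ^+ 2)).
  rewrite -addnn (big_cat_nat (n := n) (leq0n _) (leq_addr _ _)) //= lerDl.
  exact: sumr_ge0.
have -> : \sum_(0 <= k < n.*2) N (lam k - lambda0 R alpha k) ^+ 2 =
  series (fun k : nat => N (lam k.*2 - lambda0 R alpha k.*2) ^+ 2) n.
  rewrite /series /=; elim: n => [|n IH]; first by rewrite !big_geq.
  rewrite doubleS !big_nat_recr //= IH [X in _ + X](_ : _ = 0) ?addr0 //.
  by rewrite odd0 ?subrr ?normc0r ?expr0n //= odd_double.
apply: nondecreasing_cvgn_le => //.
apply/nondecreasing_seqP => k; rewrite /series /= big_nat_recr //= lerDl.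
exact: t0.
Qed.

(** The case alpha = 0, n = 0 is excluded because [partial_Delta false] always contains the factor z
    - lam 0. The constant k depends on neither lam nor z, so it cancels when the products of two
    sequences are compared. *)
Lemma partial_DeltaE alpha n : alpha || (0 < n)%N -> exists2 k : C, k != 0 &
  forall lam z, partial_Delta alpha lam n z = k * \prod_(0 <= j < n) (z - lam j).
Proof.
case: alpha => /= [_|n0].
  exists (4 * \prod_(0 <= j < n) (- (lambda0 R true j)^-1)).
    rewrite mulf_neq0 ?pnatr_eq0 // prodf_seq_neq0; apply/allP => j _ /=.
    by rewrite oppr_eq0 invr_eq0 lambda0_neq0.
  move=> lam z; rewrite /partial_Delta -mulrA -big_split /=; congr (_ * _).
  by apply: eq_bigr => j _; ring.
case: n n0 => // n _.
exists (\prod_(1 <= j < n.+1) (- (lambda0 R false j)^-1)).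
  rewrite prodf_seq_neq0; apply/allP => j /=; rewrite mem_index_iota => /andP[j1 _].
  by rewrite oppr_eq0 invr_eq0 lambda0_neq0.
move=> lam z; rewrite /partial_Delta [X in _ = _ * X]big_ltn // mulrCA -big_split /=; congr (_ * _).
by apply: eq_bigr => j _; ring.
Qed.

Definition base_Delta (alpha : bool) (l : C) : C := 2 - 2 * (-1) ^+ alpha * cosl l 1.

(** By the half-angle formulas the case q = 0 is a square: its nonzero eigenvalues are double, and
    its product is an Euler product at 1/2 taken twice. *)
Lemma base_DeltaE alpha l : base_Delta alpha l =
  if alpha then 4 * cosl l (1/2) ^+ 2 else l * (2 * sinl l (1/2)) ^+ 2.
Proof.
have c1 : cosl l 1 = cosl l (1/2) ^+ 2 - l * sinl l (1/2) ^+ 2.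
  rewrite {1}(_ : 1 = 1/2 + 1/2 :> R); last by field.
  by rewrite coslD; ring.
have e := cosl_sqr l (1/2).
rewrite /base_Delta c1; case: alpha; rewrite ?expr0 ?expr1.
- have -> : l * sinl l (1/2) ^+ 2 = 1 - cosl l (1/2) ^+ 2 by rewrite -e; ring.
  by ring.
- have -> : cosl l (1/2) ^+ 2 = 1 - l * sinl l (1/2) ^+ 2 by rewrite -e; ring.
  by ring.
Qed.

Lemma partial_base_false n z :
  partial_Delta false (lambda0 R false) n.+1 z = z * (even_prod n.+1./2 z * even_prod n./2 z).
Proof.
rewrite /partial_Delta {1}/lambda0 /= mul0r expr0n /= subr0; congr (_ * _).
elim: n => [|n IH]; first by rewrite big_geq // /even_prod !big_ord0 mul1r.
rewrite big_nat_recr //= IH.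
have p0 := pi_neq0 R.
have e j : (lambda0 R false j.+1 - z) / lambda0 R false j.+1 =
   1 - z / (pi%:C * (lam_index false j.+1)%:R) ^+ 2.
  rewrite mulrBl divff ?lambda0_neq0 // lambda0E; congr (_ - _ / _).
  by rewrite rmorphXn rmorphM rmorph_nat mulrC.
rewrite e.
rewrite uphalf_half.
have [on|en] := boolP (odd n).
- rewrite add1n {3}/even_prod big_ord_recr /= -/(even_prod _ _).
  have -> : lam_index false n.+1 = (n./2).*2.+2.
    by rewrite /lam_index /= on /= addn0 -{1}(odd_double_half n) on.
  ring.
- rewrite add0n {3}/even_prod big_ord_recr /= -/(even_prod _ _).
  have -> : lam_index false n.+1 = (n./2).*2.+2.
    by rewrite /lam_index /= en /= subn0 -{1}(odd_double_half n) (negbTE en).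
  ring.
Qed.

Lemma partial_base_true n z :
  partial_Delta true (lambda0 R true) n z = 4 * (odd_prod (uphalf n) z * odd_prod n./2 z).
Proof.
rewrite /partial_Delta; congr (_ * _).
elim: n => [|n IH]; first by rewrite big_geq // /odd_prod !big_ord0 mul1r.
rewrite big_nat_recr //= IH.
have e j : (lambda0 R true j - z) / lambda0 R true j =
   1 - z / (pi%:C * (lam_index true j)%:R) ^+ 2.
  rewrite mulrBl divff ?lambda0_neq0 // lambda0E; congr (_ - _ / _).
  by rewrite rmorphXn rmorphM rmorph_nat mulrC.
rewrite e uphalf_half.
have [on|en] := boolP (odd n).
- rewrite add1n {3}/odd_prod big_ord_recr /= -/(odd_prod _ _).
  have -> : lam_index true n = (n./2).*2.+1.
    by rewrite /lam_index on /= subn1 /= -{1}(odd_double_half n) on.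
  ring.
- rewrite add0n {3}/odd_prod big_ord_recr /= -/(odd_prod _ _).
  have -> : lam_index true n = (n./2).*2.+1.
    by rewrite /lam_index (negbTE en) /= addn1 -{1}(odd_double_half n) (negbTE en).
  ring.
Qed.

Lemma cos_ratio_uniform (r e : R) : 0 < e -> exists M, forall m l, (M <= m)%N -> N l <= r ->
  N (cos_ratio m l - 1) <= e.
Proof.
move=> e0; pose K := expR (1 + `|r|) * `|r|.
have K0 : 0 <= K by rewrite mulr_ge0 ?expR_ge0.
pose M := (Num.truncn (K / e)).+3; exists M => m l Mm lr.
have lr' : N l <= `|r| by apply: le_trans lr (ler_norm _).
case: m Mm => [|[|m]] // Mm.
apply: le_trans (cos_ratio_near1 m lr') _.
rewrite -/K ler_pdivrMr // mulrC -ler_pdivrMr //.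
have : (Num.truncn (K / e)).+1%:R <= m.+1%:R :> R.
  by rewrite ler_nat; apply: leqW; exact: Mm.
apply: le_trans; rewrite ltW //; exact: truncnS_gt.
Qed.

(** The error is stated as a factor 1 + t, since both sides vanish at the eigenvalues of q = 0
    inside the disc. The factors are shared between two Euler products, and [M.*2.+4] leaves each of
    them enough. *)
Lemma base_approx alpha (r e : R) : 0 < e -> e <= 1 -> exists M, forall n, (M <= n)%N -> forall l, N l <= r ->
  exists2 t, base_Delta alpha l = partial_Delta alpha (lambda0 R alpha) n l * (1 + t) & N t <= e.
Proof.
move=> e0 e1; have e3 : 0 < e / 3 by rewrite divr_gt0.
have [M HM] := cos_ratio_uniform r e3.
have key (x y : C) : N (x - 1) <= e / 3 -> N (y - 1) <= e / 3 -> N (x * y - 1) <= e.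
  move=> hx hy; have -> : x * y - 1 = (x - 1) * (y - 1) + (x - 1) + (y - 1) by ring.
  apply: le_trans (normcD_le _ _) _; apply: le_trans (lerD (normcD_le _ _) (lexx _)) _.
  rewrite Normc.normcM.
  have : N (x - 1) * N (y - 1) <= 1 * (e / 3).
    by apply: ler_pM; rewrite ?normc_ge0 //; lra.
  by lra.
exists (M.*2.+4) => n Mn l lr.
rewrite base_DeltaE; case: alpha.
- have h1 : (M < n./2)%N.
    by apply: (@leq_trans M.+2) => //; rewrite -(doubleK M.+2); apply: half_leq.
  have h2 : (M < uphalf n)%N by rewrite uphalf_half; apply: leq_trans h1 (leq_addl _ _).
  case E1 : (uphalf n) h2 => [//|i] h2; case E2 : (n./2) h1 => [//|j] h1.
  exists (cos_ratio i.*2.+1 l * cos_ratio j.*2.+1 l - 1).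
    by rewrite partial_base_true E1 E2 expr2 {1}(odd_prodE i) (odd_prodE j); ring.
  by apply: key; apply: HM => //; apply: leqW; rewrite -addnn; apply: leq_trans (leq_addl _ _).
- case: n Mn => // n Mn.
  have h2 : (M <= n./2)%N by rewrite -(doubleK M); apply: half_leq; rewrite doubleE; move: Mn; rewrite doubleE; do 3 move/ltnW.
  have h1 : (M <= n.+1./2)%N by apply: leq_trans h2 (half_leq _).
  exists (cos_ratio (n.+1./2).*2 l * cos_ratio (n./2).*2 l - 1).
    by rewrite partial_base_false expr2 {1}(even_prodE n.+1./2) (even_prodE n./2); ring.
  by apply: key; apply: HM => //; rewrite -addnn; apply: leq_trans (leq_addl _ _).
Qed.

Lemma base_circle alpha (rho l : C) m : rho ^+ 2 = l -> (0 < m)%N ->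
  N rho = (m%:R + 1 / 2) * pi -> expR `|Im rho| / 16 <= N (base_Delta alpha l).
Proof.
move=> h m0 Nrho; have [h1 h2] := half_circle h m0 Nrho.
have E : expR `|Im rho| = expR (`|Im rho| / 2) ^+ 2 by rewrite -expRM_natl; congr expR; field.
have E0 : 0 <= expR (`|Im rho| / 2) / 8 by rewrite divr_ge0 ?expR_ge0.
rewrite base_DeltaE E.
have -> : expR (`|Im rho| / 2) ^+ 2 / 16 = 4 * (expR (`|Im rho| / 2) / 8 * (expR (`|Im rho| / 2) / 8)).
  by field.
case: alpha.
- rewrite Normc.normcM normcX normc_nat ler_wpM2l // expr2; exact: ler_pM.
- have -> : l * (2 * sinl l (1/2)) ^+ 2 = 4 * (rho * sinl l (1/2)) ^+ 2 by rewrite -h; ring.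
  rewrite Normc.normcM normcX normc_nat ler_wpM2l // expr2; exact: ler_pM.
Qed.

(** Moduli alone suffice: with j = [lam_index alpha n] and c = m + 1/2, they differ by pi^2 |j - c|
    (j + c), and pi^2 (j + c) >= c. *)
Lemma circle_dist alpha n m (w : C) : N w = ((m%:R + 1/2) * pi) ^+ 2 ->
  `|(lam_index alpha n)%:R - (m%:R + 1/2)| * (m%:R + 1/2) <= N (lambda0 R alpha n - w).
Proof.
move=> Nw; set j := (lam_index alpha n)%:R; set c := m%:R + 1/2.
have c0 : 0 < c by rewrite /c ltr_wpDl //; lra.
have j0 : 0 <= j by [].
have p := pi_ge2 R.
have h : `|N (lambda0 R alpha n) - N w| <= N (lambda0 R alpha n - w).
  have tri (x y : C) : N x - N y <= N (x - y).
    by rewrite lerBlDr -{1}(subrK y x) normcD_le.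
  by rewrite ler_norml lerNl opprB tri andbT (normcBC (lambda0 R alpha n)) tri.
apply: le_trans h.
rewrite Nw lambda0E normcR -/j -/c (ger0_norm (sqr_ge0 (j * pi))).
have -> : (j * pi) ^+ 2 - (c * pi) ^+ 2 = (j - c) * ((j + c) * (pi * pi)) by ring.
rewrite normrM ler_wpM2l // ger0_norm; last by rewrite mulr_ge0 ?addr_ge0 ?mulr_ge0 ?pi_ge0 // ltW.
have p2 : 1 <= pi * pi :> R by rewrite -[1]mulr1; apply: ler_pM => //; lra.
by rewrite -[leLHS]mulr1; apply: ler_pM => //; lra.
Qed.

Lemma half_integer_neq (j m : nat) : j%:R != m%:R + 1/2 :> R.
Proof.
apply/eqP => h; have : (j.*2)%:R = (m.*2.+1)%:R :> R.
  by rewrite -[m.*2.+1%:R]natr1 -!muln2 !natrM h; field.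
move/eqP; rewrite eqr_nat => /eqP/(congr1 odd); by rewrite /= !odd_double.
Qed.

(** With a = |lam k - lambda0 k| and d the distance of its index from m + 1/2, the k-th term is at
    most a / (d c) <= (a^2 + d^-2) / c. The a^2 are summable by the numbering hypothesis, the d^-2
    sum to at most 10, and c = m + 1/2 is the gain. *)
Lemma perturbation alpha (lam : nat -> C) : numbered alpha lam ->
  exists2 K, 0 <= K & forall m n w, N w = ((m%:R + 1/2) * pi) ^+ 2 ->
    (forall j, lambda0 R alpha j - w != 0) /\
    \sum_(k < n) N ((lam k - lambda0 R alpha k) / (lambda0 R alpha k - w)) <= K / (m%:R + 1/2).
Proof.
move=> num; have [S HS] := numbered_bound num; have [odd0 _] := num.
have S0 : 0 <= S by apply: le_trans (HS 0%N); rewrite big_geq.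
exists (S + 10); first by rewrite addr_ge0.
move=> m n w Nw; set c := m%:R + 1/2.
have c0 : 0 < c by rewrite /c ltr_wpDl //; lra.
have jc j : (lam_index alpha j)%:R - c != 0 by rewrite subr_eq0 half_integer_neq.
have dist j := circle_dist alpha j Nw.
have dpos j : 0 < N (lambda0 R alpha j - w).
  by apply: lt_le_trans (dist j); rewrite mulr_gt0 // normr_gt0.
split; first by move=> j; rewrite -normc_gt0.
pose g j : R := ((j%:R - c) ^+ 2)^-1.
have g0 j : 0 <= g j by rewrite invr_ge0 sqr_ge0.
have term k : N ((lam k - lambda0 R alpha k) / (lambda0 R alpha k - w)) <=
   (N (lam k - lambda0 R alpha k) ^+ 2 + g (k + alpha)%N) / c.
  rewrite Normc.normcM Normc.normcV; have [ok|ek] := boolP (odd k).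
    by rewrite odd0 // subrr normc0r mul0r divr_ge0 ?(ltW c0) // addr_ge0 // sqr_ge0.
  set a := N (lam k - _); have a0 : 0 <= a by exact: normc_ge0.
  have e : lam_index alpha k = (k + alpha)%N by rewrite /lam_index (negbTE ek).
  rewrite /g -e; set d := `|(lam_index alpha k)%:R - c|.
  have d0 : 0 < d by rewrite normr_gt0.
  have -> : ((lam_index alpha k)%:R - c) ^+ 2 = d ^+ 2 by rewrite real_normK ?num_real.
  apply: (@le_trans _ _ (a / (d * c))).
    by rewrite ler_wpM2l // lef_pV2 ?posrE ?mulr_gt0 //; exact: dist.
  rewrite invfM mulrA ler_wpM2r ?invr_ge0 ?(ltW c0) // -[(d ^+ 2)^-1]exprVn.
  have := sqr_ge0 (a - d^-1); have : 0 <= a * d^-1 by rewrite mulr_ge0 ?invr_ge0 // ltW.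
  by rewrite !expr2; lra.
apply: (@le_trans _ _ (\sum_(k < n) ((N (lam k - lambda0 R alpha k) ^+ 2 + g (k + alpha)%N) / c))).
  by apply: ler_sum => k _; exact: term.
rewrite -mulr_suml ler_wpM2r ?invr_ge0 ?(ltW c0) // big_split /=; apply: lerD.
  by rewrite -(big_mkord xpredT (fun k => N (lam k - lambda0 R alpha k) ^+ 2)).
apply: (@le_trans _ _ (\sum_(0 <= j < n + alpha) g j)); last exact: sum_inv_sqr.
rewrite -(big_mkord xpredT (fun k => g (k + alpha)%N)).
rewrite (big_cat_nat (n := alpha) (leq0n _) (leq_addl _ _)) /= -{3}[nat_of_bool alpha]add0n big_addn addnK lerDr.
exact: sumr_ge0.
Qed.

Lemma partial_ratio alpha (lam : nat -> C) n w : alpha || (0 < n)%N ->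
  (forall j, lambda0 R alpha j - w != 0) ->
  partial_Delta alpha lam n w = partial_Delta alpha (lambda0 R alpha) n w *
    \prod_(k < n) (1 + (lam k - lambda0 R alpha k) / (lambda0 R alpha k - w)).
Proof.
move=> h nz; have [k _ E] := partial_DeltaE h; rewrite !E -mulrA; congr (_ * _).
rewrite -(big_mkord xpredT (fun k => 1 + (lam k - lambda0 R alpha k) / (lambda0 R alpha k - w))).
rewrite -big_split /=; apply: eq_bigr => j _.
have := nz j; set d := lambda0 R alpha j - w => d0.
have -> : w - lambda0 R alpha j = - d by rewrite opprB.
have -> : lam j - lambda0 R alpha j = - d - (w - lam j) by rewrite /d; ring.
by field.
Qed.

Lemma entireB_cst (F : C -> C) c : entire F -> entire (fun z => F z - c).
Proof.
move=> [d Hd]; exists (fun k => if k is 0 then d 0%N - c else d k) => r r0.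
have [K H] := Hd _ r0; have K0 := taylor_on_ge0 r0 H; exists (K + N c) => -[|n] w wr.
  rewrite big_ord0 subr0 expr0 mulr1; apply: le_trans (normcB_le _ _) _.
  by rewrite lerD2r; have := H 0%N w wr; rewrite expr0 mulr1 big_ord0 subr0.
have := H n.+1 w wr; rewrite !big_ord_recl /= !expr0 !mulr1.
set s := \sum_(i < n) _; have -> : F w - c - (d 0%N - c + s) = F w - (d 0%N + s) by ring.
move=> /le_trans; apply; rewrite ler_wpM2r ?exprn_ge0 ?divr_ge0 ?normc_ge0 ?(ltW r0) //.
by rewrite lerDl normc_ge0.
Qed.

Lemma entireZ (F : C -> C) c : entire F -> entire (fun z => c * F z).
Proof.
move=> [d Hd]; exists (fun k => c * d k) => r r0; have [K H] := Hd _ r0.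
exists (N c * K) => n w wr.
have -> : \sum_(k < n) c * d k * w ^+ k = c * \sum_(k < n) d k * w ^+ k.
  by rewrite mulr_sumr; apply: eq_bigr => k _; rewrite mulrA.
by rewrite -mulrBr Normc.normcM -mulrA ler_wpM2l ?normc_ge0 // H.
Qed.

(* On the circles [|rho| = (m + 1/2) pi], [rho ^+ 2 = w], the quotients of [Delta] by
   [base_Delta], of [base_Delta] by its partial products, and of these by the partial
   products of [lam] are all close to [1]. *)
Lemma quotient_circle alpha (lam : nat -> C) (Delta : C -> C) K : numbered alpha lam ->
  (forall rho l : C, rho ^+ 2 = l ->
    N (rho * (Delta l - base_Delta alpha l)) <= K * expR `|Im rho|) ->
  forall e r0, 0 < e -> e <= 1/2 -> exists2 r, r0 <= r & 0 < r /\ exists M, forall n, (M <= n)%N -> forall w, N w = r ->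
    partial_Delta alpha lam n w != 0 /\
    N (Delta w / partial_Delta alpha lam n w - 1) <= 8 * e.
Proof.
move=> num HD e r0 e0 e1.
have [K' K'0 pert] := perturbation num.
have K0 : 0 <= K.
  have := HD 0 0 (expr0n _ 2); rewrite mul0r normc0r /= normr0 expR0 mulr1; exact.
(* A circle with c >= B serves all purposes: it exceeds r0; K / c <= e / 16 beats the constant of
   [base_circle]; and K' / c <= e / 2, which [prod_near1] doubles to e. *)
pose B := `|r0| + 16 * K / e + 2 * K' / e.
have [m0 mB] : exists m : nat, B <= m%:R.
  exists (Num.truncn B).+1; rewrite ltW //; exact: truncnS_gt.
pose m := m0.+1; pose c : R := m%:R + 1/2.
have cB : B <= c.
  by apply: le_trans mB _; rewrite /c /m -natr1; lra.
have B1 : 0 <= 16 * K / e by rewrite divr_ge0 ?mulr_ge0 // ltW.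
have B2 : 0 <= 2 * K' / e by rewrite divr_ge0 ?mulr_ge0 // ltW.
have B0 := normr_ge0 r0.
have c1 : 1 <= c.
  by rewrite /c /m -natr1; have : 0 <= m0%:R :> R by []; lra.
have c0 : 0 < c by lra.
have p2 := pi_ge2 R.
have cp : c <= c * pi by rewrite ler_peMr //; lra.
have cp0 : 0 < c * pi by lra.
exists ((c * pi) ^+ 2).
  apply: (@le_trans _ _ (c * pi)); first by have := ler_norm r0; rewrite /B in cB; lra.
  by rewrite expr2 ler_peMr //; lra.
split; first by rewrite exprn_gt0.
have e1' : e <= 1 by lra.
have [M HM] := base_approx alpha ((c * pi) ^+ 2) e0 e1'.
exists M.+1 => n Mn w Nw.
have h : alpha || (0 < n)%N by rewrite (leq_trans _ Mn) ?orbT.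
have [nz sumx] := pert m n w Nw.
have wle : N w <= (c * pi) ^+ 2 by rewrite Nw.
have [t Et Nt] := HM n (ltnW Mn) w wle.
rewrite (partial_ratio lam h nz).
set P0 := partial_Delta alpha _ n w in Et *; set U := \prod_(k < n) _.
have NU : N (U - 1) <= e.
  have h2 : K' / c <= e / 2.
    rewrite ler_pdivrMr // mulrC -ler_pdivrMr ?divr_gt0 // invfM invrK mulrCA mulrA.
    by apply: le_trans cB; rewrite /B; lra.
  rewrite -/c in sumx.
  have := @prod_near1 (fun k => (lam k - lambda0 R alpha k) / (lambda0 R alpha k - w)) n.
  move=> H; apply: le_trans (H _) _; first by apply: le_trans sumx _; lra.
  by lra.
have rhoE : sqrtc w ^+ 2 = w by exact: sqr_sqrtc.
have Nrho : N (sqrtc w) = (m%:R + 1/2) * pi.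
  by apply/eqP; rewrite -(@eqrXn2 _ 2) ?normc_ge0 ?(ltW cp0) // -normcX rhoE Nw.
have bc := base_circle alpha rhoE (ltn0Sn m0) Nrho.
have E0 := expR_gt0 `|Im (sqrtc w)|.
have b0 : base_Delta alpha w != 0.
  by rewrite -normc_gt0; apply: lt_le_trans bc; rewrite divr_gt0.
have P00 : P0 != 0 by apply: contraNneq b0 => e'; rewrite Et e' mul0r.
have U0 : U != 0.
  apply/eqP => e'; move: NU; rewrite e' sub0r normcN normc1r; lra.
split; first by rewrite mulf_neq0.
pose a := (Delta w - base_Delta alpha w) / base_Delta alpha w.
have Na : N a <= e.
  rewrite Normc.normcM Normc.normcV ler_pdivrMr ?normc_gt0 //.
  apply: (@le_trans _ _ (e * (expR `|Im (sqrtc w)| / 16))); last by rewrite ler_wpM2l // ltW.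
  have := HD _ _ rhoE; rewrite Normc.normcM Nrho -/c => hD.
  rewrite -(ler_pM2l cp0); apply: le_trans hD _.
  have -> : c * pi * (e * (expR `|Im (sqrtc w)| / 16)) = (c * pi * e / 16) * expR `|Im (sqrtc w)| by ring.
  rewrite ler_wpM2r ?(ltW E0) //.
  have : 16 * K / e <= c * pi by rewrite /B in cB; lra.
  by rewrite ler_pdivrMr //; lra.
(* Here Delta = base (1 + a), base = P0 (1 + t), and U is the perturbation product. The numerator is
   at most 4 e and |U| >= 1/2, whence 8 e. *)
have -> : Delta w / (P0 * U) - 1 = (a + t + a * t - (U - 1)) / U.
  have -> : Delta w = base_Delta alpha w * (1 + a) by rewrite /a; field.
  by rewrite Et; field; rewrite P00 U0.
rewrite Normc.normcM Normc.normcV ler_pdivrMr ?normc_gt0 //.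
have NU2 : 1/2 <= N U.
  by have := normcB_le U (U - 1); rewrite opprB addrC subrK normc1r; lra.
apply: le_trans (normcB_le _ _) _.
have n1 := normcD_le (a + t) (a * t); have n2 := normcD_le a t; rewrite Normc.normcM in n1.
have n3 : N a * N t <= e * 1 by apply: ler_pM; rewrite ?normc_ge0 //; lra.
have n4 : 8 * e * (1/2) <= 8 * e * N U by rewrite ler_wpM2l // mulr_ge0 // ltW.
by lra.
Qed.

(** If g is the quotient of Delta by the partial product P, then Delta z - P z = P z (g z - 1), and
    |P z| <= 2 |Delta z| once g z is near 1; this form of the error remains valid when z is itself
    an eigenvalue. *)
Lemma partial_Delta_cvg alpha (lam : nat -> C) (Delta : C -> C) K : numbered alpha lam ->
  (forall n, exists2 G, entire G & forall z, Delta z = \prod_(0 <= j < n) (z - lam j) * G z) ->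
  (forall rho l : C, rho ^+ 2 = l ->
    N (rho * (Delta l - base_Delta alpha l)) <= K * expR `|Im rho|) ->
  forall z e, 0 < e -> exists M, forall n, (M <= n)%N -> N (Delta z - partial_Delta alpha lam n z) <= e.
Proof.
move=> num fac HD z e e0.
(* The circle estimate 8 d becomes 16 d at z: the first bound makes it at most 1/2, the second makes
   32 d |Delta z| at most e, the added 1 covering Delta z = 0. *)
pose d := Num.min (1/32) (e / (32 * (N (Delta z) + 1))).
have NDz := normc_ge0 (Delta z).
have d0 : 0 < d by rewrite lt_min divr_gt0 //= ?divr_gt0 ?mulr_gt0 //; lra.
have d1 : d <= 1/32 by rewrite ge_min lexx.
have d2 : d <= e / (32 * (N (Delta z) + 1)) by rewrite ge_min lexx orbT.
have dh : d <= 1/2 by lra.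
have [r rz [r0 [M HM]]] := quotient_circle num HD (4 * N z) d0 dh.
exists M.+1 => n Mn; have := HM n (ltnW Mn) => {}HM.
have h : alpha || (0 < n)%N by rewrite (leq_trans _ Mn) ?orbT.
have [k k0 E] := partial_DeltaE h.
have [G EG HG] := fac n.
have DG w : Delta w = partial_Delta alpha lam n w * (k^-1 * G w).
  by rewrite E HG; move: (\prod_(_ <= _ < _) _) (G w) => p g; field.
have NG : N (k^-1 * G z - 1) <= 2 * (8 * d).
  apply: (@entire_max R (fun w => k^-1 * G w - 1) r) => //.
    exact: entireB_cst (entireZ _ EG).
  move=> w Nw; have [P0 H] := HM w Nw; move: H.
  by rewrite DG mulrC mulKf.
set g := k^-1 * G z in NG; set P := partial_Delta alpha lam n z.
have DP : Delta z = P * g by exact: DG.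
have -> : Delta z - P = P * (g - 1) by rewrite DP; ring.
have Ng : 1/2 <= N g.
  by have := normcB_le g (g - 1); rewrite opprB addrC subrK normc1r; lra.
have NP : N P <= 2 * N (Delta z).
  rewrite DP Normc.normcM; have : N P * (1/2) <= N P * N g by rewrite ler_wpM2l ?normc_ge0.
  by lra.
rewrite Normc.normcM.
apply: (@le_trans _ _ (2 * N (Delta z) * (2 * (8 * d)))).
  by apply: ler_pM; rewrite ?normc_ge0.
apply: (@le_trans _ _ ((N (Delta z) + 1) * (32 * d))).
  have : 0 <= d by lra.
  by move=> ?; rewrite -subr_ge0 (_ : _ - _ = 32 * d) ?mulr_ge0 //; ring.
move: d2; rewrite ler_pdivlMr; last by rewrite mulr_gt0 //; lra.
by lra.
Qed.

End Hadamard.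

(** * Dividing the characteristic function by its eigenvalues *)

Section Factorization.
Variable R : realType.
Local Notation C := R[i].
Local Notation N := (@Normc.normc R).

(** A positive element of R[i] has imaginary part 0, so the radius of a ball is in fact a real
    number. *)
Lemma near_normc (z : C) (P : C -> Prop) : (\forall w \near z, P w) ->
  exists2 d : R, 0 < d & forall w, N (w - z) < d -> P w.
Proof.
move=> /nbhs_ballP[[d e'] /= e0 H].
have [/eqP e1 e2] : e' == 0 /\ 0 < d by move: e0; rewrite ltcE /= => /andP[].
exists d => // w wz; apply: H; rewrite -ball_normE /=.
by rewrite normcE normcBC ltcE /= e1 eqxx wz.
Qed.

Lemma cvgn_normc (u : nat -> C) (l : C) :
  u @ \oo --> l <->
  (forall e : R, 0 < e -> exists M, forall n, (M <= n)%N -> N (l - u n) <= e).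
Proof.
split=> [H e e0|H].
  have e1 : (0 : C) < e%:C by rewrite ltcE /= eqxx e0.
  have /cvgrPdist_le/(_ _ e1)[M _ HM] := H.
  by exists M => n Mn; have := HM n Mn; rewrite /= normcE lecE /= eqxx.
apply/cvgrPdist_le => -[d e'] e0.
have [/eqP e1 e2] : e' == 0 /\ 0 < d by move: e0; rewrite ltcE /= => /andP[].
have [M HM] := H d e2; exists M => // n Mn.
by rewrite /= normcE lecE /= e1 eqxx HM.
Qed.

Definition loc_lipschitz (F : C -> C) (z : C) : Prop :=
  exists M, forall w, N (w - z) <= 1 -> N (F w - F z) <= M * N (w - z).

Lemma loc_lipschitz_mul F z c : loc_lipschitz F z -> loc_lipschitz (fun w => (w - c) * F w) z.
Proof.
move=> [M HM]; exists ((N (z - c) + 1) * M + N (F z)) => w wz.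
have -> : (w - c) * F w - (z - c) * F z = (w - c) * (F w - F z) + (w - z) * F z by ring.
apply: le_trans (normcD_le _ _) _; rewrite !Normc.normcM mulrDl (mulrC (N (F z))) lerD2r.
rewrite -mulrA; apply: ler_pM; rewrite ?normc_ge0 //; last exact: HM.
have -> : w - c = (z - c) + (w - z) by ring.
by apply: le_trans (normcD_le _ _) _; rewrite lerD2l.
Qed.

Lemma loc_lipschitz_prod (G : C -> C) z (s : seq C) : loc_lipschitz G z ->
  loc_lipschitz (fun w => \prod_(c <- s) (w - c) * G w) z.
Proof.
move=> LG; elim: s => [|c s IH].
  by congr (loc_lipschitz _ z): LG; apply/funext => w; rewrite big_nil mul1r.
have := loc_lipschitz_mul c IH.
by congr (loc_lipschitz _ z); apply/funext => w; rewrite big_cons mulrA.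
Qed.

Lemma derivable_continuous (g : C -> C) (z : C) : derivable g z 1 -> {for z, continuous g}.
Proof. by move=> /derivable1_diffP/differentiable_continuous. Qed.

(** Cancelling (w - z)^k near z leaves H w = (w - z)^(m - k) g w with m - k > 0, so H w tends to 0,
    and the Lipschitz bound carries this to z. *)
Lemma zero_multiplicity_le (F : C -> C) z m k H :
  zero_multiplicity F z m -> (forall w, F w = (w - z) ^+ k * H w) ->
  loc_lipschitz H z -> (k < m)%N -> H z = 0.
Proof.
move=> [g [g1 g2 g3]] FH [M HM] km.
have gc : {for z, continuous g} by apply: derivable_continuous; exact: nbhs_singleton g1.
have : \forall w \near z, N (g w - g z) < 1.
  have /cvgrPdist_lt/(_ 1 ltr01) := gc.
  by apply: filterS => w /=; rewrite normcE normcBC ltcE /= eqxx.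
move=> /near_normc[d1 d10 H1].
have [d2 d20 H2] := near_normc g3.
apply/eqP; rewrite -normc_eq0; apply/negP => /negP Hz.
have Hz0 : 0 < N (H z) by rewrite lt_def Hz normc_ge0.
have B0 : 0 < N (g z) + 1 + `|M| by rewrite addrAC ltr_wpDl // addr_ge0 // normc_ge0.
(* One test point w = z + e suffices: |H z| <= |H w| + |M| e <= e (|g z| + 1 + |M|), which the last
   bound on e makes at most |H z| / 2. *)
pose e := Num.min (Num.min (d1 / 2) (d2 / 2)) (Num.min 1 (N (H z) / (2 * (N (g z) + 1 + `|M|)))).
have e0 : 0 < e by rewrite !lt_min ltr01 /= !divr_gt0 // mulr_gt0.
have [e1 e2] : e < d1 /\ e < d2.
  split.
    by apply: (@le_lt_trans _ _ (d1 / 2)); [rewrite !ge_min lexx | lra].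
  by apply: (@le_lt_trans _ _ (d2 / 2)); [rewrite !ge_min lexx ?orbT | lra].
have e3 : e <= 1 by rewrite !ge_min lexx ?orbT.
have e4 : e * (2 * (N (g z) + 1 + `|M|)) <= N (H z).
  by rewrite -ler_pdivlMr ?mulr_gt0 // !ge_min lexx ?orbT.
pose w := z + e%:C.
have wz : w - z = e%:C by rewrite /w addrC addKr.
have Nwz : N (w - z) = e by rewrite wz normcR gtr0_norm.
have wz0 : w - z != 0 by rewrite -normc_eq0 Nwz gt_eqF.
have Hw : H w = (w - z) ^+ (m - k) * g w.
  apply: (mulfI (expf_neq0 k wz0)).
  by rewrite -FH H2 ?Nwz // mulrA -exprD subnKC // ltnW.
have HwM : N (H w) <= e * (N (g z) + 1).
  rewrite Hw Normc.normcM normcX Nwz; apply: ler_pM; rewrite ?exprn_ge0 ?normc_ge0 ?(ltW e0) //.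
    have -> : (m - k = (m - k).-1.+1)%N by rewrite prednK // subn_gt0.
    by rewrite exprS ler_piMr ?(ltW e0) // exprn_ile1 ?(ltW e0).
  have -> : g w = g z + (g w - g z) by ring.
  by apply: le_trans (normcD_le _ _) _; rewrite lerD2l; apply/ltW/H1; rewrite Nwz.
have : N (H z) <= N (H w) + `|M| * e.
  have {1}-> : H z = H w + - (H w - H z) by ring.
  apply: le_trans (normcD_le _ _) _; rewrite lerD2l normcN.
  apply: le_trans (HM w _) _; rewrite Nwz //.
  by rewrite ler_wpM2r ?(ltW e0) // ler_norm.
nra.
Qed.

(** To divide by z - lam n after n steps, the quotient must still vanish at lam n. The earlier
    indices with that value, together with n itself, are among the m indices counted by the
    multiplicity, so fewer than m factors have been removed there; the other factors are nonzero at
    lam n. *)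
Lemma spectrum_factor (F : C -> C) (lam : nat -> C) : entire F ->
  (forall z, exists2 m, zero_multiplicity F z m & ([set n | lam n = z] #= `I_m)%card) ->
  forall n, exists2 G, entire G & forall z, F z = \prod_(0 <= j < n) (z - lam j) * G z.
Proof.
move=> entF spec; elim=> [|n [G entG FG]].
  by exists F => // z; rewrite big_geq // mul1r.
pose z0 := lam n.
have [m mF cm] := spec z0.
pose s := [seq j <- iota 0 n | lam j == z0].
pose H w := \prod_(c <- [seq lam j | j <- iota 0 n & lam j != z0]) (w - c) * G w.
have FH w : F w = (w - z0) ^+ (size s) * H w.
  rewrite FG /H mulrA; congr (_ * _).
  rewrite /index_iota subn0 (bigID (fun j => lam j == z0)) /=; congr (_ * _).
    rewrite -big_filter (eq_big_seq (fun=> w - z0)); last first.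
      by move=> j; rewrite mem_filter => /andP[/eqP -> _].
    by rewrite big_const_seq count_predT -/s iter_mulr_1.
  by rewrite big_map big_filter.
have sm : (size s < m)%N.
  have finA : finite_set [set n | lam n = z0] by exists m.
  have /finite_fsetP[A A1] := finA.
  have A2 : size (finmap.enum_fset A) = m by apply/card_eq_fsetP; rewrite -A1.
  rewrite -A2 -[(size s).+1]/(size (n :: s)); apply: uniq_leq_size.
    by rewrite /= filter_uniq ?iota_uniq // andbT mem_filter mem_iota add0n ltnn !andbF.
  move=> j; rewrite in_cons => jA.
  have : [set k | lam k = z0] j.
    by case/orP : jA => [/eqP->//|]; rewrite mem_filter => /andP[/eqP].
  by rewrite A1.
have H0 : H z0 = 0.
  apply: (zero_multiplicity_le mF FH _ sm); apply: loc_lipschitz_prod.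
  exact: entire_lipschitz.
have G0 : G z0 = 0.
  move/eqP : H0; rewrite /H mulf_eq0 => /orP[|/eqP//].
  rewrite prodf_seq_eq0 => /hasP[c] /mapP[j].
  by rewrite mem_filter => /andP[jz _] -> /=; rewrite subr_eq0 eq_sym (negPf jz).
have [G' entG' GG'] := entire_div entG G0.
exists G' => // z; rewrite big_nat_recr //= FG GG' mulrA //.
Qed.

End Factorization.

(** * Potentials folded about a *)

Section Isometries.
Variable R : realType.
Local Notation N := (@Normc.normc R).
Local Notation mu := (@lebesgue_measure R).
Local Notation Re := complex.Re.
Local Notation Im := complex.Im.

(** Translations and reflections in one family, so that each change of variables is proved once. *)
Definition isom (sg : bool) (b x : R) : R := b + (-1) ^+ sg * x.

Lemma isomE b x : (isom false b x = b + x) * (isom true b x = b - x).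
Proof. by rewrite /isom expr0 expr1 mul1r mulN1r. Qed.

Lemma measurable_isom sg b (D : set R) : measurable_fun D (isom sg b).
Proof. by apply: measurable_funD => //; apply: measurable_funM => //. Qed.

Lemma measurable_preimage_isom sg b (D : set R) : measurable D -> measurable (isom sg b @^-1` D).
Proof. by move=> mD; rewrite -[X in measurable X]setTI; apply: measurable_isom. Qed.

(** Lebesgue measure is determined by half-open intervals. A reflection closes the other end of the
    interval, which leaves the length unchanged. *)
Lemma lebesgue_measure_isom sg b (A : set R) : measurable A -> mu (isom sg b @^-1` A) = mu A.
Proof.
pose H := isMeasurableFun.Build _ _ (measurableTypeR R) (measurableTypeR R) _ (@measurable_isom sg b setT).
pose T : {mfun _ >-> _} := HB.pack (isom sg b : measurableTypeR R -> measurableTypeR R) H.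
move=> mA; rewrite -[LHS]/(pushforward mu T A).
apply/esym/lebesgue_measure_unique => //= _ [[u v]] _ <-.
rewrite /pushforward /=; case: sg H T => /= _ _.
  have -> : isom true b @^-1` `]u, v] = `[b - v, b - u[%classic.
    by apply/seteqP; split=> x /=; rewrite !in_itv /= isomE => /andP[? ?]; apply/andP; split; lra.
  rewrite !lebesgue_measure_itv /= !lte_fin ltrD2l ltrN2.
  by case: ifP => // _; rewrite !EFinN -!EFinD; congr EFin; ring.
have -> : isom false b @^-1` `]u, v] = `]u - b, v - b]%classic.
  by apply/seteqP; split=> x /=; rewrite !in_itv /= isomE => /andP[? ?]; apply/andP; split; lra.
rewrite !lebesgue_measure_itv /= !lte_fin ltrD2r.
by case: ifP => // _; rewrite -!EFinB; congr EFin; ring.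
Qed.

Lemma measurable_fun_isom d (T : measurableType d) sg b (D : set R) (f : R -> T) : measurable D ->
  measurable_fun D f -> measurable_fun (isom sg b @^-1` D) (fun x => f (isom sg b x)).
Proof.
move=> mD mf; apply: (measurable_comp mD _ mf); last exact: measurable_isom.
by move=> _ [x Dx <-].
Qed.

Lemma ge0_integral_isom sg b (D : set R) (f : R -> \bar R) : measurable D -> measurable_fun D f ->
  (forall x, 0 <= f x)%E ->
  (\int[mu]_(x in D) f x = \int[mu]_(x in isom sg b @^-1` D) f (isom sg b x))%E.
Proof.
move=> mD mf f0.
have mT := @measurable_isom sg b setT.
rewrite -[RHS](ge0_integral_pushforward (mT : measurable_fun [set: measurableTypeR R] (isom sg b : _ -> measurableTypeR R)) mu) //.
by apply: eq_measure_integral => A mA _; exact: (esym (@lebesgue_measure_isom sg b A mA)).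
Qed.

Lemma integral_isom sg b (D : set R) (f : R -> \bar R) : measurable D -> measurable_fun D f ->
  (\int[mu]_(x in D) f x = \int[mu]_(x in isom sg b @^-1` D) f (isom sg b x))%E.
Proof.
move=> mD mf; rewrite integralE [RHS]integralE.
congr (_ - _)%E.
  rewrite (@ge0_integral_isom sg b D (f^\+)%E) //; last exact/measurable_funepos.
  by apply: eq_integral => x _; rewrite !unlock.
rewrite (@ge0_integral_isom sg b D (f^\-)%E) //; last exact/measurable_funeneg.
  by apply: eq_integral => x _; rewrite !unlock.
Qed.

Lemma rint_isom sg b (D : set R) f : measurable D -> rint D f ->
  rint (isom sg b @^-1` D) (fun x => f (isom sg b x)).
Proof.
move=> mD /integrableP[mf fi]; apply/integrableP; split.
  exact: (measurable_fun_isom mD mf).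
rewrite -(ge0_integral_isom sg b (f := fun x => `|(f x)%:E|%E)) //.
exact: measurableT_comp.
Qed.

Lemma Rintegral_isom sg b (D : set R) f : measurable D -> measurable_fun D f ->
  \int[mu]_(x in D) f x = \int[mu]_(x in isom sg b @^-1` D) f (isom sg b x).
Proof. by move=> mD mf; rewrite /Rintegral (integral_isom sg b) //; exact: measurableT_comp. Qed.

Lemma cint_isom sg b (D : set R) f : measurable D -> cint D f ->
  cint (isom sg b @^-1` D) (fun x => f (isom sg b x)).
Proof. by move=> mD [f1 f2]; split; [exact: (rint_isom sg b mD f1)|exact: (rint_isom sg b mD f2)]. Qed.

Lemma cintegral_isom sg b (D : set R) f : measurable D -> cint D f ->
  cintegral D f = cintegral (isom sg b @^-1` D) (fun x => f (isom sg b x)).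
Proof.
move=> mD [f1 f2]; rewrite /cintegral.
by congr (_ +i* _); apply: (Rintegral_isom sg b mD); apply: rint_meas.
Qed.

Lemma L2_isom sg b (D : set R) f : measurable D -> L2 D f ->
  L2 (isom sg b @^-1` D) (fun x => f (isom sg b x)).
Proof.
move=> mD [f1 f2 f3]; split.
- exact: (measurable_fun_isom mD f1).
- exact: (measurable_fun_isom mD f2).
rewrite /sqnorm2 -(ge0_integral_isom sg b (f := fun x => (N (f x) ^+ 2)%:E)) //.
  have [E1 E2] : rL2 D (fun x => Re (f x)) /\ rL2 D (fun x => Im (f x)) by apply/L2P.
  apply/measurable_EFinP.
  apply: (eq_measurable_fun (fun x => Re (f x) ^+ 2 + Im (f x) ^+ 2)).
    by move=> x _; rewrite normc_sqr.
  by apply: measurable_funD; apply: measurable_funX.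
by move=> x; rewrite lee_fin sqr_ge0.
Qed.

Lemma ae_isom sg b (P : R -> Prop) : {ae mu, forall x, P x} ->
  {ae mu, forall x, P (isom sg b x)}.
Proof.
move=> [A [mA A0 PA]]; exists (isom sg b @^-1` A); split.
- exact: measurable_preimage_isom.
- by rewrite lebesgue_measure_isom.
- by move=> x Px; apply: PA => Q; apply: Px.
Qed.

End Isometries.

(** * The folded potential and the characteristic function *)

Section Folding.
Variable R : realType.
Local Notation C := R[i].
Local Notation Re := complex.Re.
Local Notation Im := complex.Im.

Definition zero_ext (D : set R) (f : R -> C) (x : R) : C := if x \in D then f x else 0.

Lemma Re_zero_ext D f x : Re (zero_ext D f x) = ((fun y => Re (f y)) \_ D) x.
Proof. by rewrite /zero_ext /patch; case: ifP. Qed.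

Lemma Im_zero_ext D f x : Im (zero_ext D f x) = ((fun y => Im (f y)) \_ D) x.
Proof. by rewrite /zero_ext /patch; case: ifP. Qed.

Lemma rint_restrict (D E : set R) (f : R -> R) : measurable D -> measurable E ->
  rint D f -> rint E (f \_ D).
Proof.
move=> mD mE /(integrable_patch mD) h; exact: (@rintS _ setT) h.
Qed.

Lemma rL2_restrict (D E : set R) (f : R -> R) : measurable D -> measurable E ->
  rL2 D f -> rL2 E (f \_ D).
Proof.
move=> mD mE [h1 h2]; split.
  apply/(measurable_restrict f mD mE); apply: measurable_funS h1 => //.
apply: (eq_rint mE) (rint_restrict mD mE h2) => x _.
by rewrite /patch; case: ifP => // _; rewrite expr0n.
Qed.

Lemma L2_zero_ext (D E : set R) f : measurable D -> measurable E -> L2 D f -> L2 E (zero_ext D f).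
Proof.
move=> mD mE /(L2P _ mD)[h1 h2]; apply/(L2P _ mE).
split; [apply: (eq_rL2 mE) (rL2_restrict mD mE h1)|apply: (eq_rL2 mE) (rL2_restrict mD mE h2)] => x _.
- by rewrite Re_zero_ext.
- by rewrite Im_zero_ext.
Qed.

Lemma cint_zero_ext (D E : set R) f : measurable D -> measurable E -> cint D f -> cint E (zero_ext D f).
Proof.
move=> mD mE [h1 h2].
split; [apply: (eq_rint mE) (rint_restrict mD mE h1)|apply: (eq_rint mE) (rint_restrict mD mE h2)] => x _.
- by rewrite Re_zero_ext.
- by rewrite Im_zero_ext.
Qed.

Lemma cintegral_zero_ext (D E : set R) f : D `<=` E -> cintegral E (zero_ext D f) = cintegral D f.
Proof.
move=> /setIidPr DE; rewrite /cintegral -[in RHS]DE !Rintegral_mkcondr.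
by congr (_ +i* _); apply: eq_Rintegral => x _; rewrite (Re_zero_ext, Im_zero_ext).
Qed.

Lemma zero_extM D f (h : R -> C) x : h x * zero_ext D f x = zero_ext D (fun y => h y * f y) x.
Proof. by rewrite /zero_ext; case: ifP => // _; rewrite mulr0. Qed.

Lemma cintegral_bndoo (x y : R) b0 b1 f : cint [set` Interval (BSide b0 x) (BSide b1 y)] f ->
  cintegral [set` Interval (BSide b0 x) (BSide b1 y)] f = cintegral `]x, y[ f.
Proof.
have sub : `]x, y[%classic `<=` [set` Interval (BSide b0 x) (BSide b1 y)].
  by move=> z /=; rewrite !in_itv /=; case: b0; case: b1 => /= /andP[h1 h2]; rewrite ?h1 ?h2 ?(ltW h1) ?(ltW h2).
move=> [h1 h2]; rewrite /cintegral /Rintegral.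
congr (fine _ +i* fine _); rewrite integral_itv_bndoo //.
  by apply: measurable_funS (measurable_int _ h1) => //; exact: measurable_itv.
by apply: measurable_funS (measurable_int _ h2) => //; exact: measurable_itv.
Qed.

Lemma ccont_isom sg b (f : R -> C) : ccont f -> ccont (fun x => f (isom sg b x)).
Proof.
have ci : continuous (@isom R sg b).
  by move=> x; apply: cvgD; [exact: cvg_cst|apply: cvgM; [exact: cvg_cst|exact: cvg_id]].
move=> [h1 h2]; split=> x.
- exact: (@continuous_comp _ _ _ (isom sg b) (fun y => Re (f y)) x (ci x) (h1 _)).
- exact: (@continuous_comp _ _ _ (isom sg b) (fun y => Im (f y)) x (ci x) (h2 _)).
Qed.

Lemma ccontZ c f : @ccont R f -> ccont (fun x => c * f x).
Proof.
move=> [f1 f2]; split => x.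
- under eq_fun do rewrite cReM.
  exact: (cvgB (cvgM (cvg_cst _) (f1 x)) (cvgM (cvg_cst _) (f2 x))).
- under eq_fun do rewrite cImM.
  exact: (cvgD (cvgM (cvg_cst _) (f2 x)) (cvgM (cvg_cst _) (f1 x))).
Qed.

Variables (a : R) (a0 : 0 < a) (a1 : a < 1).

(* The sum of q over the points of (0, 1) at distance s from a. *)
Definition fold (q : R -> C) (s : R) : C :=
  zero_ext `]0, a[ (fun t => q (isom true a t)) s + zero_ext `]0, (1 - a)[ (fun t => q (isom false a t)) s.

Definition wave (alpha : bool) (q : R -> C) (s : R) : C :=
  fold q s + (-1) ^+ alpha * fold q (isom true 1 s).

Lemma preimage_low : isom true a @^-1` `]0, a[ = `]0, a[%classic.
Proof. by apply/seteqP; split=> x /=; rewrite !in_itv /= isomE => /andP[? ?]; apply/andP; split; lra. Qed.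

Lemma preimage_high : isom false a @^-1` `]a, 1[ = `]0, (1 - a)[%classic.
Proof. by apply/seteqP; split=> x /=; rewrite !in_itv /= isomE => /andP[? ?]; apply/andP; split; lra. Qed.

Lemma preimage_flip : isom true 1 @^-1` `]0, 1[ = `](0:R), 1[%classic.
Proof. by apply/seteqP; split=> x /=; rewrite !in_itv /= isomE => /andP[? ?]; apply/andP; split; lra. Qed.

Let m01 : measurable (`]0, 1[%classic : set R). Proof. exact: measurable_itv. Qed.
Let m0a : measurable (`]0, a[%classic : set R). Proof. exact: measurable_itv. Qed.
Let ma1 : measurable (`]a, 1[%classic : set R). Proof. exact: measurable_itv. Qed.
Let m0b : measurable (`]0, (1 - a)[%classic : set R). Proof. exact: measurable_itv. Qed.

Lemma L2S (D E : set R) f : measurable D -> measurable E -> E `<=` D -> L2 D f -> L2 E f.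
Proof.
move=> mD mE ED /(L2P _ mD)[h1 h2]; apply/(L2P _ mE).
by split; [exact: rL2S h1|exact: rL2S h2].
Qed.

Lemma sub_low : `]0, a[%classic `<=` `](0:R), 1[%classic.
Proof. by apply: subset_itvl; rewrite bnd_simp ltW. Qed.
Lemma sub_high : `]a, 1[%classic `<=` `](0:R), 1[%classic.
Proof. by apply: subset_itvr; rewrite bnd_simp ltW. Qed.
Lemma sub_fold : `]0, (1 - a)[%classic `<=` `](0:R), 1[%classic.
Proof. by apply: subset_itvl; rewrite bnd_simp gerBl ltW. Qed.

Lemma L2_fold q : L2 `]0, 1[ q -> L2 `]0, 1[ (fold q).
Proof.
move=> L2q; apply: L2D => //; apply: L2_zero_ext => //.
  by rewrite -preimage_low; apply: L2_isom => //; apply: L2S L2q => //; exact: sub_low.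
by rewrite -preimage_high; apply: L2_isom => //; apply: L2S L2q => //; exact: sub_high.
Qed.

Lemma L2_wave alpha q : L2 `]0, 1[ q -> L2 `]0, 1[ (wave alpha q).
Proof.
move=> /L2_fold h; apply: L2D => //; apply: L2Z => //.
by rewrite -preimage_flip; apply: L2_isom.
Qed.

Lemma cint_open (f : R -> C) : L2 `]0, 1[ f -> cint `]0, 1[ f.
Proof. by move=> /L2_cint; apply: cintS => //; apply: itvoo_sub. Qed.

Lemma cintM01 (D : set R) (h g : R -> C) : measurable D -> D `<=` `]0, 1[ -> ccont h ->
  cint D g -> cint D (fun x => h x * g x).
Proof.
move=> mD D01; apply: (@cintM _ D 0 1) => //; apply: subset_trans D01 _; exact: itvoo_sub.
Qed.

Lemma cintegral_fold q (h : R -> C) : L2 `]0, 1[ q -> ccont h ->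
  cintegral `]0, 1[ (fun s => h s * fold q s) =
  cintegral `]0, a[ (fun t => h (a - t) * q t) + cintegral `]a, 1[ (fun t => h (t - a) * q t).
Proof.
move=> L2q ch; have iq := cint_open L2q.
have i1 : cint `]0, a[ q by apply: cintS iq => //; exact: sub_low.
have i2 : cint `]a, 1[ q by apply: cintS iq => //; exact: sub_high.
have ch1 : ccont (fun t => h (a - t)).
  by have := ccont_isom true a ch; congr ccont; apply/funext => t; rewrite isomE.
have ch2 : ccont (fun t => h (t - a)).
  by have := ccont_isom false (- a) ch; congr ccont; apply/funext => t; rewrite isomE addrC.
rewrite (cintegral_isom true a m0a) ?(cintegral_isom false a ma1); last 2 first.
- exact: cintM01 sub_high _ _.
- exact: cintM01 sub_low _ _.
rewrite preimage_low preimage_high.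
rewrite -(cintegral_zero_ext _ sub_low) -(cintegral_zero_ext _ sub_fold) -cintegralD //; last 2 first.
- apply: cint_zero_ext => //; rewrite -preimage_low.
  by apply: (@cint_isom _ true a `]0, a[ (fun t => h (a - t) * q t)) => //; exact: cintM01 sub_low _ _.
- apply: cint_zero_ext => //; rewrite -preimage_high.
  by apply: (@cint_isom _ false a `]a, 1[ (fun t => h (t - a) * q t)) => //; exact: cintM01 sub_high _ _.
apply: eq_cintegral => s _; rewrite mulrDr !zero_extM /zero_ext !isomE.
have -> : a - (a - s) = s by ring.
by have -> : a + s - a = s by ring.
Qed.

(** The substitution s -> 1 - s moves the reflected half of the kernel onto the folded potential,
    which leaves a single sine transform on (0, 1). *)
Lemma cintegral_wave q (alpha : bool) l : L2 `]0, 1[ q ->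
  cintegral `[0, a] (fun t => q t * kernel_fun ((-1) ^+ alpha) l (a - t)) +
  cintegral `]a, 1] (fun t => q t * kernel_fun ((-1) ^+ alpha) l (t - a)) =
  cintegral `]0, 1[ (fun s => sinl l s * wave alpha q s).
Proof.
move=> L2q; set sg : C := (-1) ^+ alpha.
have iQ := cint_open (L2_fold L2q).
have iQ1 : cint `]0, 1[ (fun s => fold q (isom true 1 s)).
  by rewrite -preimage_flip; apply: cint_isom.
have cS1 : ccont (fun s => sinl l (1 - s)).
  by have := ccont_isom true 1 (ccont_sinl l); congr ccont; apply/funext => t; rewrite isomE.
have cK : ccont (kernel_fun sg l).
  by apply: ccontD; [exact: ccont_sinl|exact: ccontZ].
have ch1 : ccont (fun t => kernel_fun sg l (a - t)).
  by have := ccont_isom true a cK; congr ccont; apply/funext => t; rewrite isomE.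
have ch2 : ccont (fun t => kernel_fun sg l (t - a)).
  by have := ccont_isom false (- a) cK; congr ccont; apply/funext => t; rewrite isomE addrC.
have iq := L2_cint L2q.
transitivity (cintegral `]0, 1[ (fun s => kernel_fun sg l s * fold q s)).
  have s1 : `[0, a]%classic `<=` `[(0:R), 1]%classic by apply: subset_itvl; rewrite bnd_simp ltW.
  have s2 : `]a, 1]%classic `<=` `[(0:R), 1]%classic by apply: subset_itvr; rewrite bnd_simp ltW.
  have i1 : cint `[0, a] (fun t => q t * kernel_fun sg l (a - t)).
    apply: (@eq_cint _ _ (fun t => kernel_fun sg l (a - t) * q t)) => //; first by move=> t _; rewrite mulrC.
    by apply: (@cintM _ _ 0 1) => //; apply: cintS iq.
  have i2 : cint `]a, 1] (fun t => q t * kernel_fun sg l (t - a)).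
    apply: (@eq_cint _ _ (fun t => kernel_fun sg l (t - a) * q t)) => //; first by move=> t _; rewrite mulrC.
    by apply: (@cintM _ _ 0 1) => //; apply: cintS iq.
  rewrite cintegral_fold // (cintegral_bndoo i1) (cintegral_bndoo i2).
  by congr (_ + _); apply: eq_cintegral => t _; rewrite mulrC.
transitivity (cintegral `]0, 1[ (fun s => sinl l s * fold q s) + cintegral `]0, 1[ (fun s => sg * (sinl l (1 - s) * fold q s))).
  rewrite -cintegralD //; first by apply: eq_cintegral => s _; rewrite /kernel_fun; ring.
    by apply: cintM01 => //; exact: ccont_sinl.
  by apply: cintZ => //; apply: cintM01.
transitivity (cintegral `]0, 1[ (fun s => sinl l s * fold q s) + cintegral `]0, 1[ (fun s => sg * (sinl l s * fold q (isom true 1 s)))).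
  congr (_ + _); rewrite !cintegralZ //; last 2 first.
  - by apply: cintM01 => //; exact: ccont_sinl.
  - exact: cintM01.
  congr (_ * _); rewrite (cintegral_isom true 1 m01) ?preimage_flip; last exact: cintM01.
  by apply: eq_cintegral => s _; rewrite !isomE (_ : 1 - (1 - s) = s) //; ring.
rewrite -cintegralD //.
- by apply: eq_cintegral => s _; rewrite /wave -/sg; ring.
- by apply: cintM01 => //; exact: ccont_sinl.
- by apply: cintZ => //; apply: cintM01 => //; exact: ccont_sinl.
Qed.

Definition Delta_of (alpha : bool) (w : R -> C) (l : C) : C :=
  base_Delta alpha l - cintegral `]0, 1[ (fun s => sinl l s * w s).

(** The determinant has the same value for every choice of the two solutions, and such solutions
    exist for every l, so the relation [characteristic_function] defines exactly one function. *)
Lemma characteristic_wave q (alpha : bool) Delta : L2 `]0, 1[ q ->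
  characteristic_function q a ((-1) ^+ alpha) Delta <-> Delta = Delta_of alpha (wave alpha q).
Proof.
move=> L2q.
have a01 : a \in `[0, 1] by rewrite in_itv /= !ltW.
have sg2 : ((-1) ^+ alpha : C) ^+ 2 = 1 by case: (alpha); rewrite ?expr0 ?expr1 ?sqrrN expr1n.
split=> [H|-> l].
  apply/funext => l; have [c [dc [s [ds [[h1 h2] [h3 h4] [h5 h6] ->]]]]] := H l.
  by rewrite (characteristic_value L2q a01 sg2 h1 h2) // cintegral_wave // /Delta_of /base_Delta.
have [c [dc [h1 h3 h4]]] := exists_solution l 1 0 L2q a01.
have [s [ds [h2 h5 h6]]] := exists_solution l 0 1 L2q a01.
exists c, dc, s, ds; split => //.
by rewrite (characteristic_value L2q a01 sg2 h1 h2) // cintegral_wave // /Delta_of /base_Delta.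
Qed.

End Folding.

(** * Growth and power series of the sine transform *)

Section WaveTransform.
Variable R : realType.
Local Notation C := R[i].
Local Notation N := (@Normc.normc R).
Local Notation mu := (@lebesgue_measure R).
Local Notation Re := complex.Re.
Local Notation Im := complex.Im.

Let m01 : measurable (`]0, 1[%classic : set R). Proof. exact: measurable_itv. Qed.

Lemma rint_abs (D : set R) (f : R -> R) : measurable D -> rint D f -> rint D (fun x => `|f x|).
Proof.
move=> mD h; have mf := rint_meas h; apply: (le_rint mD _ _ (integrable_abse h)) => //.
  exact: measurableT_comp.
by move=> x _; rewrite normr_id.
Qed.

Lemma cintegral_weight (h w : R -> C) (M : R) : ccont h -> cint `]0, 1[ w ->
  (forall s, s \in `]0, 1[ -> N (h s) <= M) ->
  N (cintegral `]0, 1[ (fun s => h s * w s)) <=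
  M * \int[mu]_(s in `]0, 1[) (`|Re (w s)| + `|Im (w s)|).
Proof.
move=> ch iw hM; have [i1 i2] := iw.
have ig : rint `]0, 1[ (fun s => `|Re (w s)| + `|Im (w s)|).
  by apply: rintD => //; apply: rint_abs.
rewrite -RintegralZl //; apply: normc_cintegral_le => //.
- by apply: cintM01.
- exact: (@integrable_scale _ `]0, 1[ M (fun s => `|Re (w s)| + `|Im (w s)|)).
move=> s s01; rewrite Normc.normcM; apply: ler_pM; rewrite ?normc_ge0 //; first exact: hM.
exact: normc_le_ReIm.
Qed.

(** On (0, 1) one has |rho sinl l s| <= exp (|Im rho| s), so the L_1 norms of the two parts of w add
    up to a valid K; this is the growth hypothesis of [partial_Delta_cvg]. *)
Lemma Delta_of_growth alpha (w : R -> C) : cint `]0, 1[ w -> exists K, forall rho l, rho ^+ 2 = l ->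
  N (rho * (Delta_of alpha w l - base_Delta alpha l)) <= K * expR `|Im rho|.
Proof.
move=> iw; exists (\int[mu]_(s in `]0, 1[) (`|Re (w s)| + `|Im (w s)|)) => rho l rl.
have -> : rho * (Delta_of alpha w l - base_Delta alpha l) =
  - (rho * cintegral `]0, 1[ (fun s => sinl l s * w s)) by rewrite /Delta_of; ring.
rewrite normcN -cintegralZ //; last by apply: cintM01 => //; exact: ccont_sinl.
rewrite (eq_cintegral (g := fun s => (rho * sinl l s) * w s)); last by move=> s _; rewrite mulrA.
rewrite mulrC; apply: cintegral_weight => //; first exact: ccontZ (ccont_sinl l).
move=> s; rewrite in_itv /= => /andP[s0 s1].
apply: le_trans (normc_sinl rl (ltW s0)) _.
by rewrite ler_expR ler_piMr // ltW.
Qed.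

Lemma entireD (F G : C -> C) : entire F -> entire G -> entire (fun z => F z + G z).
Proof.
move=> [c Hc] [d Hd]; exists (fun k => c k + d k) => r r0.
have [K HK] := Hc _ r0; have [L HL] := Hd _ r0; exists (K + L) => n z zr.
under eq_bigr do rewrite mulrDl.
rewrite big_split /= opprD addrACA mulrDl.
by apply: le_trans (normcD_le _ _) _; apply: lerD; [exact: HK|exact: HL].
Qed.

Lemma cintegral_sum (D : set R) n (f : nat -> R -> C) : measurable D -> (forall k, cint D (f k)) ->
  cint D (fun s => \sum_(k < n) f k s) /\
  cintegral D (fun s => \sum_(k < n) f k s) = \sum_(k < n) cintegral D (f k).
Proof.
move=> mD H; elim: n => [|n [IH1 IH2]].
  split.
    apply: (eq_cint (f := fun=> 0 * f 0%N 0)) => //; first by move=> x _; rewrite mul0r big_ord0.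
    by apply: (eq_cint (f := fun s => 0 * f 0%N s)) => //; [move=> x _; rewrite !mul0r|apply: cintZ].
  rewrite big_ord0 (eq_cintegral (g := fun s => 0 * f 0%N s)); last by move=> x _; rewrite big_ord0 mul0r.
  by rewrite cintegralZ // mul0r.
split.
  apply: (eq_cint (f := fun s => \sum_(k < n) f k s + f n s)) => //; first by move=> x _; rewrite big_ord_recr.
  exact: cintD.
rewrite big_ord_recr /= -IH2 -cintegralD //.
by apply: eq_cintegral => s _; rewrite big_ord_recr.
Qed.

Lemma ccont_monof k (c : R) : ccont (fun s => (c * monof k s)%:C).
Proof.
split=> /= x; last exact: cvg_cst.
rewrite /monof; apply: cvgM; first exact: cvg_cst.
by apply: cvgM; [exact: exprn_continuous|exact: cvg_cst].
Qed.

(** The Taylor bound for [sinl l s] is uniform in s, so the expansion may be integrated against w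
    term by term. *)
Lemma entire_sine_transform (w : R -> C) : cint `]0, 1[ w ->
  entire (fun l => cintegral `]0, 1[ (fun s => sinl l s * w s)).
Proof.
move=> iw.
exists (fun k => cintegral `]0, 1[ (fun s => ((-1) ^+ k * monof k.*2.+1 s)%:C * w s)) => r r0.
exists (expR (1 + r) * expR r * \int[mu]_(s in `]0, 1[) (`|Re (w s)| + `|Im (w s)|)) => n z zr.
pose c k s : C := ((-1) ^+ k * monof k.*2.+1 s)%:C.
have ic k : cint `]0, 1[ (fun s => z ^+ k * (c k s * w s)).
  by apply: cintZ => //; apply: cintM01 => //; exact: ccont_monof.
have [i1 e1] := cintegral_sum n m01 ic.
have -> : \sum_(k < n) cintegral `]0, 1[ (fun s => c k s * w s) * z ^+ k =
   cintegral `]0, 1[ (fun s => \sum_(k < n) z ^+ k * (c k s * w s)).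
  rewrite e1; apply: eq_bigr => k _; rewrite mulrC cintegralZ //.
  by apply: cintM01 => //; exact: ccont_monof.
rewrite -cintegralB //; last by apply: cintM01 => //; exact: ccont_sinl.
pose h s : C := sinl z s - \sum_(k < n) c k s * z ^+ k.
rewrite (eq_cintegral (g := fun s => h s * w s)); last first.
  move=> s _; rewrite /h mulrBl mulr_suml; congr (_ - _).
  by apply: eq_bigr => k _; ring.
rewrite mulrAC; apply: cintegral_weight => //.
  have cs : ccont (fun s => \sum_(k < n) c k s * z ^+ k).
    elim: n {e1 i1 h} => [|n IH].
      have := ccont_monof 0 0; congr ccont; apply/funext => s.
      by rewrite big_ord0 mul0r.
    have := ccontD IH (ccontZ (z ^+ n) (ccont_monof n.*2.+1 ((-1) ^+ n))).
    by congr ccont; apply/funext => s; rewrite big_ord_recr /= /c [_ * z ^+ n]mulrC.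
  have := ccontD (ccont_sinl z) (ccontZ (-1) cs).
  by congr ccont; apply/funext => s; rewrite /h mulN1r.
move=> s; rewrite in_itv /= => /andP[s0 s1].
by apply: (@taylor_sinl _ r s); rewrite ?(ltW s0) ?(ltW s1).
Qed.

Lemma entire_Delta_of alpha (w : R -> C) : cint `]0, 1[ w -> entire (Delta_of alpha w).
Proof.
move=> iw.
have eC : entire (fun l : C => cosl l 1).
  exists (fun k => ((-1) ^+ k * monof k.*2 1)%:C) => r r0; exists (expR (1 + r) * expR r).
  by apply: taylor_cosl; rewrite ?ler01 ?lexx.
have := entireB_cst (- 2) (entireD (entireZ (- (2 * (-1) ^+ alpha)) eC) (entireZ (-1) (entire_sine_transform iw))).
congr entire; apply/funext => l; rewrite /Delta_of /base_Delta; ring.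
Qed.

Lemma f_of_Delta alpha (w : R -> C) (rho : R) : cint `]0, 1[ w ->
  f_of alpha (Delta_of alpha w) rho = cintegral `]0, 1[ (fun s => (sin (rho * s))%:C * w s).
Proof.
move=> iw; rewrite /f_of /Delta_of /base_Delta cosl_real mulr1.
rewrite [RHS](eq_cintegral (g := fun s => rho%:C * (sinl ((rho ^+ 2)%:C) s * w s))); last first.
  by move=> s _; rewrite [RHS]mulrA sinl_real.
rewrite cintegralZ //; last by apply: cintM01 => //; exact: ccont_sinl.
by rewrite opprB addrCA subrr addr0.
Qed.

End WaveTransform.

(** * Completeness of the sine system *)

Section SineSeries.
Variable R : realType.
Local Notation C := R[i].
Local Notation mu := (@lebesgue_measure R).
Local Notation Re := complex.Re.
Local Notation Im := complex.Im.

Definition sine (k : nat) (x : R) : R := sin (pi * k%:R * x).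

Definition ip (f g : R -> R) : R := \int[mu]_(x in `]0, 1[) (f x * g x).

Local Notation H := (rL2 `]0, 1[).

Let m01 : measurable (`]0, 1[%classic : set R). Proof. exact: measurable_itv. Qed.
Let s01 : `]0, 1[%classic `<=` `[(0:R), 1]%classic. Proof. exact: itvoo_sub. Qed.

Lemma ipC f g : ip f g = ip g f.
Proof. by apply: eq_Rintegral => x _; rewrite mulrC. Qed.

Lemma ipD f g h : H f -> H g -> H h -> ip (fun x => f x + g x) h = ip f h + ip g h.
Proof.
move=> hf hg hh; rewrite /ip -RintegralD //; try exact: rL2_rintM.
by apply: eq_Rintegral => x _; rewrite mulrDl.
Qed.

Lemma ipZ c f g : H f -> H g -> ip (fun x => c * f x) g = c * ip f g.
Proof.
move=> hf hg; rewrite /ip -RintegralZl //; last exact: rL2_rintM.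
by apply: eq_Rintegral => x _; rewrite mulrA.
Qed.

Lemma ipB f g h : H f -> H g -> H h -> ip (fun x => f x - g x) h = ip f h - ip g h.
Proof.
move=> hf hg hh; rewrite /ip -RintegralB //; try exact: rL2_rintM.
by apply: eq_Rintegral => x _; rewrite mulrBl.
Qed.

Lemma ip_ge0 f : 0 <= ip f f.
Proof. by apply: Rintegral_ge0 => x _; rewrite -expr2 sqr_ge0. Qed.

Lemma eq_ip f g h k : (forall x, x \in `]0, 1[ -> f x = g x) -> (forall x, x \in `]0, 1[ -> h x = k x) ->
  ip f h = ip g k.
Proof. by move=> e1 e2; apply: eq_Rintegral => x; rewrite inE /= => x01; rewrite e1 ?e2. Qed.

Lemma ip_parallelogram f g : H f -> H g ->
  ip (fun x => f x + g x) (fun x => f x + g x) <= 2 * ip f f + 2 * ip g g.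
Proof.
move=> hf hg; have hD := rL2D m01 hf hg; have hB := rL2B m01 hf hg.
have := ip_ge0 (fun x => f x - g x).
rewrite ipB // [ip f _]ipC [ip g _]ipC !ipB // ipD // [ip f (fun x => _ + _)]ipC [ip g (fun x => _ + _)]ipC !ipD //.
by rewrite (ipC g f); lra.
Qed.

Lemma is_derive_sine (c x : R) : is_derive x (1:R) (fun y => sin (c * y)) (c * cos (c * x)).
Proof.
have h : is_derive x (1:R) (fun y => c * y) c.
  by have := is_deriveZ c (is_derive_id x (1:R)); congr is_derive; rewrite /GRing.scale /= mulr1.
have := @is_derive1_comp _ sin (fun y => c * y) x _ _ (is_derive_sin _) h.
by congr is_derive; rewrite mulrC.
Qed.

Lemma is_derive_cosine (c x : R) : is_derive x (1:R) (fun y => cos (c * y)) (- (c * sin (c * x))).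
Proof.
have h : is_derive x (1:R) (fun y => c * y) c.
  by have := is_deriveZ c (is_derive_id x (1:R)); congr is_derive; rewrite /GRing.scale /= mulr1.
have := @is_derive1_comp _ cos (fun y => c * y) x _ _ (is_derive_cos _) h.
by congr is_derive; rewrite mulNr mulrC.
Qed.

Lemma derive_continuous (f df : R -> R) : (forall x, is_derive x (1:R) f (df x)) -> continuous f.
Proof. by move=> h x; apply: differentiable_continuous; apply/derivable1_diffP; have [] := h x. Qed.

Lemma H_sine k : H (sine k).
Proof. apply: rL2_cont => //; apply: derive_continuous; exact: is_derive_sine. Qed.

Lemma Rintegral_derive (F h : R -> R) (t : R) : t \in `[0, 1] ->
  (forall x, is_derive x (1:R) F (h x)) -> continuous h ->
  \int[mu]_(x in `[0, t]) h x = F t - F 0.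
Proof.
move=> t01 dF ch.
have cc : ccont (fun x => (h x)%:C) by split=> //= x; exact: cvg_cst.
have [_ /(_ t t01)] := primitive_cderiv (cderiv_real dF) cc.
move=> /(congr1 (@complex.Re R)); rewrite cReD /= => ->; rewrite addrAC subrr add0r.
by [].
Qed.

Lemma Rintegral_derive_open (F h : R -> R) (t : R) : t \in `[0, 1] ->
  (forall x, is_derive x (1:R) F (h x)) -> continuous h ->
  \int[mu]_(x in `]0, t[) h x = F t - F 0.
Proof.
move=> t01 dF ch; rewrite -(Rintegral_derive t01 dF ch) /Rintegral [in RHS]integral_itv_bndoo //.
have ih : rint `]0, t[ h.
  apply: (@rintS _ `[0, t]) (integrable_cont_itv 0 t ch) => //; exact: itvoo_sub.
exact: measurable_int ih.
Qed.

Lemma ip_sine_id k : (0 < k)%N -> ip (sine k) (sine k) = 1 / 2.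
Proof.
move=> k0; pose c : R := pi * k%:R.
have c0 : c != 0 by rewrite /c mulf_neq0 ?(gt_eqF (pi_gt0 _)) // pnatr_eq0 -lt0n.
have hF x : is_derive x (1:R) (fun y => (1/2) * y + (- (1/2) / c) * (sin (c * y) * cos (c * y))) (sin (c * x) * sin (c * x)).
  have h1 := is_deriveZ (1/2 : R) (is_derive_id x (1:R)).
  have h2 := is_deriveM (is_derive_sine c x) (is_derive_cosine c x).
  have h3 := is_deriveZ (- (1/2) / c) h2.
  apply: (is_derive_val (is_deriveD h1 h3)).
  rewrite /GRing.scale /=; have := cos2Dsin2 (c * x); set S := sin _; set K := cos _ => e.
  have -> : - (1 / 2) / c * (sin (c * x) * - (c * S) + cos (c * x) * (c * K)) = (1/2) * (S ^+ 2 - K ^+ 2).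
    by rewrite -/S -/K; field.
  have -> : K ^+ 2 = 1 - S ^+ 2 by rewrite -e; ring.
  by field.
rewrite /ip (Rintegral_derive_open (mem1_01 R) hF); last first.
  by move=> x; apply: continuousM; apply: derive_continuous; exact: is_derive_sine.
by rewrite /c !mulr1 !mulr0 sin0 [pi * _]mulrC sin_pi_nat; ring.
Qed.

Lemma ip_sine_neq j k : j != k -> ip (sine j) (sine k) = 0.
Proof.
move=> jk; pose u : R := pi * (j%:R - k%:R); pose v : R := pi * (j%:R + k%:R).
have u0 : u != 0 by rewrite /u mulf_neq0 ?(gt_eqF (pi_gt0 _)) // subr_eq0 eqr_nat.
have v0 : v != 0.
  rewrite /v mulf_neq0 ?(gt_eqF (pi_gt0 _)) // -natrD pnatr_eq0 addn_eq0 negb_and.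
  by case: j k jk {u u0 v} => [|j] [|k].
have hF x : is_derive x (1:R) (fun y => (1/2/u) * sin (u * y) + (- (1/2)/v) * sin (v * y)) (sine j x * sine k x).
  have h1 := is_deriveZ (1/2/u) (is_derive_sine u x).
  have h2 := is_deriveZ (- (1/2)/v) (is_derive_sine v x).
  apply: (is_derive_val (is_deriveD h1 h2)); rewrite /GRing.scale /= /sine.
  have -> : u * x = pi * j%:R * x - pi * k%:R * x by rewrite /u; ring.
  have -> : v * x = pi * j%:R * x + pi * k%:R * x by rewrite /v; ring.
  by rewrite cosB cosD; field; rewrite u0 v0.
rewrite /ip (Rintegral_derive_open (mem1_01 R) hF); last first.
  by move=> x; apply: continuousM; apply: derive_continuous; exact: is_derive_sine.
by rewrite !mulr0 sin0 !mulr1 /u /v mulrBr mulrDr sinB sinD ![pi * _]mulrC !sin_pi_nat; ring.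
Qed.

Definition coef (f : R -> R) k := ip f (sine k).

(** The remainder of the sine series, built one term at a time. By orthogonality the coefficient of
    f is also that of the current remainder, so each term lowers the squared norm by twice the
    squared coefficient. *)
Fixpoint srem (f : R -> R) n (x : R) : R :=
  if n is m.+1 then srem f m x - 2 * coef f n * sine n x else f x.

Lemma sremE f n x : srem f n x = f x - 2 * \sum_(1 <= k < n.+1) coef f k * sine k x.
Proof.
elim: n => [|n IH]; first by rewrite big_geq // mulr0 subr0.
by rewrite /= IH [in RHS]big_nat_recr //=; ring.
Qed.

Lemma H_srem f n : H f -> H (srem f n).
Proof.
by move=> hf; elim: n => //= n IH; apply: rL2B => //; apply: rL2Z => //; exact: H_sine.
Qed.

Lemma ip_srem f n j : H f -> (n < j)%N -> ip (srem f n) (sine j) = coef f j.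
Proof.
move=> hf; elim: n => //= n IH nj.
rewrite ipB //; try exact: H_sine; [|exact: H_srem|by apply: rL2Z => //; exact: H_sine].
rewrite ipZ; try exact: H_sine.
by rewrite (@ip_sine_neq n.+1 j) ?mulr0 ?subr0 ?IH ?(ltnW nj) // neq_ltn nj.
Qed.

Definition defect f n := ip (srem f n) (srem f n).

Lemma defect_rec f n : H f -> defect f n.+1 = defect f n - 2 * coef f n.+1 ^+ 2.
Proof.
move=> hf; rewrite /defect /=; set r := srem f n; set b := coef f n.+1; set s := sine n.+1.
have hr : H r by exact: H_srem. have hs : H s by exact: H_sine.
have hbs : H (fun x => 2 * b * s x) by exact: rL2Z.
have e1 h : H h -> ip (fun x => r x - 2 * b * s x) h = ip r h - 2 * b * ip s h.
  by move=> hh; rewrite ipB // ipZ.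
have hB := rL2B m01 hr hbs.
rewrite e1 // (ipC r) (ipC s) !e1 //.
rewrite (ipC s r) (ip_sine_id (ltn0Sn n)) (ip_srem hf (ltnSn n)) -/b; by field.
Qed.

Lemma defect_ge0 f n : 0 <= defect f n. Proof. exact: ip_ge0. Qed.

Lemma defect_le f m n : H f -> (m <= n)%N -> defect f n <= defect f m.
Proof.
move=> hf /subnK <-; elim: (n - m)%N => [|k IH]; first by rewrite add0n.
rewrite addSn defect_rec //; apply: le_trans IH.
by rewrite gerBl mulr_ge0 ?sqr_ge0.
Qed.

Lemma coefD f g k : H f -> H g -> coef (fun x => f x + g x) k = coef f k + coef g k.
Proof. by move=> hf hg; apply: ipD => //; exact: H_sine. Qed.

Lemma defectD f g n : H f -> H g -> defect (fun x => f x + g x) n <= 2 * defect f n + 2 * defect g n.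
Proof.
move=> hf hg; apply: le_trans (ip_parallelogram (H_srem n hf) (H_srem n hg)).
rewrite le_eqVlt; apply/orP; left; apply/eqP.
have e x : srem (fun x => f x + g x) n x = srem f n x + srem g n x.
  by elim: n => //= n ->; rewrite coefD //; ring.
exact: eq_ip.
Qed.

Lemma defectZ c f n : H f -> defect (fun x => c * f x) n = c ^+ 2 * defect f n.
Proof.
move=> hf.
have e x : srem (fun x => c * f x) n x = c * srem f n x.
  by elim: n => //= n ->; rewrite /coef ipZ //; [ring|exact: H_sine].
have hr := H_srem n hf; have hc := rL2Z c m01 hr.
by rewrite /defect (eq_ip (g := fun x => c * srem f n x) (k := fun x => c * srem f n x)) // ipZ // ipC ipZ // mulrA.
Qed.

(** One n for each e suffices, because [defect f n] decreases with n; this is convergence of the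
    sine series to f in L_2. *)
Definition sine_approx (f : R -> R) := H f /\ forall e : R, 0 < e -> exists n, defect f n <= e.

(** Functions with convergent sine series form a closed set: the defect of f is at most twice that
    of f - g plus twice that of g, and the former never exceeds the squared norm of f - g. *)
Lemma sine_approx_of_approx f : H f ->
  (forall e : R, 0 < e -> exists2 g, sine_approx g & ip (fun x => f x - g x) (fun x => f x - g x) <= e) ->
  sine_approx f.
Proof.
move=> hf h; split=> // e e0.
have [g [hg cg] ge] := h (e / 4) ltac:(lra).
have [n nh] := cg (e / 4) ltac:(lra).
exists n; have hB := rL2B m01 hf hg.
have E : defect f n = defect (fun x => (f x - g x) + g x) n.
  by congr (defect _ n); apply/funext => x; rewrite subrK.
rewrite E; apply: le_trans (defectD n hB hg) _.
have := defect_le hB (leq0n n); rewrite {2}/defect /= => h1; lra.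
Qed.

Lemma sine_approxD f g : sine_approx f -> sine_approx g -> sine_approx (fun x => f x + g x).
Proof.
move=> [hf cf] [hg cg]; split=> [|e e0]; first exact: rL2D.
have [n nh] := cf (e / 4) ltac:(lra); have [m mh] := cg (e / 4) ltac:(lra).
exists (maxn n m); apply: le_trans (defectD _ hf hg) _.
have := defect_le hf (leq_maxl n m); have := defect_le hg (leq_maxr n m); lra.
Qed.

Lemma sine_approxZ c f : sine_approx f -> sine_approx (fun x => c * f x).
Proof.
move=> [hf cf]; split=> [|e e0]; first exact: rL2Z.
have [n nh] := cf (e / (c ^+ 2 + 1)) ltac:(by rewrite divr_gt0 // ltr_wpDl ?sqr_ge0).
exists n; rewrite defectZ //; move: nh; rewrite ler_pdivlMr ?ltr_wpDl ?sqr_ge0 //.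
have := defect_ge0 f n; lra.
Qed.

Lemma sine_approxB f g : sine_approx f -> sine_approx g -> sine_approx (fun x => f x - g x).
Proof.
move=> cf cg; have := sine_approxD cf (sine_approxZ (-1) cg).
by congr sine_approx; apply/funext => x; rewrite mulN1r.
Qed.

Lemma eq_sine_approx f g : (forall x, x \in `]0, 1[ -> f x = g x) -> sine_approx f -> sine_approx g.
Proof.
move=> e [hf cf]; have hg : H g by apply: eq_rL2 hf.
split=> // d d0; have [n nh] := cf d d0; exists n; apply: le_trans nh.
have ec k : coef f k = coef g k by apply: eq_ip.
rewrite le_eqVlt; apply/orP; left; apply/eqP.
by apply: eq_ip => x x01; rewrite !sremE e //; congr (_ - _ * _); apply: eq_bigr => k _; rewrite ec.
Qed.

End SineSeries.

(** * Step functions and the sawtooth series *)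

Section Sawtooth.
Variable R : realType.
Local Notation mu := (@lebesgue_measure R).

Lemma lipschitz_of_deriv (f df : R -> R) (a b M : R) : a <= b ->
  (forall x, x \in `[a, b] -> is_derive x (1:R) f (df x)) ->
  (forall x, x \in `[a, b] -> `|df x| <= M) -> `|f b - f a| <= M * (b - a).
Proof.
move=> ab hd hM.
have cont : {within `[a, b], continuous f}.
  apply: continuous_in_subspaceT => x; rewrite inE /= => xab.
  by apply: differentiable_continuous; apply/derivable1_diffP; case: (hd x xab).
have hd' x : x \in `]a, b[ -> is_derive x (1:R) f (df x).
  by move=> xab; apply: hd; apply: subset_itv_oo_cc xab.
have [c cab ->] := MVT_segment ab hd' cont.
by rewrite normrM (ger0_norm (x := b - a)) ?subr_ge0 // ler_wpM2r ?subr_ge0 // hM.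
Qed.

(* \sum_(1 <= k <= n) sin (k u) / k - (pi - u) / 2 *)
Fixpoint saw n (u : R) : R :=
  if n is m.+1 then saw m u + n%:R^-1 * sin (n%:R * u) else 1/2 * u + - (1/2) * pi.

Fixpoint dsaw n (u : R) : R :=
  if n is m.+1 then dsaw m u + cos (n%:R * u) else 1/2.

Lemma is_derive_saw n (u : R) : is_derive u (1:R) (saw n) (dsaw n u).
Proof.
elim: n => [|n IH] /=.
  apply: (is_derive_val (is_deriveD (is_deriveZ (1/2) (is_derive_id u (1:R))) (is_derive_cst _ _ _))).
  by rewrite /GRing.scale /= mulr1 addr0.
apply: (is_derive_val (is_deriveD IH (is_deriveZ n.+1%:R^-1 (is_derive_sine n.+1%:R u)))).
by rewrite /GRing.scale /= mulrA mulVf ?mul1r ?pnatr_eq0.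
Qed.

(** [dsaw] is the Dirichlet kernel 1/2 + cos u + ... + cos (n u), in closed form. *)
Lemma dsawE n (u : R) : dsaw n u * (2 * sin (1/2 * u)) = sin ((n%:R + 1/2) * u).
Proof.
elim: n => [|n IH] /=.
  by rewrite add0r mulrA (_ : 1/2 * 2 = 1) ?mul1r //; field.
rewrite mulrDl IH.
have -> : (n%:R + 1/2) * u = n.+1%:R * u - 1/2 * u by rewrite -[n.+1%:R]natr1; field.
have -> : (n.+1%:R + 1/2) * u = n.+1%:R * u + 1/2 * u by ring.
rewrite sinB sinD; ring.
Qed.

Lemma saw_pi n : saw n pi = 0.
Proof. by elim: n => [|n IH] /=; rewrite ?IH ?sin_pi_nat; ring. Qed.

(** The derivative of [saw] oscillates without decaying. Adding cos (c v) / (N sin (v / 2)), as in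
    an integration by parts of the Dirichlet kernel, leaves a derivative of order 1 / N. Both terms
    of the corrected function F vanish at pi, so integrating from there gives the bound. *)
Lemma saw_bound n (u s : R) : 0 <= u <= 2 * pi -> 0 < s ->
  (forall v, Num.min u pi <= v <= Num.max u pi -> s <= sin (1/2 * v)) ->
  `|saw n u| <= (pi + 1) / (s ^+ 2 * (2 * n%:R + 1)).
Proof.
move=> /andP[u0 u1] s0 hs; pose c : R := n%:R + 1/2; pose N : R := 2 * n%:R + 1.
have cN : c = N / 2 by rewrite /c /N; field.
have N1 : 1 <= N by rewrite /N lerDr mulr_ge0.
have N0 : 0 < N by lra.
have s1 : s <= 1.
  by apply: le_trans (sin_le1 (1/2 * pi)); apply: hs; rewrite ge_min lexx orbT le_max lexx orbT.
pose F v := saw n v + N^-1 * (cos (c * v) * (sin (1/2 * v))^-1).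
pose dF v := - (cos (c * v) * cos (1/2 * v)) / (2 * N * sin (1/2 * v) ^+ 2).
have hF v : Num.min u pi <= v <= Num.max u pi -> is_derive v (1:R) F (dF v).
  move=> /hs sv; have S0 : sin (1/2 * v) != 0 by rewrite gt_eqF // (lt_le_trans s0).
  have h1 := is_deriveV S0 (is_derive_sine (1/2) v).
  have h2 := is_deriveM (is_derive_cosine c v) h1.
  have h3 := is_deriveZ N^-1 h2.
  apply: (is_derive_val (is_deriveD (is_derive_saw n v) h3)).
  rewrite /GRing.scale /= /dF.
  have -> : dsaw n v = sin (c * v) / (2 * sin (1/2 * v)).
    by rewrite -dsawE mulfK // mulf_neq0 // pnatr_eq0.
  set A := sin (c * v); set B := cos (c * v); set S := sin (1/2 * v) in S0 *; set K := cos (1/2 * v); rewrite cN.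
  have Nn : N != 0 by rewrite gt_eqF.
  by move: (N) Nn (S) S0 (A) (B) (K) => M Mn Z Z0 X Y W; field; rewrite ?Mn ?Z0.
have bF v : Num.min u pi <= v <= Num.max u pi -> `|dF v| <= (2 * N * s ^+ 2)^-1.
  move=> /hs sv; have S0 := lt_le_trans s0 sv.
  rewrite /dF normrM normrN normrM -[leRHS]mul1r; apply: ler_pM => //.
    by rewrite -[leRHS]mulr1; apply: ler_pM; rewrite // ler_norml ?cos_geN1 ?cos_le1.
  have D0 (x : R) : 0 < x -> 0 < 2 * N * x ^+ 2 by move=> x0; rewrite !mulr_gt0 // exprn_gt0.
  rewrite normfV (gtr0_norm (D0 _ S0)) lef_pV2 ?posrE ?D0 //.
  by rewrite ler_pM2l ?mulr_gt0 // lerXn2r ?nnegrE ?(ltW s0) ?(ltW S0).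
have p0 : 0 < (pi : R) := pi_gt0 R.
have Fpi : F pi = 0.
  rewrite /F saw_pi /c mulrDl cosD [1/2 * pi](_ : _ = pi / 2); last by rewrite mulrC mulrA mulr1.
  by rewrite cos_pihalf sin_pi_nat; ring.
have FB : `|F u| <= (2 * N * s ^+ 2)^-1 * pi.
  have Ms : 0 <= (2 * N * s ^+ 2)^-1 by rewrite invr_ge0 !mulr_ge0 ?sqr_ge0 // ltW.
  case: (leP u pi) hF bF => up hF bF.
    have := @lipschitz_of_deriv F dF u pi _ up hF bF.
    rewrite Fpi sub0r normrN => /le_trans; apply; rewrite ler_wpM2l //; lra.
  have := @lipschitz_of_deriv F dF pi u _ (ltW up) hF bF.
  rewrite Fpi subr0 => /le_trans; apply; rewrite ler_wpM2l //; lra.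
have su : s <= sin (1/2 * u) by apply: hs; rewrite ge_min lexx le_max lexx.
have S0 := lt_le_trans s0 su.
have GB : `|N^-1 * (cos (c * u) * (sin (1/2 * u))^-1)| <= N^-1 * s^-1.
  rewrite normrM ger0_norm ?invr_ge0 ?(ltW N0) // ler_wpM2l ?invr_ge0 ?(ltW N0) //.
  rewrite normrM -[leRHS]mul1r; apply: ler_pM => //; first by rewrite ler_norml cos_geN1 cos_le1.
  by rewrite normfV gtr0_norm // lef_pV2.
have -> : saw n u = F u - N^-1 * (cos (c * u) * (sin (1/2 * u))^-1) by rewrite /F addrK.
apply: le_trans (ler_normB _ _) _; apply: le_trans (lerD FB GB) _.
rewrite -/N [leRHS]mulrDl mul1r; apply: lerD.
  rewrite mulrC ler_wpM2l ?(ltW p0) // lef_pV2 ?posrE ?mulr_gt0 ?exprn_gt0 //.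
  by rewrite mulrC -mulrA ler_pMl ?mulr_gt0 ?exprn_gt0 // ler1n.
rewrite -invfM lef_pV2 ?posrE ?mulr_gt0 ?exprn_gt0 // mulrC ler_wpM2l ?(ltW N0) //.
by rewrite expr2 ler_piMr // ltW.
Qed.

(* The defect of the indicator function of ]0, t[. *)
Fixpoint bessel_gap n (t : R) : R :=
  if n is m.+1 then bessel_gap m t + - 2 * ((pi * n%:R)^-1 * (1 + - 1 * cos (pi * n%:R * t))) ^+ 2 else t.

(** Differentiating a squared coefficient gives sin x (1 - cos x) = sin x - sin (2x) / 2 with x = pi
    k t, hence sawtooth sums at pi t and 2 pi t; their linear parts combine to the derivative 1 of
    t. *)
Lemma is_derive_bessel_gap n (t : R) :
  is_derive t (1:R) (bessel_gap n) (- (4 * saw n (pi * t) - 2 * saw n (2 * pi * t)) / pi).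
Proof.
have p0 : (pi : R) != 0 by rewrite gt_eqF ?pi_gt0.
elim: n => [|n IH].
  apply: (is_derive_val (is_derive_id t (1:R))) => /=.
  by move: (pi : R) p0 => p p0; field.
rewrite [bessel_gap _]/=.
pose c : R := pi * n.+1%:R.
have c0 : c != 0 by rewrite /c mulf_neq0 // pnatr_eq0.
have h1 : is_derive t (1:R) (fun y => c^-1 * (1 + -1 * cos (c * y))) (sin (c * t)).
  have h := is_deriveD (is_derive_cst (1:R) t (1:R)) (is_deriveZ (-1) (is_derive_cosine c t)).
  apply: (is_derive_val (is_deriveZ c^-1 h)).
  by rewrite /GRing.scale /= add0r mulN1r opprK mulrA mulVf ?mul1r.
have h2 := is_deriveX 2 h1.
apply: (is_derive_val (is_deriveD IH (is_deriveZ (-2) h2))).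
rewrite /GRing.scale /= -/c expr1.
have -> : n.+1%:R * (pi * t) = c * t by rewrite /c; ring.
have -> : n.+1%:R * (2 * pi * t) = c * t + c * t by rewrite /c; ring.
have n0 : (n.+1%:R : R) != 0 by rewrite pnatr_eq0.
rewrite sinD; set S := sin _; set K := cos _; set A := saw n _; set B := saw n _.
have -> : c^-1 = pi^-1 / n.+1%:R by rewrite /c invfM.
rewrite -[n.+1%:R^-1]mul1r; move: (pi : R) p0 (n.+1%:R : R) n0 => p p0 m m0.
by field; rewrite ?p0 ?m0.
Qed.

Lemma bessel_gap_le n t : bessel_gap n t <= t.
Proof.
elim: n => //= n IH; apply: le_trans IH.
by rewrite gerDl mulNr oppr_le0 mulr_ge0 ?sqr_ge0.
Qed.

Definition step (t x : R) : R := (x < t)%R%:R.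

Lemma Rintegral_step (t : R) (h : R -> R) : 0 <= t <= 1 ->
  \int[mu]_(x in `]0, 1[) (step t x * h x) = \int[mu]_(x in `]0, t[) h x.
Proof.
move=> /andP[t0 t1].
have -> : `]0, t[%classic = `](0:R), 1[%classic `&` `]-oo, t[%classic.
  apply/seteqP; split=> x /=; rewrite !in_itv /=.
    by move=> /andP[h0 h1]; rewrite h0 h1 (lt_le_trans h1 t1).
  by move=> [/andP[-> _] ->].
rewrite Rintegral_mkcondr; apply: eq_Rintegral => x _.
by rewrite /step /patch mem_setE in_itv /=; case: ifP => _; rewrite ?mul1r ?mul0r.
Qed.

Lemma H_step t : rL2 `]0, 1[ (step t).
Proof.
apply: (@rL2_bounded _ _ _ 1) => //; first exact: itvoo_sub.
  apply: measurable_funTS.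
  have -> : step t = \1_(`]-oo, t[%classic : set R).
    by apply/funext => x; rewrite indicE mem_setE in_itv.
  exact: measurable_indic.
by move=> x _; rewrite /step; case: (x < t); rewrite ?normr1 ?normr0 ?ler01.
Qed.

Lemma defect_step t n : 0 <= t <= 1 -> defect (step t) n = bessel_gap n t.
Proof.
move=> t01; have t01' : t \in `[0, 1] by rewrite in_itv.
elim: n => [|n IH].
  rewrite /defect /= /ip Rintegral_step //.
  transitivity (\int[mu]_(x in `]0, t[) (fun=> 1 : R) x).
    by apply: eq_Rintegral => x; rewrite inE /= in_itv /= /step => /andP[_ ->].
  rewrite (Rintegral_derive_open t01' (fun x => is_derive_id x (1:R))) ?subr0 //.
  exact: cst_continuous.
rewrite defect_rec ?IH /=; last exact: H_step.
rewrite mulNr; congr (_ - 2 * _ ^+ 2).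
rewrite /coef /ip Rintegral_step //; pose c : R := pi * n.+1%:R.
have c0 : c != 0 by rewrite /c mulf_neq0 ?pnatr_eq0 // gt_eqF ?pi_gt0.
have hF x : is_derive x (1:R) (fun y => - c^-1 * cos (c * y)) (sine n.+1 x).
  apply: (is_derive_val (is_deriveZ (- c^-1) (is_derive_cosine c x))).
  by rewrite /GRing.scale /= mulrNN mulrA mulVf ?mul1r.
rewrite (Rintegral_derive_open t01' hF) -/c ?mulr0 ?cos0; first by ring.
by apply: derive_continuous; exact: is_derive_sine.
Qed.

(* The defect is at most d at a small d > 0, and its derivative tends to 0 uniformly on [d, t],
   where the sawtooth series converges uniformly. *)
Lemma sine_approx_step t : 0 < t < 1 -> sine_approx (step t).
Proof.
move=> /andP[t0 t1]; split=> [|e e0]; first exact: H_step.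
have p0 : 0 < (pi : R) := pi_gt0 R.
(* [saw_bound] needs sin (v / 2) bounded below for v between pi and pi x or 2 pi x, where x lies in
   [d, t]; these v / 2 fill part of [pi d / 2, pi t'], and t' >= 1/2 makes room for pi / 2. *)
pose d := Num.min (e / 2) (t / 2); pose t' := Num.max t (1/2).
have d0 : 0 < d by rewrite lt_min !divr_gt0.
have [de dt] : d <= e / 2 /\ d <= t / 2 by rewrite /d; split; rewrite ge_min lexx ?orbT.
have [tt' t'2] : t <= t' /\ 1/2 <= t' by rewrite /t'; split; rewrite le_max lexx ?orbT.
have t'1 : t' < 1 by rewrite gt_max t1; lra.
have sc : {within `[pi * (d / 2), pi * t'], continuous sin}.
  by apply: continuous_subspaceT; exact: continuous_sin.
have le1 : pi * (d / 2) <= pi * t' by rewrite ler_pM2l //; lra.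
have [v0 v01 hs] := EVT_min le1 sc.
pose s := sin v0.
have s0 : 0 < s.
  move: v01; rewrite in_itv /= => /andP[h1 h2]; apply: sin_gt0_pi.
  apply/andP; split; first by apply: lt_le_trans h1; rewrite mulr_gt0 // divr_gt0.
  by apply: le_lt_trans h2 _; rewrite -[ltRHS]mulr1 ltr_pM2l.
have sb x : pi * d <= x <= 2 * pi * t' -> s <= sin (1/2 * x).
  move=> /andP[h1 h2]; apply: hs; rewrite in_itv /=; apply/andP; split; lra.
(* The 6 collects the weights 4 and 2 of the two sawtooth values in the derivative of
   [bessel_gap]. *)
pose K : R := 6 * (pi + 1) / (s ^+ 2 * pi).
have K0 : 0 <= K by rewrite ltW // /K divr_gt0 // mulr_gt0 // ?exprn_gt0 // addr_gt0.
have [n hn] : exists n : nat, K / (2 * n%:R + 1) <= e / 2.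
  pose n := (Num.truncn (2 * K / e)).+1; exists n.
  have hn : 2 * K / e < n%:R by exact: truncnS_gt.
  have n0 : 0 <= (n%:R : R) by [].
  rewrite ler_pdivrMr; last by lra.
  move: hn; rewrite ltr_pdivrMr // => hn; nra.
exists n; rewrite defect_step ?(ltW t0) ?(ltW t1) //.
have N0 : 0 < 2 * n%:R + 1 :> R by have : 0 <= (n%:R : R) by []; lra.
have dK x : x \in `[d, t] -> `|- (4 * saw n (pi * x) - 2 * saw n (2 * pi * x)) / pi| <= K / (2 * n%:R + 1).
  rewrite in_itv /= => /andP[x1 x2].
  have px1 : pi * d <= pi * x by rewrite ler_pM2l.
  have px2 : pi * x <= pi * t' by rewrite ler_pM2l //; lra.
  have pt : pi * (1/2) <= pi * t' by rewrite ler_pM2l.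
  have pd : pi * d <= pi * (1/2) by rewrite ler_pM2l //; lra.
  have pd0 : 0 < pi * d by rewrite mulr_gt0.
  have pt1 : pi * t' <= pi * 1 by rewrite ler_pM2l // ltW.
  have b1 : `|saw n (pi * x)| <= (pi + 1) / (s ^+ 2 * (2 * n%:R + 1)).
    apply: saw_bound s0 _; first by apply/andP; split; lra.
    move=> v /andP[h1 h2]; apply: sb; move: h1 h2; rewrite ge_min le_max => h1 h2.
    by apply/andP; split; [case/orP : h1 => h|case/orP : h2 => h]; lra.
  have b2 : `|saw n (2 * pi * x)| <= (pi + 1) / (s ^+ 2 * (2 * n%:R + 1)).
    apply: saw_bound s0 _; first by apply/andP; split; lra.
    move=> v /andP[h1 h2]; apply: sb; move: h1 h2; rewrite ge_min le_max => h1 h2.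
    by apply/andP; split; [case/orP : h1 => h|case/orP : h2 => h]; lra.
  rewrite normrM normrN normfV (gtr0_norm p0) ler_pdivrMr //.
  apply: le_trans (ler_normB _ _) _; rewrite !normrM !normr_nat.
  have -> : K / (2 * n%:R + 1) * pi = 6 * ((pi + 1) / (s ^+ 2 * (2 * n%:R + 1))).
    have [N1 s1 p1] : [/\ 2 * n%:R + 1 != 0 :> R, s != 0 & pi != 0 :> R] by rewrite !gt_eqF.
    rewrite /K; move: (2 * n%:R + 1) N1 (s) s1 (pi : R) p1 => N N1 z s1 p p1.
    by field; rewrite ?N1 ?s1 ?p1.
  by lra.
have dt' : d <= t by lra.
have := lipschitz_of_deriv dt' (fun x _ => is_derive_bessel_gap n x) dK.
have := bessel_gap_le n d; have := ler_norm (bessel_gap n t - bessel_gap n d).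
have : K / (2 * n%:R + 1) * (t - d) <= e / 2.
  apply: le_trans hn; apply: ler_piMr; first by rewrite divr_ge0 // ltW.
  by rewrite lerBlDr; apply: (le_trans (ltW t1)); rewrite lerDl ltW.
lra.
Qed.

End Sawtooth.

(** * From step functions to all of L_2(0, 1) *)

Section Completeness.
Import HBNNSimple.
Variable R : realType.
Local Notation mu := (@lebesgue_measure R).
Local Notation D01 := (`]0, 1[%classic : set R).
Local Notation H := (rL2 D01).
Let m01 : measurable (`]0, 1[%classic : set R). Proof. exact: measurable_itv. Qed.
Let s01 : `]0, 1[%classic `<=` `[(0:R), 1]%classic. Proof. exact: itvoo_sub. Qed.

(** Dominated convergence with majorant 4 g^2 turns pointwise convergence into convergence in L_2,
    where [sine_approx_of_approx] applies. *)
Lemma sine_approx_lim (u : nat -> R -> R) (f g : R -> R) : H g -> measurable_fun D01 f ->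
  (forall n, sine_approx (u n)) ->
  (forall x, x \in `]0, 1[ -> u ^~ x @ \oo --> f x) ->
  (forall n x, x \in `]0, 1[ -> `|u n x| <= g x) -> (forall x, x \in `]0, 1[ -> `|f x| <= g x) ->
  sine_approx f.
Proof.
move=> hg mf cu uf ug fg.
have hf : H f.
  split=> //; apply: (le_rint m01 _ _ hg.2); first exact: measurable_funX.
  move=> x Dx; rewrite normrX lerXn2r ?nnegrE ?fg //.
  exact: le_trans (normr_ge0 _) (fg x Dx).
apply: sine_approx_of_approx => // e e0.
pose h n x := (f x - u n x) * (f x - u n x).
have mh n : measurable_fun D01 (h n).
  have mu_ : measurable_fun D01 (u n) by have [[]] := cu n.
  by apply: measurable_funM; apply: measurable_funB.
have hi n : rint D01 (h n).
  by have [hn _] := cu n; apply: rL2_rintM => //; exact: rL2B.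
have h0 (x : R) : D01 x -> (fun n => (h n x)%:E) @ \oo --> 0%E.
  move=> Dx; apply: cvg_EFin; first exact: nearW.
  have c0 : (fun n => f x - u n x) @ \oo --> (0 : R).
    by rewrite -[X in _ --> X](subrr (f x)); apply: cvgB; [exact: cvg_cst|exact: uf].
  by rewrite -[X in _ --> X](mul0r (0:R)); exact: (cvgM c0 c0).
have hb n (x : R) : D01 x -> (`|(h n x)%:E| <= (4 * g x ^+ 2)%:E)%E.
  move=> Dx; rewrite /= lee_fin normrM -expr2.
  have h1 : `|f x - u n x| <= 2 * g x.
    by apply: le_trans (ler_normB _ _) _; have := fg x Dx; have := ug n x Dx; lra.
  have -> : 4 * g x ^+ 2 = (2 * g x) ^+ 2 by ring.
  by rewrite lerXn2r ?nnegrE // (le_trans _ h1).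
have mh' n : measurable_fun D01 (fun x => (h n x)%:E) by apply/measurable_EFinP; exact: mh.
have h0ae : {ae mu, forall x, D01 x -> (fun n => (h n x)%:E) @ \oo --> 0%E} by apply: aeW.
have hbae : {ae mu, forall x n, D01 x -> (`|(h n x)%:E| <= (4 * g x ^+ 2)%:E)%E}.
  by apply: aeW => x n; exact: hb.
have [_ _ /=] := @dominated_convergence _ _ _ mu D01 m01 (fun n x => (h n x)%:E) (fun=> 0%E)
  (fun x => (4 * g x ^+ 2)%:E) mh' (@measurable_cst _ _ _ _ _ _)
  h0ae (integrable_scale 4 m01 hg.2) hbae.
rewrite integral0 => /fine_cvgP[_] /cvgrPdist_le/(_ e e0)[n _ /(_ n (leqnn n)) hn].
exists (u n) => //; apply: le_trans hn; rewrite sub0r normrN.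
exact: ler_norm.
Qed.

Lemma sine_approx0 : sine_approx (fun=> 0 : R).
Proof.
have := sine_approxZ 0 (sine_approx_step (t := 1/2 : R) ltac:(apply/andP; split; lra)).
by apply: eq_sine_approx => x _; rewrite mul0r.
Qed.

Lemma rL2_01 (c : R) : H (fun=> c).
Proof. exact: rL2_cst. Qed.

(** The jump at t = 1 is outside the range of [sine_approx_step], so the constant is reached as the
    limit of steps at 1 - 1 / (n + 2). *)
Lemma sine_approx1 : sine_approx (fun=> 1 : R).
Proof.
apply: (@sine_approx_lim (fun n => step (1 - n.+2%:R^-1)) _ (fun=> 1)) => //.
- exact: rL2_01.
- move=> n; apply: sine_approx_step; apply/andP; split.
    by rewrite subr_gt0 invf_lt1 // ltr1n.
  by rewrite gtrBl invr_gt0.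
- move=> x; rewrite in_itv /= => /andP[x0 x1]; apply: cvg_near_cst.
  exists (Num.truncn (1 - x)^-1) => // n /= hn; rewrite /step (_ : (_ < _)%R = true) //.
  rewrite ltrBrDl -ltrBrDr; rewrite -[ltRHS]invrK ltf_pV2 ?posrE ?invr_gt0 ?subr_gt0 //.
  apply: lt_le_trans (truncnS_gt _) _; by rewrite ler_nat ltnS (leq_trans hn).
- by move=> n x _; rewrite /step; case: (_ < _)%R; rewrite ?normr1 ?normr0.
- by move=> x _; rewrite normr1.
Qed.

Lemma sine_approx_sum n (u : nat -> R -> R) : (forall k, (k < n)%N -> sine_approx (u k)) ->
  sine_approx (fun x => \sum_(k < n) u k x).
Proof.
elim: n => [|n IH] h; first by apply: eq_sine_approx sine_approx0 => x _; rewrite big_ord0.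
apply: eq_sine_approx (sine_approxD (IH _) (h n (ltnSn n))); first by move=> x _; rewrite big_ord_recr.
by move=> k kn; apply: h; exact: ltnW.
Qed.

(** By the pi-lambda theorem: open half-lines are stable under intersection and generate the Borel
    sets, and the sets with the property are stable under complement and, by domination by 1, under
    countable disjoint union. *)
Lemma sine_approx_indic (A : set R) : measurable A -> sine_approx (\1_A : R -> R).
Proof.
have mE : @measurable _ (measurableTypeR R) = <<s @RGenInftyO.G R >>.
  exact: (RGenInftyO.measurableE R).
move=> mA; move: (mA); rewrite -[measurable A]/(@measurable _ (measurableTypeR R) A) mE.
apply: (@dynkin_induction _ (measurableTypeR R) (@RGenInftyO.G R) (fun B => sine_approx (\1_B : R -> R))) => //.
- move=> _ _ [x ->] [y ->]; exists (Num.min x y).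
  by apply/seteqP; split=> z /=; rewrite !in_itv /= lt_min; [move=> [-> ->]|move=> /andP].
- by apply: eq_sine_approx sine_approx1 => x _; rewrite indicT.
- move=> _ [t ->].
  have st x : \1_`]-oo, t[ x = step t x by rewrite indicE mem_setE in_itv.
  have [t0|t0] := leP t 0.
    apply: eq_sine_approx sine_approx0 => x; rewrite st in_itv /= => /andP[x0 _].
    by rewrite /step ltNge (le_trans t0 (ltW x0)).
  have [t1|t1] := leP 1 t.
    apply: eq_sine_approx sine_approx1 => x; rewrite st in_itv /= => /andP[_ x1].
    by rewrite /step (lt_le_trans x1 t1).
  by apply: eq_sine_approx (sine_approx_step (t := t) _); rewrite ?t0.
- move=> S _ cS; apply: eq_sine_approx (sine_approxB sine_approx1 cS) => x _.
  by rewrite !indicE in_setC; case: (x \in S); rewrite ?subrr ?subr0.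
- move=> F mF tF cF.
  have hit x i n : F i x -> \sum_(k < n) (\1_(F k) x : R) = (i < n)%N%:R.
    move=> Fi; have e (k : nat) : \1_(F k) x = (k == i)%:R :> R.
      rewrite indicE; have [->|ki] := eqVneq k i; first by rewrite mem_set.
      rewrite memNset // => Fk; move/eqP : ki; apply.
      by apply: (tF k i) => //; exists x.
    under eq_bigr do rewrite e.
    case: ltnP => [lin|nli].
      rewrite (bigD1 (Ordinal lin)) //= eqxx big1 ?addr0 // => k kl.
      by rewrite (_ : (k == i :> nat) = false) //; apply: contraNF kl => /eqP h; apply/eqP/val_inj.
    by rewrite big1 // => k _; rewrite ltn_eqF // (leq_trans (ltn_ord k)).
  have miss x n : ~ (\bigcup_k F k) x -> \sum_(k < n) (\1_(F k) x : R) = 0.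
    move=> h; rewrite big1 // => k _; rewrite indicE memNset // => Fk; apply: h.
    by exists k.
  apply: (@sine_approx_lim (fun n x => \sum_(k < n) \1_(F k) x) _ (fun=> 1)) => //.
  + exact: rL2_01.
  + by apply: measurable_indic; apply: (@bigcup_measurable _ (measurableTypeR R)) => k _; exact: mF.
  + by move=> n; exact: (sine_approx_sum (u := fun k => \1_(F k)) (fun k _ => cF k)).
  + move=> x _; have [[i _ Fi]|nF] := pselect ((\bigcup_k F k) x).
      rewrite indicE mem_set; last by exists i.
      by apply: cvg_near_cst; exists i.+1 => // n /= ni; rewrite (hit _ i) // ni.
    by rewrite indicE memNset //; apply: cvg_near_cst; apply: nearW => n; rewrite miss.
  + move=> n x _; have [[i _ Fi]|nF] := pselect ((\bigcup_k F k) x).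
      by rewrite (hit _ i) // normr_nat lern1 leq_b1.
    by rewrite miss // normr0.
  + by move=> x _; rewrite indicE normr_nat lern1 leq_b1.
Qed.

(** Increasing simple approximations are dominated by f itself. *)
Lemma sine_approx_nonneg (f : R -> R) : H f -> (forall x, x \in `]0, 1[ -> 0 <= f x) -> sine_approx f.
Proof.
move=> hf f0.
have mf : measurable_fun D01 (EFin \o f) by apply/measurable_EFinP; case: hf.
have f0' x : x \in `]0, 1[%classic -> (0%:E <= (EFin \o f) x)%E.
  by rewrite inE /= lee_fin; exact: f0.
pose u := nnsfun_approx m01 mf.
have uf (x : R) : x \in `]0, 1[ -> (fun n => u n x) @ \oo --> f x.
  move=> Dx; have := cvg_nnsfun_approx m01 mf (fun y Dy => ltac:(by rewrite lee_fin; exact: f0)) Dx.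
  by move=> /fine_cvg.
have uF n (x : R) : x \in `]0, 1[ -> u n x <= f x.
  move=> Dx; have /cvg_lim <- // := uf x Dx.
  apply: nondecreasing_cvgn_le => [i j ij|]; first by have /lefP := nd_nnsfun_approx m01 mf ij.
  by apply/cvg_ex; exists (f x); exact: uf.
apply: (@sine_approx_lim (fun n => u n) f f) => //.
- by case: hf.
- move=> n; pose s := finmap.enum_fset (fset_set (range (u n))).
  pose v k x := s`_k * \1_(u n @^-1` [set s`_k]) x.
  apply: (@eq_sine_approx _ (fun x => \sum_(k < size s) v k x)); first by move=> x _; rewrite [RHS]fimfunEord.
  by apply: sine_approx_sum => k _; apply: sine_approxZ; apply: sine_approx_indic.
- by move=> n x Dx; rewrite ger0_norm // uF.
- by move=> x Dx; rewrite ger0_norm // f0.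
Qed.

Lemma sine_approx_rL2 (f : R -> R) : H f -> sine_approx f.
Proof.
move=> hf; have [mf _] := hf.
pose p x := Num.max (f x) 0; pose q x := Num.max (- f x) 0.
have aux (g : R -> R) : measurable_fun D01 g -> (forall x, x \in `]0, 1[ -> `|g x| <= `|f x|) -> H g.
  move=> mg gf; split=> //; apply: (le_rint m01 _ _ hf.2); first exact: measurable_funX.
  by move=> x Dx; rewrite normrX -(real_normK (num_real (f x))) lerXn2r ?nnegrE // gf.
have cp : sine_approx p.
  apply: sine_approx_nonneg; last by move=> x _; rewrite le_max lexx orbT.
  apply: aux; first by apply: measurable_maxr.
  by move=> x _; rewrite /p; case: (leP (f x) 0); rewrite ?normr0.
have cq : sine_approx q.
  apply: sine_approx_nonneg; last by move=> x _; rewrite le_max lexx orbT.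
  apply: aux; first by apply: measurable_maxr => //; exact: measurableT_comp.
  by move=> x _; rewrite /q; case: (leP (- f x) 0); rewrite ?normr0 ?normrN.
apply: eq_sine_approx (sine_approxB cp cq) => x _; rewrite /p /q.
by case: (leP (f x) 0); case: (leP (- f x) 0) => *; lra.
Qed.

End Completeness.

(** * The potentials of a pair of spectra *)

Section StepOne.
Variable R : realType.
Local Notation C := R[i].
Local Notation N := (@Normc.normc R).
Local Notation mu := (@lebesgue_measure R).
Local Notation Re := complex.Re.
Local Notation Im := complex.Im.
Let m01 : measurable (`]0, 1[%classic : set R). Proof. exact: measurable_itv. Qed.
Let s01 : `]0, 1[%classic `<=` `[(0:R), 1]%classic. Proof. exact: itvoo_sub. Qed.

Definition sine_sum (c : nat -> C) n (x : R) : C :=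
  2 * \sum_(1 <= k < n) c k * (sin (pi * k%:R * x))%:C.

Lemma L2_sine_sum c n : L2 `]0, 1[ (sine_sum c n).
Proof.
apply: L2Z => //; elim: n => [|n IH].
  have [_ h] : rL2 `]0, 1[ (fun=> 0 : R) /\ rL2 `]0, 1[ (fun=> 0 : R) by split; apply: rL2_cst.
  by apply/(L2P _ m01); split; apply: (eq_rL2 m01) h => x _; rewrite big_geq.
have [n0|n0] := posnP n.
  have -> : (fun x => \sum_(1 <= k < n.+1) c k * (sin (pi * k%:R * x))%:C) =
    (fun x => \sum_(1 <= k < n) c k * (sin (pi * k%:R * x))%:C :> C).
    by apply/funext => x; rewrite n0 !big_geq.
  by [].
have -> : (fun x => \sum_(1 <= k < n.+1) c k * (sin (pi * k%:R * x))%:C) =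
    (fun x => \sum_(1 <= k < n) c k * (sin (pi * k%:R * x))%:C + c n * (sin (pi * n%:R * x))%:C :> C).
  by apply/funext => x; rewrite big_nat_recr.
apply: L2D => //; apply: L2Z => //; apply/(L2P _ m01); split.
  exact: H_sine.
exact: rL2_cst.
Qed.

Lemma L2B (f g : R -> C) : L2 `]0, 1[ f -> L2 `]0, 1[ g -> L2 `]0, 1[ (fun x => f x - g x).
Proof.
move=> hf hg; have := L2D m01 hf (L2Z (-1) m01 hg).
by congr (L2 _ _); apply/funext => x; rewrite mulN1r.
Qed.

Lemma sqnorm2_ip (f : R -> C) : L2 `]0, 1[ f ->
  sqnorm2 `]0, 1[ f = (ip (fun x => Re (f x)) (fun x => Re (f x)) + ip (fun x => Im (f x)) (fun x => Im (f x)))%:E.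
Proof.
move=> /(L2P _ m01)[h1 h2]; rewrite (sqnorm2_rint m01 h1 h2); by congr (_ + _)%:E; apply: eq_Rintegral => x _; rewrite expr2.
Qed.

Lemma Re_muln (z : C) n : Re (z *+ n) = Re z *+ n.
Proof. by elim: n => // n IH; rewrite !mulrS cReD IH. Qed.

Lemma Im_muln (z : C) n : Im (z *+ n) = Im z *+ n.
Proof. by elim: n => // n IH; rewrite !mulrS cImD IH. Qed.

Lemma sqnorm2_sine_sum alpha (w : R -> C) n : L2 `]0, 1[ w ->
  sqnorm2 `]0, 1[ (fun x => w x - sine_sum (fun k => f_of alpha (Delta_of alpha w) (pi * k%:R)) n x) =
  (defect (fun x => Re (w x)) n.-1 + defect (fun x => Im (w x)) n.-1)%:E.
Proof.
move=> L2w; have iw := cint_open L2w.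
(* The sum over 1 <= k < n is [srem] at n.-1; for n = 0 and for n = 1 it is empty alike. *)
have nE : ((n.-1).+1 = n \/ n = 0)%N by case: n; [right|left].
have idx (c : nat -> C) : \sum_(1 <= k < (n.-1).+1) c k = \sum_(1 <= k < n) c k :> C.
  by case: nE => ->.
have idxR (c : nat -> R) : \sum_(1 <= k < (n.-1).+1) c k = \sum_(1 <= k < n) c k :> R.
  by case: nE => ->.
rewrite sqnorm2_ip; last by apply: L2B => //; exact: L2_sine_sum.
have rf k : Re (f_of alpha (Delta_of alpha w) (pi * k%:R)) = coef (fun x => Re (w x)) k.
  rewrite f_of_Delta //=; apply: eq_Rintegral => x _.
  by rewrite cReM /= mul0r subr0 mulrC.
have imf k : Im (f_of alpha (Delta_of alpha w) (pi * k%:R)) = coef (fun x => Im (w x)) k.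
  rewrite f_of_Delta //=; apply: eq_Rintegral => x _.
  by rewrite cImM /= mul0r addr0 mulrC.
congr (_ + _)%:E; apply: eq_ip => x _.
all: rewrite sremE idxR /sine_sum.
1,2: rewrite cReD cReN mulr_natl Re_muln Re_sum [in RHS]mulr_natl; congr (_ - _ *+ 2).
1,2: by apply: eq_bigr => k _; rewrite cReM /= mulr0 subr0 rf.
all: rewrite cImD cImN mulr_natl Im_muln Im_sum [in RHS]mulr_natl; congr (_ - _ *+ 2).
all: by apply: eq_bigr => k _; rewrite cImM /= mulr0 add0r imf.
Qed.

Lemma sine_sum_cvg alpha (w : R -> C) : L2 `]0, 1[ w ->
  sqnorm2 `]0, 1[ (fun x => w x - sine_sum (fun k => f_of alpha (Delta_of alpha w) (pi * k%:R)) n x)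
    @[n --> \oo] --> 0%E.
Proof.
move=> L2w; under eq_fun do rewrite sqnorm2_sine_sum //.
have /(L2P _ m01)[h1 h2] := L2w.
apply: cvg_EFin; first exact: nearW.
apply/cvgrPdist_le => e e0.
have [_ /(_ (e / 2) ltac:(lra))[i hi]] := sine_approx_rL2 h1.
have [_ /(_ (e / 2) ltac:(lra))[j hj]] := sine_approx_rL2 h2.
exists (maxn i j).+1 => // n /= hn.
have [ni nj] : (i <= n.-1)%N /\ (j <= n.-1)%N.
  by move: hn; case: n => // n; rewrite ltnS geq_max => /andP.
rewrite sub0r normrN ger0_norm ?addr_ge0 ?defect_ge0 //.
have := defect_le h1 ni; have := defect_le h2 nj; lra.
Qed.

Lemma spectrum_step1 (q : R -> C) (a : R) (alpha : bool) lam : 0 < a -> a < 1 -> L2 `]0, 1[ q ->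
  is_spectrum q a ((-1) ^+ alpha) lam -> numbered alpha lam -> step1 alpha lam (wave a alpha q).
Proof.
move=> a0 a1 L2q [Delta /(characteristic_wave a0 a1 _ _ L2q) DE spec] num.
have L2w := L2_wave a0 a1 alpha L2q; have iw := cint_open L2w.
have eD : entire Delta by rewrite DE; exact: entire_Delta_of.
have [K HK] := Delta_of_growth alpha iw.
exists Delta.
  move=> z; apply/cvgn_normc => e e0.
  by apply: (partial_Delta_cvg num (spectrum_factor eD spec) (K := K)); rewrite // DE.
by split=> //; rewrite DE; exact: sine_sum_cvg.
Qed.

Lemma sqnorm2_eq0 (f : R -> C) : L2 `]0, 1[ f -> sqnorm2 `]0, 1[ f = 0%E ->
  {ae mu, forall x, x \in `]0, 1[ -> f x = 0}.
Proof.
move=> L2f f0; have /(L2P _ m01)[[m1 h1] [m2 h2]] := L2f.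
have mf : measurable_fun (`]0, 1[%classic : set R) (fun x => (N (f x) ^+ 2)%:E).
  apply/measurable_EFinP; apply: (eq_measurable_fun (fun x => Re (f x) ^+ 2 + Im (f x) ^+ 2)).
    by move=> x _; rewrite normc_sqr.
  by apply: measurable_funD; apply: measurable_funX.
have := (ae_eq_integral_abs mu m01 mf).1.
have -> : (\int[mu]_(x in `]0%R, 1%R[) `|(N (f x) ^+ 2)%:E|)%E = sqnorm2 `]0, 1[ f.
  by apply: eq_integral => x _; rewrite gee0_abs // lee_fin sqr_ge0.
move=> /(_ f0); apply: ae_mono => x H x01.
have /(congr1 fine)/= /eqP := H x01.
by rewrite expf_eq0 /= normc_eq0 => /eqP.
Qed.

(** [step1] is a relation, fixing w only almost everywhere. The pointwise limit of the products is
    unique, so both functions are limits in L_2 of one and the same sine series. *)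
Lemma step1_unique alpha lam (w w' : R -> C) : step1 alpha lam w -> step1 alpha lam w' ->
  {ae mu, forall x, x \in `]0, 1[ -> w x = w' x}.
Proof.
move=> [D1 hD1 [L2w cw]] [D2 hD2 [L2w' cw']].
have DE : D1 = D2 by apply/funext => z; apply: cvg_unique (hD1 z) (hD2 z).
have hB := L2B L2w L2w'.
have : {ae mu, forall x, x \in `]0, 1[ -> w x - w' x = 0}.
  apply: sqnorm2_eq0 => //; apply/eqP; rewrite eq_le; apply/andP; split; last first.
    by apply: integral_ge0 => x _; rewrite lee_fin sqr_ge0.
  pose c k := f_of alpha D2 (pi * k%:R).
  have hs (v : R -> C) n : L2 `]0, 1[ v -> L2 `]0, 1[ (fun x => v x - sine_sum c n x).
    by move=> hv; apply: L2B => //; exact: L2_sine_sum.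
  rewrite DE in cw.
  move: cw cw' => /fine_cvgP[_ cw] /fine_cvgP[_ cw'].
  pose A (v : R -> C) n := fine (sqnorm2 `]0, 1[ (fun x => v x - sine_sum c n x)).
  have c2 : (fun n => 2 * A w n + 2 * A w' n) @ \oo --> (2 * 0 + 2 * 0 : R).
    by apply: cvgD; apply: cvgM; [exact: cvg_cst|exact: cw|exact: cvg_cst|exact: cw'].
  rewrite sqnorm2_ip // lee_fin; rewrite !mulr0 addr0 in c2.
  apply: (cvgr_to_ge c2); apply: nearW => n.
  rewrite /A !sqnorm2_ip /=; try exact: hs.
  have /(L2P _ m01)[h1 h2] := hs w n L2w; have /(L2P _ m01)[h3 h4] := hs w' n L2w'.
  have par (f g f' : R -> R) : rL2 `]0, 1[ f -> rL2 `]0, 1[ g -> (forall x, f' x = f x - g x) ->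
      ip f' f' <= 2 * ip f f + 2 * ip g g.
    move=> hf hg e; have := ip_parallelogram hf (rL2Z (-1) m01 hg).
    have -> : ip (fun x => -1 * g x) (fun x => -1 * g x) = ip g g.
      by apply: eq_Rintegral => x _; rewrite !mulN1r mulrNN.
    by rewrite (eq_ip (g := f') (k := f')) // => x _; rewrite e mulN1r.
  have ReB x : Re (w x - w' x) = Re (w x - sine_sum c n x) - Re (w' x - sine_sum c n x).
    by rewrite !cReD !cReN; ring.
  have ImB x : Im (w x - w' x) = Im (w x - sine_sum c n x) - Im (w' x - sine_sum c n x).
    by rewrite !cImD !cImN; ring.
  have := par _ _ (fun x => Re (w x - w' x)) h1 h3 (fun x => ReB x).
  have := par _ _ (fun x => Im (w x - w' x)) h2 h4 (fun x => ImB x).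
  lra.
by apply: ae_mono => x H x01; apply/eqP; rewrite -subr_eq0 H.
Qed.

End StepOne.

(** * Recovering the potential from its fold *)

Section Reconstruction.
Variable R : realType.
Local Notation C := R[i].
Local Notation mu := (@lebesgue_measure R).

Lemma ae_neq (c : R) : {ae mu, forall x, x <> c}.
Proof.
exists [set c]; split => //; first exact: lebesgue_measure_set1.
by move=> x /= /contrapT ->.
Qed.

Variable a : R.

Let m01 : measurable (`]0, 1[%classic : set R). Proof. exact: measurable_itv. Qed.
Let m0a : measurable (`]0, a[%classic : set R). Proof. exact: measurable_itv. Qed.

Lemma fold_low (a0 : 0 < a) (a12 : a <= 1 / 2) (q : R -> C) x : x \in `]0, a[ -> fold a q x = q (a - x) + q (a + x).
Proof.
rewrite in_itv /= => /andP[x0 xa]; rewrite /fold /zero_ext !mem_setE !in_itv /= x0 xa !isomE.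
by have -> : x < 1 - a by lra.
Qed.

Lemma fold_mid (a0 : 0 < a) (a12 : a <= 1 / 2) (q : R -> C) x : x \in `]a, (1 - a)[ -> fold a q x = q (a + x).
Proof.
rewrite in_itv /= => /andP[xa x1]; rewrite /fold /zero_ext !mem_setE !in_itv /= x1 !isomE.
by rewrite (ltNge x a) (ltW xa) andbF add0r (lt_trans a0 xa).
Qed.

Lemma fold_high (a0 : 0 < a) (a12 : a <= 1 / 2) (q : R -> C) x : 1 - a < x -> fold a q x = 0.
Proof.
move=> xa; rewrite /fold /zero_ext !mem_setE !in_itv /=.
have -> : (x < a) = false by apply/negbTE; rewrite -leNgt; lra.
have -> : (x < 1 - a) = false by apply/negbTE; rewrite -leNgt; lra.
by rewrite !andbF addr0.
Qed.

(** For x < a the point 1 - x is farther than 1 - a from 0, and no point of (0, 1) lies at such a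
    distance from a <= 1/2; the reflected half of the wave vanishes there. *)
Lemma wave_low (a0 : 0 < a) (a12 : a <= 1 / 2) (q : R -> C) x : x \in `]0, a[ -> wave a false q x = q (a - x) + q (a + x).
Proof.
move=> x0a; rewrite /wave fold_low // fold_high ?mulr0 ?addr0 // isomE.
by move: x0a; rewrite in_itv /= => /andP[_ xa]; lra.
Qed.

Lemma wave_half_sum (q : R -> C) x : (wave a false q x + wave a true q x) / 2 = fold a q x.
Proof. by rewrite /wave expr0 expr1; field. Qed.

(** On (0, a) the fold is q(a - x) + q(a + x), which Step 3 makes equal to w_0 whatever the values
    q(a - x); on (a, 1 - a) it is given by Step 4, and beyond it is 0. So the fold depends on w_0
    and w_1 alone. *)
Lemma fold_ae (a0 : 0 < a) (a12 : a <= 1 / 2) (q q' : R -> C) (w w' : bool -> R -> C) :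
  (forall alpha, {ae mu, forall x, x \in `]0, 1[ -> w alpha x = w' alpha x}) ->
  {ae mu, forall x, x \in `]0, a[ -> q (a + x) = w false x - q (a - x)} ->
  {ae mu, forall x, x \in `]0, a[ -> q' (a + x) = w' false x - q' (a - x)} ->
  {ae mu, forall x, x \in `](2 * a), 1[ -> q x = (w false (x - a) + w true (x - a)) / 2} ->
  {ae mu, forall x, x \in `](2 * a), 1[ -> q' x = (w' false (x - a) + w' true (x - a)) / 2} ->
  {ae mu, forall x, x \in `]0, 1[ -> fold a q x = fold a q' x}.
Proof.
move=> ww lq lq' hq hq'.
have := ae_isom false a hq'; have := ae_isom false a hq.
move=> hq1 hq1'.
apply: ae_mono (ae_and (ae_and (ww false) (ww true)) (ae_and (ae_and lq lq') (ae_and (ae_and hq1 hq1')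
  (ae_and (ae_neq a) (ae_neq (1 - a)))))) => x.
rewrite !isomE in_itv /= => -[[w0 w1] [[l l'] [[h h'] [xa xa']]]] x01.
have /andP[x0 x1] := x01.
have [xa1|ax] := ltP x a.
  by rewrite !fold_low ?in_itv /= ?x0 ?xa1 // l ?l' ?in_itv /= ?x0 ?xa1 // w0 //; ring.
have ax1 : a < x by rewrite lt_neqAle ax andbT eq_sym; apply/eqP.
have [xb|bx] := ltP x (1 - a).
  have xm : a + x \in `](2 * a), 1[ by rewrite in_itv /=; apply/andP; split; lra.
  rewrite !fold_mid ?in_itv /= ?ax1 // h // h' //.
  have -> : a + x - a = x by ring.
  by rewrite w0 // w1.
have bx1 : 1 - a < x by rewrite lt_neqAle bx andbT eq_sym; apply/eqP.
by rewrite !fold_high.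
Qed.

Lemma wave_ae alpha (q q' : R -> C) : {ae mu, forall x, x \in `]0, 1[ -> fold a q x = fold a q' x} ->
  {ae mu, forall x, x \in `]0, 1[ -> wave a alpha q x = wave a alpha q' x}.
Proof.
move=> h; apply: ae_mono (ae_and h (ae_isom true 1 h)) => x [h1 h2] x01.
rewrite /wave h1 // h2 // isomE in_itv /=.
by move: x01; rewrite in_itv /= => /andP[? ?]; apply/andP; split; lra.
Qed.

Lemma Delta_of_ae alpha (w w' : R -> C) : L2 `]0, 1[ w -> L2 `]0, 1[ w' ->
  {ae mu, forall x, x \in `]0, 1[ -> w x = w' x} -> Delta_of alpha w = Delta_of alpha w'.
Proof.
move=> /cint_open iw /cint_open iw' h; apply/funext => l; congr (_ - _).
apply: cintegral_ae => //; try by apply: cintM01 => //; exact: ccont_sinl.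
by apply: ae_mono h => x H x01; rewrite H.
Qed.

Lemma wave_equations (a0 : 0 < a) (a12 : a <= 1 / 2) (q : R -> C) :
  {ae mu, forall x, x \in `]0, a[ -> q (a + x) = wave a false q x - q (a - x)} /\
  {ae mu, forall x, x \in `](2 * a), 1[ -> q x = (wave a false q (x - a) + wave a true q (x - a)) / 2}.
Proof.
split; apply: aeW => x; first by move=> x0a; rewrite wave_low //; ring.
rewrite in_itv /= => /andP[x1 x2]; rewrite wave_half_sum fold_mid //; first by congr q; ring.
by rewrite in_itv /=; apply/andP; split; lra.
Qed.

(** The three clauses describe q through a - x, a + x and x. Reflecting and translating the
    exceptional null sets brings them to the same variable, and the points a and 2a are
    discarded. *)
Lemma constructed_unique (a0 : 0 < a) (a12 : a <= 1 / 2) (lam : bool -> nat -> C) (p q q' : R -> C) :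
  constructed lam a p q -> constructed lam a p q' ->
  {ae mu, forall x, x \in `]0, 1[ -> q' x = q x}.
Proof.
move=> [L2q [w [sw pq lq hq]]] [L2q' [w' [sw' pq' lq' hq']]].
have ww alpha := step1_unique (sw alpha) (sw' alpha).
have P1 := ae_isom true a (ae_and pq pq').
have P2 := ae_isom false (- a) (ae_and (ae_and (ww false) (ww true)) (ae_and (ae_and lq lq') (ae_and pq pq'))).
apply: ae_mono (ae_and P1 (ae_and P2 (ae_and (ae_and hq hq') (ae_and (ae_neq a) (ae_neq (2 * a)))))) => x.
rewrite !isomE => -[[p1 p1'] [[[w0 w1] [[l l'] [p2 p2']]] [[h h'] [xa x2a]]]].
rewrite in_itv /= => /andP[x0 x1].
have [xa1|ax] := ltP x a.
  have x0a : a - x \in `]0, a[ by rewrite in_itv /=; apply/andP; split; lra.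
  have e : a - (a - x) = x by ring.
  by move: (p1 x0a) (p1' x0a); rewrite e => -> ->.
have ax1 : a < x by rewrite lt_neqAle ax andbT eq_sym; apply/eqP.
have [x2|x2] := ltP x (2 * a).
  have x0a : - a + x \in `]0, a[ by rewrite in_itv /=; apply/andP; split; lra.
  have x01 : - a + x \in `]0, 1[ by rewrite in_itv /=; apply/andP; split; lra.
  have e : a + (- a + x) = x by ring.
  by move: (l x0a) (l' x0a); rewrite e p2 // p2' // w0 // => -> ->.
have x21 : 2 * a < x by rewrite lt_neqAle x2 andbT eq_sym; apply/eqP.
have xm : x \in `](2 * a), 1[ by rewrite in_itv /= x21.
have x01 : - a + x \in `]0, 1[ by rewrite in_itv /=; apply/andP; split; lra.
by rewrite h // h' // [x - a]addrC w0 // w1.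
Qed.

(** The three pieces are glued as extensions by zero. The last one is [qstar] itself: beyond 2a,
    Step 4 returns the fold of [qstar] at x - a, which is [qstar x]. *)
Lemma constructed_exists (a0 : 0 < a) (a12 : a <= 1 / 2) (lam : bool -> nat -> C) (p qstar : R -> C) : L2 `]0, 1[ qstar -> L2 `]0, a[ p ->
  (forall alpha, step1 alpha (lam alpha) (wave a alpha qstar)) -> exists q, constructed lam a p q.
Proof.
move=> L2q L2p sq.
have a1 : a < 1 by lra.
pose w := wave a false qstar.
have L2w : L2 `]0, 1[ w by exact: (L2_wave a0 a1).
have pre : isom false (- a) @^-1` `]0, a[ = `]a, (2 * a)[%classic.
  by apply/seteqP; split=> x /=; rewrite !in_itv /= isomE => /andP[? ?]; apply/andP; split; lra.
pose f1 := zero_ext `]0, a[ (fun x => p (isom true a x)).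
pose f2 := zero_ext `]a, (2 * a)[ (fun x => w (isom false (- a) x) + -1 * p (isom false (- a) x)).
pose f3 := zero_ext `](2 * a), 1[ qstar.
exists (fun x => f1 x + (f2 x + f3 x)); split.
  have m2a : measurable (`]a, (2 * a)[%classic : set R) by exact: measurable_itv.
  have m21 : measurable (`](2 * a), 1[%classic : set R) by exact: measurable_itv.
  apply: L2D => //; first by apply: L2_zero_ext => //; rewrite -(preimage_low a); exact: L2_isom.
  apply: L2D => //; apply: L2_zero_ext => //; last first.
    by apply: L2S L2q => //; apply: subset_itvr; rewrite bnd_simp; lra.
  have L2h : L2 `]0, a[ (fun x => w x + -1 * p x).
    by apply: L2D => //; [apply: L2S L2w => //; exact: sub_low|exact: L2Z].
  by rewrite -pre; exact: (L2_isom false (- a) m0a L2h).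
have f1E x : 0 < x -> x < a -> f1 x + (f2 x + f3 x) = p (a - x).
  move=> x0 xa; rewrite /f1 /f2 /f3 /zero_ext !mem_setE !in_itv /= x0 xa !isomE.
  have -> : (a < x) = false by apply/negbTE; rewrite -leNgt; lra.
  have -> : (2 * a < x) = false by apply/negbTE; rewrite -leNgt; lra.
  by rewrite /= !addr0.
have f2E x : a < x -> x < 2 * a -> f1 x + (f2 x + f3 x) = w (x - a) - p (x - a).
  move=> xa x2; rewrite /f1 /f2 /f3 /zero_ext !mem_setE !in_itv /= xa x2 !isomE [- a + x]addrC.
  have -> : (x < a) = false by apply/negbTE; rewrite -leNgt; lra.
  have -> : (2 * a < x) = false by apply/negbTE; rewrite -leNgt; lra.
  by rewrite andbF /= add0r addr0 mulN1r.
exists (fun alpha => wave a alpha qstar); split=> //.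
- apply: aeW => x; rewrite in_itv /= => /andP[x0 xa].
  by rewrite f1E; [congr p; ring|lra|lra].
- apply: aeW => x; rewrite in_itv /= => /andP[x0 xa].
  rewrite f2E; [|lra|lra]; rewrite f1E; [|lra|lra].
  have -> : a + x - a = x by ring.
  by have -> : a - (a - x) = x by ring.
- apply: aeW => x x2; rewrite wave_half_sum; have := x2; rewrite in_itv /= => /andP[x1 x1'].
  rewrite fold_mid //; last by rewrite in_itv /=; apply/andP; split; lra.
  rewrite /f1 /f2 /f3 /zero_ext !mem_setE !in_itv /= x1 x1'.
  have -> : (x < a) = false by apply/negbTE; rewrite -leNgt; lra.
  have -> : (x < 2 * a) = false by apply/negbTE; rewrite -leNgt; lra.
  by rewrite !andbF /= !add0r; congr qstar; ring.
Qed.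

End Reconstruction.

Theorem theorem8 (R : realType) (a : R) (qstar : R -> R[i])
    (lam : bool -> nat -> R[i]) :
  0 < a -> a <= 1 / 2 ->
  L2 `]0, 1[ qstar ->
  (forall alpha : bool, is_spectrum qstar a ((-1) ^+ alpha) (lam alpha)) ->
  (forall alpha : bool, numbered alpha (lam alpha)) ->
  (forall p : R -> R[i], L2 `]0, a[ p ->
     exists2 q : R -> R[i], constructed lam a p q &
       forall q' : R -> R[i], constructed lam a p q' ->
         {ae @lebesgue_measure R, forall x, x \in `]0, 1[ -> q' x = q x}) /\
  [set q : R -> R[i] | L2 `]0, 1[ q /\
     forall alpha : bool, is_spectrum q a ((-1) ^+ alpha) (lam alpha)] =
  [set q : R -> R[i] | exists2 p : R -> R[i],
     L2 `]0, a[ p & constructed lam a p q].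
Proof.
move=> a0 a12 L2s specs num.
have a1 : a < 1 by lra.
have sstar alpha := spectrum_step1 a0 a1 L2s (specs alpha) (num alpha).
split=> [p L2p|].
  have [q cq] := constructed_exists a0 a12 L2s L2p sstar.
  by exists q => // q'; exact: constructed_unique cq.
apply/seteqP; split=> q /=.
  (* The parameter p of a given q is its own reflection x -> q(a - x) on (0, a), as Step 2 demands,
     and the waves of q are the functions of Step 1. *)
  move=> [L2q specq]; exists (fun x => q (isom true a x)).
    rewrite -(preimage_low a); apply: L2_isom; first exact: measurable_itv.
    by apply: L2S L2q; [exact: measurable_itv|exact: measurable_itv|exact: sub_low].
  have [lq hq] := wave_equations a0 a12 q.
  split=> //; exists (fun alpha => wave a alpha q); split=> //.
    by move=> alpha; exact: spectrum_step1.
  by apply: aeW => x _; rewrite isomE.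
move=> [p _ [L2q [w [sw _ lq hq]]]]; split=> // alpha.
have [ls hs] := wave_equations a0 a12 qstar.
(* By uniqueness in Step 1, the functions w of the construction are the waves of [qstar]; so q and
   [qstar] have the same fold, the same waves and the same characteristic functions, and the
   spectrum carries over with its multiplicities. *)
have wq := wave_ae alpha (fold_ae a0 a12 (fun b => step1_unique (sw b) (sstar b)) lq ls hq hs).
have E := Delta_of_ae alpha (L2_wave a0 a1 alpha L2q) (L2_wave a0 a1 alpha L2s) wq.
have [Delta /(characteristic_wave a0 a1 _ _ L2s) DE spec] := specs alpha.
by exists Delta => //; apply/(characteristic_wave a0 a1 _ _ L2q); rewrite E.
Qed.
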